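(* Let $c=e^{2\pi}/1728$. There is a constant $C_0$ such that for every even $k\ge4$ and every integer $0\le m\le\ell$, every zero $z\in\mathcal F$ of the Miller form $g_{k,m}$ satisfies \[\Im z<\frac{2\log k}{1-c}+C_0.\]
   Context: $\mathfrak H$ is the upper half-plane, $q=e^{2\pi iz}$, $\mathcal F=\{z\in\mathfrak H:|\Re z|\le1/2,|z|\ge1\}$. For an even integer $k\ge4$ write $k=12\ell+k'$ with $k'\in\{0,4,6,8,10,14\}$, so $\ell+1=\dim M_k$ ($M_k$ the holomorphic level-one modular forms of weight $k$). For $0\le m\le\ell$ the Miller form $g_{k,m}$ is the unique element of $M_k$ with $q$-expansion $q^m+O(q^{\ell+1})$. *)

(* Defs.v *)
From Stdlib Require Import Reals Arith.
From Coquelicot Require Import Coquelicot.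
Open Scope R_scope.

Definition in_H (z : C) : Prop := 0 < Im z.

(* q = e^{2 pi i z} = e^{-2 pi y}(cos 2 pi x + i sin 2 pi x). *)
Definition qpar (z : C) : C :=
  (exp (- 2 * PI * Im z) * cos (2 * PI * Re z),
   exp (- 2 * PI * Im z) * sin (2 * PI * Re z)).

(* Holomorphic level-one modular forms of weight k:
   holomorphic on H (complex differentiable at every point of H),
   invariant of weight k under SL_2(Z), and bounded as Im z -> oo
   (holomorphic at the cusp). *)
Definition is_modular_form (k : nat) (f : C -> C) : Prop :=
  (forall z, in_H z -> @ex_derive C_AbsRing C_NormedModule f z) /\
  (forall (a b c d : Z) (z : C), (a * d - b * c)%Z = 1%Z -> in_H z ->
     f (Cdiv (Cplus (Cmult (IZR a) z) (IZR b)) (Cplus (Cmult (IZR c) z) (IZR d)))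
     = Cmult (Cpow (Cplus (Cmult (IZR c) z) (IZR d)) k) (f z)) /\
  (exists M : R, forall z, 1 <= Im z -> Cmod (f z) <= M).

(* ell with k = 12 ell + k', k' in {0,4,6,8,10,14}; ell + 1 = dim M_k. *)
Definition ell (k : nat) : nat :=
  if Nat.eqb (k mod 12) 2 then (k / 12 - 1)%nat else (k / 12)%nat.

Definition has_miller_expansion (k m : nat) (f : C -> C) : Prop :=
  exists a : nat -> C,
    (forall n, (n <= ell k)%nat -> a n = (if Nat.eqb n m then RtoC 1 else RtoC 0)) /\
    (forall z, in_H z -> is_series (fun n => Cmult (a n) (Cpow (qpar z) n)) (f z)).

Definition is_miller_form (k m : nat) (f : C -> C) : Prop :=
  is_modular_form k f /\ has_miller_expansion k m f.

Definition in_F (z : C) : Prop :=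
  in_H z /\ Rabs (Re z) <= 1 / 2 /\ 1 <= Cmod z.

Definition cconst : R := exp (2 * PI) / 1728.

(* Main.v *)
Require Import Defs.
From Stdlib Require Import Reals Arith Lra Lia Psatz Machin ClassicalEpsilon.
From Coquelicot Require Import Coquelicot.
Open Scope R_scope.

(** Write [k = 12 l + 4 a + 6 b] with [a <= 2], [b <= 1], [l = ell k].  The forms
    [E4^(a+3(l-s)) E6^b Delta^s], [0 <= s <= l], have [q]-expansions [q^s + O(q^(s+1))] whose later
    coefficients are bounded by [(C k)^i], because each of them is a product of at most [k] series
    with constant term [1] and geometrically bounded coefficients.  Solving the triangular system
    gives [g = sum_i gamma_i E4^(a+3(l-m-i)) E6^b Delta^(m+i)] with [gamma_0 = 1] and
    [|gamma_i| <= (2 C k)^i], so [g] cannot vanish once [|Delta / E4^3| ~ |q|] is smaller than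
    [1 / (C' k)].  This bounds the height of the zeros by [ln k / (2 PI) + C0].

    The representation of [g] requires that a form of weight [k] that is [O(q^(l+1))] vanishes.
    If [a_N q^N] were its first nonzero term, then its product with
    [E4^(2-a+3(N-l-1)) E6^(1-b) / Delta^N] would have weight two and constant term [a_N].  A weight
    two [q]-series has constant term zero: its termwise primitive takes values differing by
    this constant at the two corners of the fundamental domain, while invariance of [W dz] under
    [z |-> -1/z] makes them equal.

    The modularity of [E4] and [E6] comes from Lipschitz' formula for [sum_n (z+n)^(-k)], obtained
    as the limit of the duplication formula for [phi(q) = sum_d d^(k-1) q^d]. *)

(** * Series of complex numbers *)

(** All analysis takes place on the disc |q| <= 1/220. It contains the image of the fundamental
    domain, whose corners have |q| = exp(-pi sqrt 3), about 1/231, and it is small enough for Delta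
    / q to stay within 9/10 of 1 in the norm sum |a_n| [rad]^n. That single estimate does the work
    of the product formula: Delta has no zero on the disc, and q / Delta is again a power series of
    bounded norm. The corners must lie strictly inside, because the primitive of a weight two series
    has to be differentiated on the closed arc joining them.

    The values 240, 504 and 1728 are never computed. The Eisenstein series come with coefficients (2
    pi)^4 / (6 zeta(4)) and -(2 pi)^6 / (120 zeta(6)), known only to lie in short intervals, and
    Delta is normalised by 3 alpha + 2 beta.

    The vanishing argument stands in for the valence formula. It uses invariance under z |-> -1/z on
    an arc of the unit circle only, so that a subdivision of the arc can replace contour
    integration.

    The height obtained has slope 1 / (2 pi) in ln k, far below 2 / (1 - c), which exceeds 2 because
    0 < c < 1. *)

Fixpoint csum (f : nat -> C) (n : nat) : C :=
  match n with O => RtoC 0 | S p => (csum f p + f p)%C end.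

Fixpoint rsum (f : nat -> R) (n : nat) : R :=
  match n with O => 0 | S p => rsum f p + f p end.

(** Plain epsilon-N convergence for [Cmod]. Since [csum a n] stops before index [n], [csums] is the
    usual sum of the series; [csums_of_is_series] transfers from the filter formulation. *)
Definition ccv (u : nat -> C) (l : C) : Prop :=
  forall eps, 0 < eps -> exists N, forall n, (N <= n)%nat -> Cmod (u n - l) < eps.

Definition csums (a : nat -> C) (l : C) : Prop := ccv (csum a) l.

Lemma csum_ext f g n : (forall i, (i < n)%nat -> f i = g i) -> csum f n = csum g n.
Proof.
  induction n as [|n IH]; intros H; simpl; auto.
  rewrite IH, H; auto.
Qed.

Lemma rsum_ext f g n : (forall i, (i < n)%nat -> f i = g i) -> rsum f n = rsum g n.
Proof.
  induction n as [|n IH]; intros H; simpl; auto.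
  rewrite IH, H; auto.
Qed.

Lemma csum_plus f g n : csum (fun i => f i + g i)%C n = (csum f n + csum g n)%C.
Proof. induction n as [|n IH]; simpl; [|rewrite IH]; ring. Qed.

Lemma csum_scal c f n : csum (fun i => c * f i)%C n = (c * csum f n)%C.
Proof. induction n as [|n IH]; simpl; [|rewrite IH]; ring. Qed.

Lemma csum_0 f n : (forall i, (i < n)%nat -> f i = RtoC 0) -> csum f n = RtoC 0.
Proof.
  induction n as [|n IH]; intros H; simpl; auto.
  rewrite IH, H; auto. ring.
Qed.

Lemma rsum_plus f g n : rsum (fun i => f i + g i) n = rsum f n + rsum g n.
Proof. induction n as [|n IH]; simpl; [|rewrite IH]; ring. Qed.

Lemma rsum_scal c f n : rsum (fun i => c * f i) n = c * rsum f n.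
Proof. induction n as [|n IH]; simpl; [|rewrite IH]; ring. Qed.

Lemma rsum_0 f n : (forall i, (i < n)%nat -> f i = 0) -> rsum f n = 0.
Proof.
  induction n as [|n IH]; intros H; simpl; auto.
  rewrite IH, H; auto. ring.
Qed.

Lemma rsum_le f g n : (forall i, (i < n)%nat -> f i <= g i) -> rsum f n <= rsum g n.
Proof.
  induction n as [|n IH]; intros H; simpl; [lra|].
  apply Rplus_le_compat; auto.
Qed.

Lemma rsum_ge_0 f n : (forall i, (i < n)%nat -> 0 <= f i) -> 0 <= rsum f n.
Proof.
  intros H. rewrite <- (rsum_0 (fun _ => 0) n) by auto. now apply rsum_le.
Qed.

Lemma rsum_incr f n m :
  (forall i, 0 <= f i) -> (n <= m)%nat -> rsum f n <= rsum f m.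
Proof.
  intros Hf H. induction H as [|m H IH]; simpl; [lra|]. specialize (Hf m). lra.
Qed.

Lemma rsum_shift f n : rsum f (S n) = f O + rsum (fun i => f (S i)) n.
Proof. induction n as [|n IH]; [simpl; ring|]. simpl in *. rewrite IH. ring. Qed.

Lemma csum_shift f n : csum f (S n) = (f O + csum (fun i => f (S i)) n)%C.
Proof. induction n as [|n IH]; [simpl; ring|]. simpl in *. rewrite IH. ring. Qed.

Lemma csum_split f n m :
  csum f (n + m) = (csum f n + csum (fun i => f (n + i)%nat) m)%C.
Proof.
  induction m as [|m IH]; simpl.
  - rewrite Nat.add_0_r. ring.
  - rewrite Nat.add_succ_r. simpl. rewrite IH. ring.
Qed.

Lemma rsum_split f n m :
  rsum f (n + m) = rsum f n + rsum (fun i => f (n + i)%nat) m.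
Proof.
  induction m as [|m IH]; simpl.
  - rewrite Nat.add_0_r. ring.
  - rewrite Nat.add_succ_r. simpl. rewrite IH. ring.
Qed.

Lemma csum_rev f n : csum f n = csum (fun i => f (n - 1 - i)%nat) n.
Proof.
  induction n as [|n IH]; auto.
  rewrite (csum_shift (fun i => f (S n - 1 - i)%nat)). simpl csum at 1. rewrite IH, Cplus_comm.
  f_equal; [f_equal; lia|]. apply csum_ext. intros i Hi. f_equal. lia.
Qed.

Lemma csum_swap (a : nat -> nat -> C) n m :
  csum (fun i => csum (a i) m) n = csum (fun j => csum (fun i => a i j) n) m.
Proof.
  induction n as [|n IH]; simpl.
  - symmetry. apply csum_0. auto.
  - rewrite IH, csum_plus. reflexivity.
Qed.

Lemma rsum_swap (a : nat -> nat -> R) n m :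
  rsum (fun i => rsum (a i) m) n = rsum (fun j => rsum (fun i => a i j) n) m.
Proof.
  induction n as [|n IH]; simpl.
  - symmetry. apply rsum_0. auto.
  - rewrite IH, rsum_plus. reflexivity.
Qed.

Lemma Cmod_csum f n : Cmod (csum f n) <= rsum (fun i => Cmod (f i)) n.
Proof.
  induction n as [|n IH]; simpl; [rewrite Cmod_0; lra|].
  eapply Rle_trans; [apply Cmod_triangle|lra].
Qed.

Lemma csum_eventually_0 f n m :
  (n <= m)%nat -> (forall i, (n <= i)%nat -> f i = RtoC 0) -> csum f m = csum f n.
Proof.
  intros H Hf. induction H as [|m H IH]; auto. simpl. rewrite IH, Hf by auto. ring.
Qed.

Lemma Cmod_minus_sym a b : Cmod (a - b) = Cmod (b - a).
Proof. rewrite <- Cmod_opp. f_equal. ring. Qed.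

Lemma Cmod_triangle3 a b c : Cmod (a - c) <= Cmod (a - b) + Cmod (b - c).
Proof. replace (a - c)%C with ((a - b) + (b - c))%C by ring. apply Cmod_triangle. Qed.

Lemma Cmod_minus_le a b : Cmod (a - b) <= Cmod a + Cmod b.
Proof. unfold Cminus. rewrite <- (Cmod_opp b). apply Cmod_triangle. Qed.

Lemma Cmod_minus_ge a b : Cmod a - Cmod b <= Cmod (a - b).
Proof.
  assert (Cmod a <= Cmod (a - b) + Cmod b); [|lra].
  replace a with ((a - b) + b)%C at 1 by ring. apply Cmod_triangle.
Qed.

Lemma ccv_unique u l1 l2 : ccv u l1 -> ccv u l2 -> l1 = l2.
Proof.
  intros H1 H2.
  destruct (Req_dec (Cmod (l1 - l2)) 0) as [H|H].
  - apply Cmod_eq_0 in H. replace l1 with (l2 + (l1 - l2))%C by ring. rewrite H. ring.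
  - pose proof (Cmod_ge_0 (l1 - l2)) as P.
    destruct (H1 (Cmod (l1 - l2) / 2)) as [N1 K1]; [lra|].
    destruct (H2 (Cmod (l1 - l2) / 2)) as [N2 K2]; [lra|].
    specialize (K1 (N1 + N2)%nat ltac:(lia)). specialize (K2 (N1 + N2)%nat ltac:(lia)).
    pose proof (Cmod_triangle3 l1 (u (N1 + N2)%nat) l2).
    rewrite (Cmod_minus_sym l1 (u _)) in H0. lra.
Qed.

Lemma ccv_ext u v l : (forall n, u n = v n) -> ccv u l -> ccv v l.
Proof.
  intros E H eps He. destruct (H eps He) as [N K]. exists N. intros n Hn. rewrite <- E. auto.
Qed.

Lemma ccv_const c : ccv (fun _ => c) c.
Proof.
  intros eps He. exists O. intros n _. replace (c - c)%C with (RtoC 0) by ring.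
  now rewrite Cmod_0.
Qed.

Lemma ccv_plus u v l m : ccv u l -> ccv v m -> ccv (fun n => u n + v n)%C (l + m)%C.
Proof.
  intros H1 H2 eps He.
  destruct (H1 (eps / 2)) as [N1 K1]; [lra|].
  destruct (H2 (eps / 2)) as [N2 K2]; [lra|].
  exists (N1 + N2)%nat. intros n Hn.
  specialize (K1 n ltac:(lia)). specialize (K2 n ltac:(lia)).
  replace (u n + v n - (l + m))%C with ((u n - l) + (v n - m))%C by ring.
  eapply Rle_lt_trans; [apply Cmod_triangle|lra].
Qed.

Lemma ccv_scal c u l : ccv u l -> ccv (fun n => c * u n)%C (c * l)%C.
Proof.
  intros H eps He. pose proof (Cmod_ge_0 c) as P.
  destruct (H (eps / (Cmod c + 1))) as [N K].
  { apply Rdiv_lt_0_compat; lra. }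
  exists N. intros n Hn. specialize (K n Hn).
  replace (c * u n - c * l)%C with (c * (u n - l))%C by ring. rewrite Cmod_mult.
  apply Rle_lt_trans with ((Cmod c) * (eps / (Cmod c + 1))).
  { apply Rmult_le_compat_l; lra. }
  apply Rlt_le_trans with ((Cmod c + 1) * (eps / (Cmod c + 1))).
  { apply Rmult_lt_compat_r; [apply Rdiv_lt_0_compat|]; lra. }
  right. field. lra.
Qed.

Lemma ccv_bound u l B : ccv u l -> (forall n, Cmod (u n) <= B) -> Cmod l <= B.
Proof.
  intros H HB. apply Rnot_lt_le. intros Hl.
  destruct (H (Cmod l - B)) as [N K]; [lra|]. specialize (K N (le_n _)).
  pose proof (Cmod_minus_ge l (u N)). rewrite Cmod_minus_sym in H0. specialize (HB N). lra.
Qed.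

Lemma ccv_mult u v l m : ccv u l -> ccv v m -> ccv (fun n => u n * v n)%C (l * m)%C.
Proof.
  intros H1 H2.
  assert (H3 : ccv (fun n => (u n - l) * (v n - m))%C (RtoC 0)).
  { intros eps He.
    destruct (H1 (Rmin eps 1)) as [N1 K1]; [apply Rmin_glb_lt; lra|].
    destruct (H2 1) as [N2 K2]; [lra|].
    exists (N1 + N2)%nat. intros n Hn.
    specialize (K1 n ltac:(lia)). specialize (K2 n ltac:(lia)).
    replace ((u n - l) * (v n - m) - 0)%C with ((u n - l) * (v n - m))%C by ring.
    rewrite Cmod_mult. pose proof (Rmin_l eps 1).
    pose proof (Cmod_ge_0 (u n - l)). pose proof (Cmod_ge_0 (v n - m)). nra. }
  pose proof (ccv_plus _ _ _ _ H3 (ccv_plus _ _ _ _ (ccv_scal l _ _ H2)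
     (ccv_plus _ _ _ _ (ccv_scal m _ _ H1) (ccv_const (- (l * m))%C)))) as H4.
  replace (l * m)%C with (0 + (l * m + (m * l + - (l * m))))%C by ring.
  eapply ccv_ext; [|exact H4]. intros n. simpl. ring.
Qed.

Lemma ccv_pow u l k : ccv u l -> ccv (fun n => Cpow (u n) k) (Cpow l k).
Proof.
  intros H. induction k as [|k IH]; simpl; [apply ccv_const|now apply ccv_mult].
Qed.

Lemma ccv_inv u l : l <> RtoC 0 -> ccv u l -> ccv (fun n => / u n)%C (/ l)%C.
Proof.
  intros Hl H eps He. apply Cmod_gt_0 in Hl as Pl.
  destruct (H (Rmin (Cmod l / 2) (eps * (Cmod l * Cmod l) / 2))) as [N K].
  { apply Rmin_glb_lt; [lra|]. apply Rdiv_lt_0_compat; [|lra]. apply Rmult_lt_0_compat; nra. }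
  exists N. intros n Hn. specialize (K n Hn).
  pose proof (Rmin_l (Cmod l / 2) (eps * (Cmod l * Cmod l) / 2)).
  pose proof (Rmin_r (Cmod l / 2) (eps * (Cmod l * Cmod l) / 2)).
  assert (Hu : Cmod l / 2 < Cmod (u n)).
  { pose proof (Cmod_minus_ge l (u n)). rewrite Cmod_minus_sym in H2. lra. }
  assert (u n <> RtoC 0) by (apply Cmod_gt_0; lra).
  replace (/ u n - / l)%C with ((l - u n) / (u n * l))%C by (field; auto).
  rewrite Cmod_div by (now apply Cmult_neq_0). rewrite Cmod_mult, Cmod_minus_sym.
  apply Rmult_lt_reg_r with (Cmod (u n) * Cmod l); [nra|].
  unfold Rdiv. rewrite Rmult_assoc, Rinv_l, Rmult_1_r by nra.
  assert (eps * (Cmod l * Cmod l) / 2 <= eps * (Cmod (u n) * Cmod l)); [|lra].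
  assert (Cmod l * Cmod l / 2 <= Cmod (u n) * Cmod l) by nra. nra.
Qed.

Lemma csums_unique a l1 l2 : csums a l1 -> csums a l2 -> l1 = l2.
Proof. apply ccv_unique. Qed.

Lemma csums_ext a b l : (forall n, a n = b n) -> csums a l -> csums b l.
Proof. intros E. apply ccv_ext. intros n. apply csum_ext. auto. Qed.

Lemma csums_plus a b l m :
  csums a l -> csums b m -> csums (fun n => a n + b n)%C (l + m)%C.
Proof.
  intros H1 H2. eapply ccv_ext; [|apply (ccv_plus _ _ _ _ H1 H2)].
  intros n. simpl. now rewrite csum_plus.
Qed.

Lemma csums_scal c a l : csums a l -> csums (fun n => c * a n)%C (c * l)%C.
Proof.
  intros H1. eapply ccv_ext; [|apply (ccv_scal c _ _ H1)].
  intros n. simpl. now rewrite csum_scal.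
Qed.

Lemma csums_finite a N :
  (forall n, (N <= n)%nat -> a n = RtoC 0) -> csums a (csum a N).
Proof.
  intros H eps He. exists N. intros n Hn. rewrite (csum_eventually_0 a N n) by auto.
  replace (csum a N - csum a N)%C with (RtoC 0) by ring. now rewrite Cmod_0.
Qed.

Lemma ccv_shift u l : ccv u l <-> ccv (fun n => u (S n)) l.
Proof.
  split; intros H eps He; destruct (H eps He) as [N K].
  - exists N. intros n Hn. apply K. lia.
  - exists (S N). intros [|n] Hn; [lia|]. apply K. lia.
Qed.

Lemma csums_shift a l : csums a l <-> csums (fun n => a (S n)) (l - a O)%C.
Proof.
  unfold csums. split; intros H.
  - apply ccv_shift in H.
    eapply ccv_ext; [|exact (ccv_plus _ _ _ _ H (ccv_const (- a O)%C))].
    intros n. cbn beta. rewrite csum_shift. ring.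
  - apply ccv_shift. replace l with (a O + (l - a O))%C by ring.
    eapply ccv_ext; [|exact (ccv_plus _ _ _ _ (ccv_const (a O)) H)].
    intros n. cbn beta. rewrite csum_shift. ring.
Qed.

Lemma csums_of_is_series (a : nat -> C) (l : C) : is_series a l -> csums a l.
Proof.
  intros H. apply ccv_shift. intros eps He.
  (* A ball of the uniform structure on C controls [Cmod] only up to the factor sqrt 2. *)
  assert (He2 : 0 < eps / sqrt 2) by (apply Rdiv_lt_0_compat; [lra|apply sqrt_lt_R0; lra]).
  destruct (H _ (locally_ball l (mkposreal _ He2))) as [N K].
  exists N. intros n Hn. specialize (K n Hn).
  apply C_NormedModule_mixin_compat2 in K. simpl in K.
  assert (E : forall m, sum_n a m = csum a (S m)).
  { induction m as [|m IH].
    - rewrite sum_O. simpl. ring.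
    - rewrite sum_Sn, IH. reflexivity. }
  rewrite E in K. change (Cmod (csum a (S n) - l)%C < sqrt 2 * (eps / sqrt 2)) in K.
  replace (sqrt 2 * (eps / sqrt 2)) with eps in K; auto.
  field. apply Rgt_not_eq, sqrt_lt_R0. lra.
Qed.

Lemma rsum_tail v B :
  (forall n, 0 <= v n) -> (forall N, rsum v N <= B) ->
  forall eps, 0 < eps -> exists N, forall M, (N <= M)%nat -> rsum v M - rsum v N < eps.
Proof.
  intros Hv HB eps He.
  destruct (completeness (fun x => exists n, x = rsum v n)) as [l [Hu Hl]].
  - exists B. intros x [n ->]. auto.
  - exists (rsum v 0). now exists O.
  - destruct (Classical_Prop.classic (exists N, l - eps < rsum v N)) as [[N K]|K].
    + exists N. intros M HM. specialize (Hu (rsum v M) (ex_intro _ M eq_refl)). lra.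
    + assert (l <= l - eps); [|lra]. apply Hl. intros x [n ->].
      apply Rnot_lt_le. intros Hn. apply K. now exists n.
Qed.

Lemma csum_tail_le a v N M :
  (forall n, Cmod (a n) <= v n) -> (N <= M)%nat ->
  Cmod (csum a M - csum a N) <= rsum v M - rsum v N.
Proof.
  intros H HM. induction HM as [|M HM IH].
  - replace (csum a N - csum a N)%C with (RtoC 0) by ring. rewrite Cmod_0. lra.
  - simpl. replace (csum a M + a M - csum a N)%C with ((csum a M - csum a N) + a M)%C by ring.
    eapply Rle_trans; [apply Cmod_triangle|]. specialize (H M). lra.
Qed.

Lemma im_le_Cmod (c : C) : Rabs (Im c) <= Cmod c.
Proof. eapply Rle_trans; [apply Rmax_r|apply Rmax_Cmod]. Qed.

Lemma Cmod_le_re_im (c : C) : Cmod c <= Rabs (Re c) + Rabs (Im c).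
Proof.
  destruct c as [x y]. unfold Re, Im; simpl fst; simpl snd.
  replace (x, y) with (x + Ci * y)%C by (unfold Cplus, Cmult, Ci, RtoC; simpl; f_equal; ring).
  eapply Rle_trans; [apply Cmod_triangle|]. rewrite Cmod_mult, Cmod_Ci, !Cmod_R. lra.
Qed.

Lemma ccv_cauchy u :
  (forall eps, 0 < eps -> exists N, forall n, (N <= n)%nat -> Cmod (u n - u N) < eps) ->
  exists l, ccv u l.
Proof.
  intros H.
  assert (G : forall p : C -> R, (forall a b, Rabs (p a - p b) <= Cmod (a - b)) ->
     exists l, is_lim_seq (fun n => p (u n)) (Finite l)).
  { intros p Hp. apply ex_lim_seq_cauchy_corr. intros eps.
    destruct (H (eps / 2)) as [N K]; [destruct eps; simpl; lra|].
    exists N. intros n m Hn Hm. pose proof (K n Hn). pose proof (K m Hm).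
    eapply Rle_lt_trans; [apply Hp|].
    eapply Rle_lt_trans; [apply (Cmod_triangle3 _ (u N))|].
    rewrite (Cmod_minus_sym (u N)). lra. }
  destruct (G Re) as [x Hx].
  { intros a b. apply (re_le_Cmod (a - b)). }
  destruct (G Im) as [y Hy].
  { intros a b. apply (im_le_Cmod (a - b)). }
  exists (x, y). intros eps He.
  apply is_lim_seq_spec in Hx. apply is_lim_seq_spec in Hy.
  assert (He2 : 0 < eps / 2) by lra.
  destruct (Hx (mkposreal _ He2)) as [N1 K1]. destruct (Hy (mkposreal _ He2)) as [N2 K2].
  exists (N1 + N2)%nat. intros n Hn.
  specialize (K1 n ltac:(lia)). specialize (K2 n ltac:(lia)). simpl in K1, K2.
  eapply Rle_lt_trans; [apply Cmod_le_re_im|].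
  change (Rabs (Re (u n) - x) + Rabs (Im (u n) - y) < eps). lra.
Qed.

Lemma csums_dominated a v B :
  (forall n, Cmod (a n) <= v n) -> (forall N, rsum v N <= B) -> exists l, csums a l.
Proof.
  intros H HB. apply ccv_cauchy. intros eps He.
  destruct (rsum_tail v B) with (eps := eps) as [N K]; auto.
  - intros n. eapply Rle_trans; [apply Cmod_ge_0|apply H].
  - exists N. intros n Hn. eapply Rle_lt_trans; [apply (csum_tail_le a v); auto|auto].
Qed.

Lemma csums_bound a l B : csums a l -> (forall N, rsum (fun n => Cmod (a n)) N <= B) -> Cmod l <= B.
Proof.
  intros H HB. apply (ccv_bound _ _ _ H). intros n.
  eapply Rle_trans; [apply Cmod_csum|apply HB].
Qed.

Lemma csums_tail_le a l v N eps :
  csums a l -> (forall n, Cmod (a n) <= v n) ->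
  (forall M, (N <= M)%nat -> rsum v M - rsum v N < eps) -> Cmod (csum a N - l) <= eps.
Proof.
  intros H Hv K. apply Rnot_lt_le. intros Hl.
  destruct (H (Cmod (csum a N - l) - eps)) as [M HM]; [lra|].
  specialize (HM (N + M)%nat ltac:(lia)). specialize (K (N + M)%nat ltac:(lia)).
  pose proof (csum_tail_le a v N (N + M) Hv ltac:(lia)).
  pose proof (Cmod_triangle3 (csum a N) (csum a (N + M)) l).
  rewrite (Cmod_minus_sym (csum a N) (csum a (N + M))) in H1. lra.
Qed.

Lemma ccv_csum (a : nat -> nat -> C) b N :
  (forall n, ccv (fun j => a j n) (b n)) -> ccv (fun j => csum (a j) N) (csum b N).
Proof.
  intros H. induction N as [|N IH]; simpl; [apply ccv_const|now apply ccv_plus].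
Qed.

(** Dominated convergence for series. The three thirds of eps are the tails of the two series beyond
    a common [N], both controlled by [v], and the difference of their first [N] terms. *)
Lemma tannery (a : nat -> nat -> C) (b : nat -> C) (v : nat -> R) (B : R) (s : nat -> C) :
  (forall N, rsum v N <= B) -> (forall j n, Cmod (a j n) <= v n) ->
  (forall n, ccv (fun j => a j n) (b n)) -> (forall j, csums (a j) (s j)) ->
  exists l, csums b l /\ ccv s l.
Proof.
  intros HB Ha Hb Hs.
  assert (Hv : forall n, 0 <= v n).
  { intros n. eapply Rle_trans; [apply Cmod_ge_0|apply (Ha O)]. }
  assert (Hbv : forall n, Cmod (b n) <= v n) by (intros n; apply (ccv_bound _ _ _ (Hb n)); auto).
  destruct (csums_dominated b v B) as [l Hl]; auto.
  exists l. split; auto. intros eps He.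
  destruct (rsum_tail v B Hv HB (eps / 3)) as [N HN]; [lra|].
  destruct (ccv_csum a b N Hb (eps / 3)) as [J HJ]; [lra|].
  exists J. intros j Hj. specialize (HJ j Hj).
  pose proof (csums_tail_le _ _ _ _ _ Hl Hbv HN).
  pose proof (csums_tail_le _ _ _ _ _ (Hs j) (Ha j) HN).
  pose proof (Cmod_triangle3 (s j) (csum (a j) N) l).
  pose proof (Cmod_triangle3 (csum (a j) N) (csum b N) l).
  rewrite (Cmod_minus_sym (s j) (csum (a j) N)) in H1. lra.
Qed.

Lemma csums_csum (a : nat -> nat -> C) t N :
  (forall n, csums (fun m => a m n) (t n)) -> csums (fun m => csum (a m) N) (csum t N).
Proof.
  intros H. eapply ccv_ext; [|apply (ccv_csum (fun M n => csum (fun m => a m n) M) t N H)].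
  intros M. cbn beta. now rewrite csum_swap.
Qed.

(** Tannery's theorem with the number of columns kept as the limit parameter: the partial row sums
    tend to [s] and are dominated by [u], while their total over all rows is a partial sum of
    [t]. *)
Lemma csums_fubini (a : nat -> nat -> C) (s t : nat -> C) (u : nat -> R) (B : R) :
  (forall N, rsum u N <= B) ->
  (forall m N, rsum (fun n => Cmod (a m n)) N <= u m) ->
  (forall m, csums (a m) (s m)) -> (forall n, csums (fun m => a m n) (t n)) ->
  exists l, csums s l /\ csums t l.
Proof.
  intros HB Hu Hs Ht.
  apply (tannery (fun N m => csum (a m) N) s u B); auto.
  - intros N m. eapply Rle_trans; [apply Cmod_csum|apply Hu].
  - intros N. now apply csums_csum.
Qed.

(** * Cauchy products *)

Definition conv (a b : nat -> C) (n : nat) : C := csum (fun i => a i * b (n - i)%nat)%C (S n).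

Definition shift (N : nat) (a : nat -> C) (n : nat) : C :=
  if (n <? N)%nat then RtoC 0 else a (n - N)%nat.

Lemma csum_shift_seq N a M : csum (shift N a) (N + M) = csum a M.
Proof.
  rewrite csum_split. rewrite (csum_0 (shift N a)).
  - rewrite Cplus_0_l. apply csum_ext. intros i _. unfold shift.
    destruct (Nat.ltb_spec (N + i) N); [lia|]. f_equal. lia.
  - intros i Hi. unfold shift. destruct (Nat.ltb_spec i N); [auto|lia].
Qed.

Lemma csums_shift_seq N a l : csums a l -> csums (shift N a) l.
Proof.
  intros H eps He. destruct (H eps He) as [K HK]. exists (N + K)%nat. intros n Hn.
  replace n with (N + (n - N))%nat by lia. rewrite csum_shift_seq. apply HK. lia.
Qed.

Lemma rsum_shift_seq N (a : nat -> R) M :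
  rsum (fun n => if (n <? N)%nat then 0 else a (n - N)%nat) (N + M) = rsum a M.
Proof.
  rewrite rsum_split, rsum_0.
  - rewrite Rplus_0_l. apply rsum_ext. intros i _.
    destruct (Nat.ltb_spec (N + i) N); [lia|]. f_equal. lia.
  - intros i Hi. destruct (Nat.ltb_spec i N); [auto|lia].
Qed.

Lemma rsum_shift_seq_le N (a : nat -> R) B M :
  0 <= B -> (forall M, rsum a M <= B) ->
  rsum (fun n => if (n <? N)%nat then 0 else a (n - N)%nat) M <= B.
Proof.
  intros HB H. destruct (Nat.le_gt_cases N M) as [HM|HM].
  - replace M with (N + (M - N))%nat by lia. rewrite rsum_shift_seq. auto.
  - rewrite rsum_0; auto. intros i Hi. destruct (Nat.ltb_spec i N); [auto|lia].
Qed.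

(** Fubini for the array whose row [m] is [b] multiplied by a_m and moved [m] places to the right;
    column [n] is then finite and sums to [conv a b n]. *)
Lemma csums_conv a b la lb A B :
  (forall N, rsum (fun n => Cmod (a n)) N <= A) ->
  (forall N, rsum (fun n => Cmod (b n)) N <= B) ->
  csums a la -> csums b lb -> csums (conv a b) (la * lb)%C.
Proof.
  intros HA HB Ha Hb.
  assert (B0 : 0 <= B) by apply (HB O).
  set (c := fun m n => shift m (fun i => a m * b i)%C n).
  destruct (csums_fubini c (fun m => a m * lb)%C (conv a b) (fun m => Cmod (a m) * B) (A * B))
    as [l [H1 H2]].
  - intros N. rewrite (rsum_ext _ (fun m => B * Cmod (a m))) by (intros; ring).
    rewrite rsum_scal. specialize (HA N). nra.
  - intros m N. eapply Rle_trans; [|apply (rsum_shift_seq_le m (fun i => Cmod (a m) * Cmod (b i)) _ N)].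
    + apply rsum_le. intros i _. unfold c, shift. destruct (Nat.ltb_spec i m).
      * rewrite Cmod_0. lra.
      * rewrite Cmod_mult. lra.
    + pose proof (Cmod_ge_0 (a m)). nra.
    + intros M. rewrite rsum_scal. pose proof (Cmod_ge_0 (a m)). specialize (HB M). nra.
  - intros m. unfold c. apply csums_shift_seq, csums_scal, Hb.
  - intros n. replace (conv a b n) with (csum (fun m => c m n) (S n)).
    + apply csums_finite. intros m Hm. unfold c, shift. destruct (Nat.ltb_spec n m); [auto|lia].
    + apply csum_ext. intros i Hi. unfold c, shift. destruct (Nat.ltb_spec n i); [lia|auto].
  - replace (la * lb)%C with l; auto. apply (csums_unique _ _ _ H1).
    apply (csums_ext (fun m => lb * a m)%C); [intros; ring|].
    rewrite Cmult_comm. now apply csums_scal.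
Qed.

(** The triangle of index pairs is completed to a square by zeros, after which each row is a shifted
    multiple of [b]. This makes the weighted norm of power series submultiplicative. *)
Lemma rsum_conv_le (a b : nat -> R) A B N :
  (forall n, 0 <= a n) -> (forall n, 0 <= b n) ->
  (forall N, rsum a N <= A) -> (forall N, rsum b N <= B) ->
  rsum (fun n => rsum (fun i => a i * b (n - i)%nat) (S n)) N <= A * B.
Proof.
  intros Ha Hb HA HB.
  assert (B0 : 0 <= B) by apply (HB O).
  rewrite (rsum_ext _ (fun n => rsum (fun i => if (n <? i)%nat then 0 else a i * b (n - i)%nat) N)).
  - rewrite rsum_swap.
    apply Rle_trans with (rsum (fun i => B * a i) N).
    + apply rsum_le. intros i Hi.
      eapply Rle_trans; [apply (rsum_shift_seq_le i (fun j => a i * b j) (B * a i) N)|lra].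
      * specialize (Ha i). nra.
      * intros M. rewrite rsum_scal. specialize (Ha i). specialize (HB M). nra.
    + rewrite rsum_scal. specialize (HA N). nra.
  - intros n Hn. replace N with (S n + (N - S n))%nat by lia. rewrite rsum_split.
    rewrite (rsum_0 (fun i => if (n <? S n + i)%nat then _ else _)).
    + rewrite Rplus_0_r. apply rsum_ext. intros i Hi.
      destruct (Nat.ltb_spec n i); [lia|auto].
    + intros i Hi. destruct (Nat.ltb_spec n (S n + i)); [auto|lia].
Qed.

(** * The exponential near the origin *)

Lemma PI_bounds : 3.14 < PI < 3.15.
Proof.
  pose proof (PI_2_3_7_ineq 2) as [H1 H2].
  unfold sum_f_R0, tg_alt, PI_2_3_7_tg, Ratan_seq in H1, H2. simpl in H1, H2. lra.
Qed.

Lemma exp_ge_1 x : 0 <= x -> 1 <= exp x.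
Proof. intros H. pose proof (exp_ineq1_le x). lra. Qed.

Lemma exp_minus_1_le x : exp x - 1 <= x * exp x.
Proof.
  pose proof (exp_ineq1_le (- x)) as H. pose proof (exp_pos x) as P.
  rewrite exp_Ropp in H. apply (Rmult_le_compat_r (exp x)) in H; [|lra].
  rewrite Rinv_l in H by lra. lra.
Qed.

Lemma Rabs_exp_minus_1 x : Rabs (exp x - 1) <= Rabs x * exp (Rabs x).
Proof.
  pose proof (exp_minus_1_le x). pose proof (exp_ineq1_le x).
  pose proof (exp_ge_1 (Rabs x) (Rabs_pos x)).
  destruct (Rle_or_lt 0 x) as [Hx|Hx].
  - rewrite (Rabs_pos_eq x) by auto. rewrite Rabs_pos_eq; lra.
  - rewrite (Rabs_left x) in * by auto. pose proof (exp_ge_1 (- x)).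
    rewrite Rabs_left1; [nra|]. pose proof (exp_pos x). nra.
Qed.

Lemma Rabs_exp_quad x : Rabs (exp x - 1 - x) <= x ^ 2 * exp (Rabs x).
Proof.
  pose proof (exp_minus_1_le x). pose proof (exp_ineq1_le x).
  pose proof (exp_ge_1 (Rabs x) (Rabs_pos x)).
  rewrite Rabs_pos_eq by lra.
  destruct (Rle_or_lt 0 x) as [Hx|Hx].
  - rewrite (Rabs_pos_eq x) in * by auto. nra.
  - nra.
Qed.

Lemma Rabs_sin_le x : Rabs (sin x) <= Rabs x.
Proof.
  assert (G : forall t, 0 <= t -> Rabs (sin t) <= t).
  { intros t [Ht|<-]; [|rewrite sin_0, Rabs_R0; lra].
    apply Rabs_le. split; [|left; now apply sin_lt_x].
    destruct (Rle_or_lt t PI) as [Hp|Hp].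
    - pose proof (sin_ge_0 t). lra.
    - pose proof (SIN_bound t). pose proof PI_bounds. lra. }
  destruct (Rle_or_lt 0 x) as [Hx|Hx].
  - rewrite (Rabs_pos_eq x) by auto. auto.
  - rewrite (Rabs_left x) by auto. rewrite <- Rabs_Ropp, <- sin_neg. apply G. lra.
Qed.

Lemma cos_lower x : 1 - x ^ 2 / 2 <= cos x.
Proof.
  replace x with (2 * (x / 2)) at 2 by field. rewrite cos_2a_sin.
  assert (H : sin (x / 2) ^ 2 <= (x / 2) ^ 2); [|nra].
  rewrite <- (pow2_abs (sin (x / 2))), <- (pow2_abs (x / 2)).
  apply pow_incr. split; [apply Rabs_pos|apply Rabs_sin_le].
Qed.

Lemma sin_lower x : 0 <= x <= 2 -> x - x ^ 3 / 6 <= sin x.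
Proof.
  intros [H1 H2]. pose proof PI_bounds.
  destruct (sin_bound x 0) as [H3 _]; [lra|lra|].
  unfold sin_approx, sin_term in H3. simpl in H3. lra.
Qed.

Lemma Rabs_cos_minus_1 x : Rabs (cos x - 1) <= Rabs x.
Proof.
  pose proof (cos_lower x). pose proof (COS_bound x).
  rewrite Rabs_left1 by lra. rewrite <- pow2_abs in H.
  pose proof (Rabs_pos x). destruct (Rle_or_lt (Rabs x) 2); nra.
Qed.

Lemma Rabs_sin_minus x : Rabs (sin x - x) <= x ^ 2.
Proof.
  destruct (MVT_gen (fun t => sin t - t) 0 x (fun t => cos t - 1)) as [c [Hc E]].
  - intros t _. auto_derive; auto; ring.
  - intros t _. apply continuity_pt_filterlim, (ex_derive_continuous (fun t => sin t - t)).
    auto_derive. auto.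
  - rewrite sin_0 in E. replace (sin x - x) with (sin x - x - (0 - 0)) by ring. rewrite E.
    rewrite Rabs_mult, <- pow2_abs. simpl. rewrite Rmult_1_r.
    replace (x - 0) with x by ring. apply Rmult_le_compat_r; [apply Rabs_pos|].
    eapply Rle_trans; [apply Rabs_cos_minus_1|].
    unfold Rmin, Rmax in Hc. destruct (Rle_dec 0 x).
    + rewrite !Rabs_pos_eq; lra.
    + rewrite !Rabs_left1; lra.
Qed.

Definition cexp (w : C) : C := (exp (Re w) * cos (Im w), exp (Re w) * sin (Im w)).

Lemma C_eq (a b : C) : Re a = Re b -> Im a = Im b -> a = b.
Proof. destruct a, b. unfold Re, Im. simpl. now intros -> ->. Qed.

Lemma cexp_plus a b : cexp (a + b) = (cexp a * cexp b)%C.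
Proof.
  unfold cexp. apply C_eq; unfold Re, Im; simpl; rewrite exp_plus, ?cos_plus, ?sin_plus; ring.
Qed.

Lemma Cmod_cexp w : Cmod (cexp w) = exp (Re w).
Proof.
  unfold Cmod, cexp. simpl fst. simpl snd.
  replace ((exp (Re w) * cos (Im w)) ^ 2 + (exp (Re w) * sin (Im w)) ^ 2) with (exp (Re w) ^ 2).
  - rewrite sqrt_pow2; auto. left. apply exp_pos.
  - pose proof (sin2_cos2 (Im w)) as H. unfold Rsqr in H.
    replace (exp (Re w) ^ 2) with (exp (Re w) ^ 2 * 1) by ring. rewrite <- H. ring.
Qed.

(** The second-order bound serves twice: for the limit of 2^r (1 - q) in Lipschitz' formula, and for
    the termwise differentiation of a q-series. *)
Lemma cexp_quad w : Cmod (cexp w - 1 - w) <= 4 * Cmod w ^ 2 * exp (Cmod w).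
Proof.
  destruct w as [x y]. set (w := (x, y)).
  assert (Hx : Rabs x <= Cmod w) by apply (re_le_Cmod w).
  assert (Hy : Rabs y <= Cmod w) by apply (im_le_Cmod w).
  pose proof (Rabs_pos x) as X0. pose proof (Rabs_pos y) as Y0.
  assert (He : exp (Rabs x) <= exp (Cmod w)).
  { destruct Hx as [Hx|Hx]; [left; now apply exp_increasing|rewrite Hx; lra]. }
  assert (E1 : 1 <= exp (Cmod w)) by (apply exp_ge_1, Cmod_ge_0).
  set (M := Cmod w) in *. set (e := exp M) in *.
  assert (Hxx : exp x <= e).
  { eapply Rle_trans; [|exact He].
    destruct (Rle_abs x) as [H|H]; [left; now apply exp_increasing|rewrite <- H; lra]. }
  eapply Rle_trans; [apply Cmod_le_re_im|].
  change (Re (cexp w - 1 - w)) with (exp x * cos y - 1 - x).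
  replace (Im (cexp w - 1 - w)) with (exp x * sin y - y) by (unfold cexp, Im; simpl; ring).
  assert (A1 : Rabs (exp x * cos y - 1 - x) <= M ^ 2 * e + e * (M ^ 2 / 2)).
  { replace (exp x * cos y - 1 - x) with ((exp x - 1 - x) + exp x * (cos y - 1)) by ring.
    eapply Rle_trans; [apply Rabs_triang|]. apply Rplus_le_compat.
    - eapply Rle_trans; [apply Rabs_exp_quad|]. rewrite <- pow2_abs.
      apply Rmult_le_compat; auto; [nra|left; apply exp_pos|]. apply pow_incr. lra.
    - rewrite Rabs_mult, (Rabs_pos_eq (exp x)) by (left; apply exp_pos).
      apply Rmult_le_compat; [left; apply exp_pos|apply Rabs_pos|auto|].
      pose proof (cos_lower y). pose proof (COS_bound y). rewrite Rabs_left1 by lra.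
      rewrite <- pow2_abs in H. assert (Rabs y ^ 2 <= M ^ 2) by (apply pow_incr; lra). lra. }
  assert (A2 : Rabs (exp x * sin y - y) <= M * e * M + M ^ 2).
  { replace (exp x * sin y - y) with ((exp x - 1) * sin y + (sin y - y)) by ring.
    eapply Rle_trans; [apply Rabs_triang|]. apply Rplus_le_compat.
    - rewrite Rabs_mult. apply Rmult_le_compat; try apply Rabs_pos.
      + eapply Rle_trans; [apply Rabs_exp_minus_1|].
        apply Rmult_le_compat; auto. left. apply exp_pos.
      + eapply Rle_trans; [apply Rabs_sin_le|auto].
    - eapply Rle_trans; [apply Rabs_sin_minus|]. rewrite <- pow2_abs. apply pow_incr. lra. }
  nra.
Qed.

Definition twopii : C := (0, 2 * PI).

Lemma qpar_cexp z : qpar z = cexp (twopii * z).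
Proof.
  destruct z as [x y]. unfold qpar, cexp, twopii, Re, Im. simpl.
  f_equal; f_equal; f_equal; ring.
Qed.

Lemma qpar_plus z w : qpar (z + w) = (qpar z * qpar w)%C.
Proof. rewrite !qpar_cexp, <- cexp_plus. f_equal. ring. Qed.

Lemma Cmod_qpar z : Cmod (qpar z) = exp (- 2 * PI * Im z).
Proof.
  rewrite qpar_cexp, Cmod_cexp. f_equal. destruct z. unfold twopii, Re, Im. simpl. ring.
Qed.

Lemma qpar_neq_0 z : qpar z <> RtoC 0.
Proof. apply Cmod_gt_0. rewrite Cmod_qpar. apply exp_pos. Qed.

Lemma Cmod_qpar_lt_1 z : 0 < Im z -> Cmod (qpar z) < 1.
Proof.
  intros H. rewrite Cmod_qpar, <- exp_0. apply exp_increasing.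
  pose proof PI_bounds. nra.
Qed.

Lemma qpar_1 : qpar 1 = RtoC 1.
Proof.
  unfold qpar, Re, Im. simpl. rewrite !Rmult_0_r, exp_0, !Rmult_1_r, sin_2PI, cos_2PI.
  unfold RtoC. f_equal; ring.
Qed.

Lemma qpar_half : qpar (1 / 2)%R = (- (1))%C.
Proof.
  unfold qpar, Re, Im. simpl. rewrite !Rmult_0_r, exp_0.
  replace (2 * PI * (1 / 2)) with PI by field. rewrite sin_PI, cos_PI.
  unfold RtoC, Copp. simpl. f_equal; ring.
Qed.

Lemma qpar_INR n z : qpar (INR n * z) = (qpar z ^ n)%C.
Proof.
  induction n as [|n IH].
  - simpl INR. rewrite qpar_cexp. replace (twopii * (0 * z))%C with (RtoC 0) by ring.
    unfold cexp. simpl. rewrite exp_0, cos_0, sin_0. unfold RtoC. f_equal; ring.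
  - rewrite S_INR, RtoC_plus, Cmult_plus_distr_r, Cmult_1_l, qpar_plus, IH. simpl. ring.
Qed.

Lemma Cmod_twopii : Cmod twopii = 2 * PI.
Proof.
  replace twopii with (Ci * (2 * PI)%R)%C
    by (unfold twopii, Ci, RtoC, Cmult; simpl; f_equal; ring).
  rewrite Cmod_mult, Cmod_Ci, Cmod_R, Rabs_pos_eq; pose proof PI_bounds; lra.
Qed.

Lemma qpar_quad h :
  Cmod (qpar h - 1 - twopii * h) <= 4 * (2 * PI * Cmod h) ^ 2 * exp (2 * PI * Cmod h).
Proof.
  rewrite qpar_cexp. eapply Rle_trans; [apply cexp_quad|].
  rewrite Cmod_mult, Cmod_twopii. lra.
Qed.

(** The range 3/4 is what the recentered duplication formula produces: the shifts stay within half a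
    period and the real part of the base point adds at most a quarter. *)
Lemma Rabs_sin_PI_lower u : Rabs u <= 3 / 4 -> Rabs u / 2 <= Rabs (sin (PI * u)).
Proof.
  assert (G : forall u, 0 <= u <= 3 / 4 -> u / 2 <= sin (PI * u)).
  { clear u. intros u Hu. pose proof PI_bounds.
    replace (PI * u) with (2 * (PI * u / 2)) by field. rewrite sin_2a.
    set (x := PI * u / 2). assert (Hx : 1.57 * u <= x <= 1.2) by (unfold x; nra).
    pose proof (sin_lower x ltac:(lra)). pose proof (cos_lower x).
    assert (0.28 <= cos x) by nra. assert (0.7 * x <= sin x) by nra. nra. }
  intros Hu. destruct (Rle_or_lt 0 u) as [H|H].
  - rewrite (Rabs_pos_eq u) in * by auto. specialize (G u ltac:(lra)).
    eapply Rle_trans; [apply G|apply Rle_abs].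
  - rewrite (Rabs_left u) in * by auto. specialize (G (- u) ltac:(lra)).
    rewrite <- Rabs_Ropp, <- sin_neg. replace (- (PI * u)) with (PI * - u) by ring.
    eapply Rle_trans; [apply G|apply Rle_abs].
Qed.

(** With e = |q|, the square of |1 - q| is (1 - e)^2 + 4 e sin(pi u)^2. The first term controls the
    imaginary part of [w], the second its real part. *)
Lemma Cmod_1_minus_qpar_lower w :
  Rabs (Re w) <= 3 / 4 -> 0 < Im w -> exp (- 2 * PI * Im w) / 2 * Cmod w <= Cmod (1 - qpar w).
Proof.
  intros Hu Hv. set (u := Re w) in *. set (v := Im w) in *.
  apply Rsqr_incr_0_var; [|apply Cmod_ge_0]. unfold Rsqr.
  set (e := exp (- 2 * PI * v)).
  replace (Cmod (1 - qpar w) * Cmod (1 - qpar w)) with (Cmod (1 - qpar w) ^ 2) by ring.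
  replace (e / 2 * Cmod w * (e / 2 * Cmod w)) with (e ^ 2 / 4 * Cmod w ^ 2) by field.
  rewrite !Cmod2_alt. fold u v.
  change (Re (1 - qpar w)) with (1 - e * cos (2 * PI * u)).
  change (Im (1 - qpar w)) with (0 - e * sin (2 * PI * u)).
  assert (E0 : 0 < e) by apply exp_pos.
  assert (E1 : e < 1).
  { unfold e. rewrite <- exp_0. apply exp_increasing. pose proof PI_bounds. nra. }
  assert (Ev : e * v <= 1 - e).
  { pose proof (exp_minus_1_le (2 * PI * v)) as H. pose proof (exp_ineq1_le (2 * PI * v)).
    unfold e. replace (- 2 * PI * v) with (- (2 * PI * v)) by ring. rewrite exp_Ropp.
    pose proof (exp_pos (2 * PI * v)). pose proof PI_bounds.
    apply Rmult_le_reg_r with (exp (2 * PI * v)); auto.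
    rewrite Rmult_minus_distr_r, Rinv_l by lra.
    replace (/ exp (2 * PI * v) * v * exp (2 * PI * v)) with v by (field; lra). nra. }
  pose proof (sin2_cos2 (2 * PI * u)) as SC. unfold Rsqr in SC.
  replace (2 * PI * u) with (2 * (PI * u)) in * by ring.
  assert (C2 : cos (2 * (PI * u)) = 1 - 2 * sin (PI * u) ^ 2) by (rewrite cos_2a_sin; ring).
  assert (S2 : u ^ 2 / 4 <= sin (PI * u) ^ 2).
  { rewrite <- (pow2_abs u), <- (pow2_abs (sin _)).
    replace (Rabs u ^ 2 / 4) with ((Rabs u / 2) ^ 2) by field.
    apply pow_incr. split; [pose proof (Rabs_pos u); lra|now apply Rabs_sin_PI_lower]. }
  set (s := sin (PI * u) ^ 2) in *. set (cc := cos (2 * (PI * u))) in *.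
  set (ss := sin (2 * (PI * u))) in *.
  replace ((1 - e * cc) ^ 2 + (0 - e * ss) ^ 2) with ((1 - e) ^ 2 + 4 * e * s).
  2:{ transitivity (1 - 2 * e * cc + e ^ 2 * (ss * ss + cc * cc)); [rewrite SC, C2|]; ring. }
  assert (F1 : e ^ 2 * v ^ 2 <= (1 - e) ^ 2).
  { replace (e ^ 2 * v ^ 2) with ((e * v) ^ 2) by ring. apply pow_incr. split; [nra|auto]. }
  assert (F2 : e ^ 2 / 4 * u ^ 2 <= 4 * e * s) by nra.
  assert (0 <= e ^ 2 * v ^ 2) by nra. lra.
Qed.

Lemma Cmod_ge_Im z : 0 < Im z -> Im z <= Cmod z.
Proof. intros H. eapply Rle_trans; [|apply im_le_Cmod]. apply Rle_abs. Qed.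

Lemma pow2_ge_INR n : INR n <= 2 ^ n.
Proof.
  induction n as [|n IH]; [simpl; lra|]. rewrite S_INR. simpl.
  assert (1 <= 2 ^ n) by (apply pow_R1_Rle; lra). lra.
Qed.

Lemma ccv_pow2 u l c : (forall r, Cmod (u r - l) <= c / 2 ^ r) -> ccv u l.
Proof.
  intros H eps He.
  destruct (archimed_cor1 (eps / (Rabs c + 1))) as [N [H1 H2]].
  { apply Rdiv_lt_0_compat; [auto|]. pose proof (Rabs_pos c). lra. }
  exists N. intros n Hn. eapply Rle_lt_trans; [apply H|].
  pose proof (Rabs_pos c) as P. pose proof (Rle_abs c) as Q.
  assert (NP : 0 < INR N) by (apply lt_0_INR; lia).
  assert (N2 : INR N <= 2 ^ n).
  { eapply Rle_trans; [apply le_INR, Hn|apply pow2_ge_INR]. }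
  apply Rle_lt_trans with ((Rabs c + 1) * / INR N).
  - unfold Rdiv. apply Rle_trans with ((Rabs c + 1) * / 2 ^ n).
    + apply Rmult_le_compat_r; [|lra]. left. apply Rinv_0_lt_compat. lra.
    + apply Rmult_le_compat_l; [lra|]. now apply Rinv_le_contravar.
  - apply Rmult_lt_reg_r with (/ (Rabs c + 1)); [apply Rinv_0_lt_compat; lra|].
    replace ((Rabs c + 1) * / INR N * / (Rabs c + 1)) with (/ INR N); [exact H1|].
    field. lra.
Qed.

Lemma rsum_inv_sq N : rsum (fun n => / (INR n + 1) ^ 2) N <= 2.
Proof.
  assert (G : rsum (fun n => / (INR n + 1) ^ 2) (S N) <= 2 - / (INR N + 1)).
  { induction N as [|N IH].
    - simpl. lra.
    - change (rsum (fun n => / (INR n + 1) ^ 2) (S N) + / (INR (S N) + 1) ^ 2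
        <= 2 - / (INR (S N) + 1)).
      rewrite S_INR. pose proof (pos_INR N) as P. set (x := INR N) in *.
      assert (/ (x + 1 + 1) ^ 2 <= / (x + 1) - / (x + 1 + 1)); [|lra].
      replace (/ (x + 1) - / (x + 1 + 1)) with (/ ((x + 1) * (x + 1 + 1))) by (field; lra).
      apply Rinv_le_contravar; nra. }
  simpl in G. assert (0 < / (INR N + 1) ^ 2).
  { apply Rinv_0_lt_compat. pose proof (pos_INR N). apply pow_lt. lra. }
  assert (0 < / (INR N + 1)).
  { apply Rinv_0_lt_compat. pose proof (pos_INR N). lra. }
  simpl in *. lra.
Qed.

(** * Lipschitz' formula *)

(* [P q / (1 - q) ^ k] stands for the rational function [sum_d d^(k-1) q^d], with [L = (k-1)!]. *)
Record euler_poly (k : nat) (P : C -> C) (L K : R) : Prop := {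
  euler_bound : forall q, Cmod q <= 1 -> Cmod (P q) <= K;
  euler_at_1 : forall q, Cmod q <= 1 -> Cmod (P q - L) <= K * Cmod (1 - q);
  euler_dup : forall p, Cmod p < 1 ->
    (P p / (1 - p) ^ k + P (- p) / (1 + p) ^ k = 2 ^ k * (P (p * p) / (1 - p * p) ^ k))%C;
  euler_series : forall q, Cmod q < 1 ->
    csums (fun d => INR d ^ (k - 1) * q ^ d)%C (P q / (1 - q) ^ k)%C
}.

Lemma C2_neq_0 : RtoC 2 <> RtoC 0.
Proof. intros H. apply (f_equal Re) in H. unfold Re in H. simpl in H. lra. Qed.

Lemma pow2_neq_0 r : (2 ^ r)%C <> RtoC 0.
Proof. apply Cpow_nz, C2_neq_0. Qed.

Lemma Im_div_pow2 z r : Im (z / 2 ^ r)%C = Im z / 2 ^ r.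
Proof.
  rewrite <- RtoC_pow. unfold Cdiv. rewrite <- RtoC_inv by (apply pow_nonzero; lra).
  destruct z. unfold Im. simpl. unfold Rdiv. ring.
Qed.

Lemma Re_div_pow2 z r : Re (z / 2 ^ r)%C = Re z / 2 ^ r.
Proof.
  rewrite <- RtoC_pow. unfold Cdiv. rewrite <- RtoC_inv by (apply pow_nonzero; lra).
  destruct z. unfold Re. simpl. unfold Rdiv. ring.
Qed.

Lemma Cmod_div_pow2 z r : Cmod (z / 2 ^ r)%C = Cmod z / 2 ^ r.
Proof.
  rewrite Cmod_div by apply pow2_neq_0. rewrite Cmod_pow, Cmod_R, Rabs_pos_eq; lra.
Qed.

Lemma Im_plus_R z (x : R) : Im (z + x)%C = Im z.
Proof. destruct z. unfold Im. simpl. ring. Qed.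

Lemma Rpow2_pos r : 0 < 2 ^ r.
Proof. apply pow_lt. lra. Qed.

(** The duplication formula holds because phi(p) + phi(-p) keeps only the even exponents. Iterated
    [r] times, it spreads phi(q) over all 2^r-th roots of q, which are the values of [qpar] at (z +
    j) / 2^r. *)
Lemma euler_iterate k P L K z r :
  euler_poly k P L K -> 0 < Im z ->
  csum (fun j => P (qpar ((z + INR j) / 2 ^ r)) / (1 - qpar ((z + INR j) / 2 ^ r)) ^ k)%C (2 ^ r)
  = (2 ^ (k * r) * (P (qpar z) / (1 - qpar z) ^ k))%C.
Proof.
  intros E Hz. induction r as [|r IH].
  - rewrite Nat.mul_0_r. simpl Nat.pow. simpl csum. simpl Cpow.
    replace ((z + 0) / 1)%C with z by field. ring.
  - set (A := fun j => (P (qpar ((z + INR j) / 2 ^ S r)) / (1 - qpar ((z + INR j) / 2 ^ S r)) ^ k)%C).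
    replace (2 ^ S r)%nat with (2 ^ r + 2 ^ r)%nat by (simpl; lia).
    rewrite csum_split, <- csum_plus.
    replace (k * S r)%nat with (k + k * r)%nat by lia. rewrite Cpow_add_r, <- Cmult_assoc, <- IH.
    rewrite <- csum_scal. apply csum_ext. intros j _. unfold A.
    set (w := ((z + INR j) / 2 ^ S r)%C).
    assert (D : (2 ^ S r)%C = (2 * 2 ^ r)%C) by reflexivity.
    pose proof (pow2_neq_0 r) as N2. pose proof C2_neq_0 as N1.
    (* The indices j and 2^r + j differ by half a period, so their values of [qpar] are opposite. *)
    replace ((z + INR (2 ^ r + j)) / 2 ^ S r)%C with (w + (1 / 2)%R)%C.
    2:{ unfold w. rewrite D, plus_INR, RtoC_plus, pow_INR.
        replace (INR 2) with 2 by (simpl; ring). rewrite RtoC_pow, RtoC_div by lra.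
        field. auto. }
    replace ((z + INR j) / 2 ^ r)%C with (w + w)%C by (unfold w; rewrite D; field; auto).
    rewrite !qpar_plus, qpar_half.
    replace (qpar w * - (1))%C with (- qpar w)%C by ring.
    replace (1 - - qpar w)%C with (1 + qpar w)%C by ring.
    apply (euler_dup _ _ _ _ E). apply Cmod_qpar_lt_1. unfold w.
    rewrite Im_div_pow2, Im_plus_R. apply Rdiv_lt_0_compat; [auto|apply Rpow2_pos].
Qed.

Lemma qpar_add_1 z : qpar (z + 1) = qpar z.
Proof. rewrite qpar_plus, qpar_1. ring. Qed.

(* The terms of [euler_iterate], recentered so that each converges. *)
Lemma euler_iterate_centered k P L K z r :
  euler_poly k P L K -> 0 < Im z ->
  csum (fun j => P (qpar ((z + INR j) / 2 ^ S r)) / (1 - qpar ((z + INR j) / 2 ^ S r)) ^ k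
    + P (qpar ((z - 1 - INR j) / 2 ^ S r)) / (1 - qpar ((z - 1 - INR j) / 2 ^ S r)) ^ k)%C (2 ^ r)
  = (2 ^ (k * S r) * (P (qpar z) / (1 - qpar z) ^ k))%C.
Proof.
  intros E Hz. rewrite <- (euler_iterate k P L K z (S r) E Hz).
  replace (2 ^ S r)%nat with (2 ^ r + 2 ^ r)%nat by (simpl; lia).
  (* The upper half of the indices is read backwards: 2^(r+1) - 1 - j is congruent to -1 - j modulo
     the period 2^(r+1). *)
  rewrite csum_split, csum_plus. f_equal. rewrite (csum_rev (fun i => _ / (1 - qpar ((_ + INR (_ + i)) / _)) ^ k)%C).
  apply csum_ext. intros j Hj.
  replace (qpar ((z + INR (2 ^ r + (2 ^ r - 1 - j))) / 2 ^ S r))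
    with (qpar ((z - 1 - INR j) / 2 ^ S r)); auto.
  rewrite <- qpar_add_1. f_equal.
  rewrite plus_INR, !minus_INR by lia. rewrite pow_INR.
  replace (INR 2) with 2 by (simpl; ring). rewrite RtoC_plus, !RtoC_minus, RtoC_pow.
  change (INR 1) with 1. simpl Cpow. field; auto using pow2_neq_0, C2_neq_0.
Qed.

Lemma pow_sq_le x k : 1 <= x -> (2 <= k)%nat -> x ^ 2 <= x ^ k.
Proof. intros H Hk. now apply Rle_pow. Qed.

Lemma Cmod_1_minus_qpar_upper h :
  Cmod h <= 1 -> Cmod (1 - qpar h) <= (2 * PI + 4 * (2 * PI) ^ 2 * exp (2 * PI)) * Cmod h.
Proof.
  intros H. pose proof (qpar_quad h) as Q. pose proof (Cmod_ge_0 h) as P0.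
  pose proof PI_bounds as [P1 P2].
  rewrite Cmod_minus_sym.
  replace (qpar h - 1)%C with ((qpar h - 1 - twopii * h) + twopii * h)%C by ring.
  eapply Rle_trans; [apply Cmod_triangle|]. rewrite Cmod_mult, Cmod_twopii.
  assert (exp (2 * PI * Cmod h) <= exp (2 * PI)).
  { destruct H as [H|H]; [left; apply exp_increasing; nra|rewrite H, Rmult_1_r; lra]. }
  assert (4 * (2 * PI * Cmod h) ^ 2 * exp (2 * PI * Cmod h)
    <= 4 * (2 * PI) ^ 2 * exp (2 * PI) * Cmod h); [|lra].
  replace (4 * (2 * PI) ^ 2 * exp (2 * PI) * Cmod h) with
    (4 * (2 * PI) ^ 2 * Cmod h * exp (2 * PI)) by ring.
  apply Rmult_le_compat; [| left; apply exp_pos | | auto].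
  - pose proof (pow2_ge_0 (2 * PI * Cmod h)). lra.
  - replace ((2 * PI * Cmod h) ^ 2) with ((2 * PI) ^ 2 * (Cmod h * Cmod h)) by ring.
    assert (Cmod h * Cmod h <= Cmod h) by nra.
    rewrite !Rmult_assoc. apply Rmult_le_compat_l; [lra|].
    apply Rmult_le_compat_l; [apply pow2_ge_0|auto].
Qed.

Lemma twopii_neq_0 : twopii <> RtoC 0.
Proof. apply Cmod_gt_0. rewrite Cmod_twopii. pose proof PI_bounds. lra. Qed.

Lemma Copp_twopii_neq_0 : (- twopii)%C <> RtoC 0.
Proof. apply Cmod_gt_0. rewrite Cmod_opp, Cmod_twopii. pose proof PI_bounds. lra. Qed.

Lemma ccv_of_shift u l n : ccv (fun r => u (r + n)%nat) l -> ccv u l.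
Proof.
  intros H eps He. destruct (H eps He) as [N HN]. exists (N + n)%nat. intros m Hm.
  replace m with ((m - n) + n)%nat by lia. apply HN. lia.
Qed.

Lemma exists_pow2_ge x : exists R0 : nat, forall r, x <= 2 ^ (r + R0).
Proof.
  destruct (archimed_cor1 (/ (Rabs x + 1))) as [n [H1 H2]].
  { apply Rinv_0_lt_compat. pose proof (Rabs_pos x). lra. }
  exists n. intros r. pose proof (Rabs_pos x). pose proof (Rle_abs x).
  assert (0 < INR n) by (apply lt_0_INR; lia).
  apply Rinv_lt_cancel in H1; [|lra].
  assert (2 ^ n <= 2 ^ (r + n)) by (apply Rle_pow; [lra|lia]).
  pose proof (pow2_ge_INR n). lra.
Qed.

(** As r grows, q tends to 1, so [P] tends to [L], while 2^r (1 - q) tends to -2 pi i w. *)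
Lemma euler_term_cv k P L K w :
  euler_poly k P L K -> 0 < Im w ->
  ccv (fun r => P (qpar (w / 2 ^ r)) / (1 - qpar (w / 2 ^ r)) ^ k / 2 ^ (k * r))%C
      (L / (- twopii * w) ^ k)%C.
Proof.
  intros E Hw. pose proof (Cmod_ge_0 w) as W0. pose proof PI_bounds as [P1 P2].
  assert (Wn : w <> RtoC 0).
  { apply Cmod_gt_0. pose proof (Cmod_ge_Im w Hw). lra. }
  (* Dropping the first [R0] stages gives |w / 2^r| <= 1, where the quadratic remainder of the
     exponential has a uniform constant. *)
  destruct (exists_pow2_ge (Cmod w)) as [R0 HR].
  set (M := 2 * PI + 4 * (2 * PI) ^ 2 * exp (2 * PI)).
  assert (M0 : 0 < M).
  { unfold M. pose proof (exp_pos (2 * PI)). pose proof (pow2_ge_0 (2 * PI)). nra. }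
  assert (Hh : forall r, Cmod (w / 2 ^ (r + R0)) <= 1).
  { intros r. rewrite Cmod_div_pow2. apply Rmult_le_reg_r with (2 ^ (r + R0)); [apply Rpow2_pos|].
    unfold Rdiv. rewrite Rmult_assoc, Rinv_l, Rmult_1_l, Rmult_1_r; [apply HR|].
    pose proof (Rpow2_pos (r + R0)). lra. }
  apply (ccv_of_shift _ _ R0).
  assert (C1 : ccv (fun r => P (qpar (w / 2 ^ (r + R0)))) L).
  { apply (ccv_pow2 _ _ (Rabs K * M * Cmod w)). intros r.
    assert (Hq : Cmod (qpar (w / 2 ^ (r + R0))) <= 1).
    { left. apply Cmod_qpar_lt_1. rewrite Im_div_pow2.
      apply Rdiv_lt_0_compat; [auto|apply Rpow2_pos]. }
    eapply Rle_trans; [apply (euler_at_1 _ _ _ _ E); auto|].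
    pose proof (Cmod_1_minus_qpar_upper _ (Hh r)) as B. fold M in B.
    rewrite Cmod_div_pow2 in B.
    assert (B2 : Cmod w / 2 ^ (r + R0) <= Cmod w / 2 ^ r).
    { apply Rmult_le_compat_l; auto. apply Rinv_le_contravar; [apply Rpow2_pos|].
      apply Rle_pow; [lra|lia]. }
    pose proof (Cmod_ge_0 (1 - qpar (w / 2 ^ (r + R0)))) as Q0.
    apply Rle_trans with (Rabs K * (M * (Cmod w / 2 ^ r))); [|right; unfold Rdiv; ring].
    apply Rle_trans with (Rabs K * Cmod (1 - qpar (w / 2 ^ (r + R0)))).
    - apply Rmult_le_compat_r; [auto|apply Rle_abs].
    - apply Rmult_le_compat_l; [apply Rabs_pos|]. nra. }
  assert (C2 : ccv (fun r => 2 ^ (r + R0) * (1 - qpar (w / 2 ^ (r + R0))))%C (- twopii * w)%C).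
  { apply (ccv_pow2 _ _ (4 * (2 * PI) ^ 2 * exp (2 * PI) * Cmod w ^ 2)). intros r.
    pose proof (Rpow2_pos (r + R0)) as T0. pose proof (pow2_neq_0 (r + R0)) as T1.
    specialize (Hh r). set (h := (w / 2 ^ (r + R0))%C) in *.
    replace (2 ^ (r + R0) * (1 - qpar h) - - twopii * w)%C
      with (- (2 ^ (r + R0) * (qpar h - 1 - twopii * h)))%C.
    2:{ replace w with (2 ^ (r + R0) * h)%C by (unfold h; field; auto). ring. }
    rewrite Cmod_opp, Cmod_mult, Cmod_pow, Cmod_R, Rabs_pos_eq by lra.
    pose proof (qpar_quad h) as Q. pose proof (Cmod_ge_0 h) as P0.
    assert (Eh : Cmod h = Cmod w / 2 ^ (r + R0)) by apply Cmod_div_pow2.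
    assert (X : exp (2 * PI * Cmod h) <= exp (2 * PI)).
    { destruct Hh as [H|H]; [left; apply exp_increasing; nra|rewrite H, Rmult_1_r; lra]. }
    apply Rle_trans with (2 ^ (r + R0) * (4 * (2 * PI * Cmod h) ^ 2 * exp (2 * PI))).
    - apply Rmult_le_compat_l; [lra|]. eapply Rle_trans; [exact Q|].
      apply Rmult_le_compat_l; auto. pose proof (pow2_ge_0 (2 * PI * Cmod h)). lra.
    - rewrite Eh.
      replace (2 ^ (r + R0) * (4 * (2 * PI * (Cmod w / 2 ^ (r + R0))) ^ 2 * exp (2 * PI)))
        with (4 * (2 * PI) ^ 2 * exp (2 * PI) * Cmod w ^ 2 / 2 ^ (r + R0)) by (field; lra).
      apply Rmult_le_compat_l.
      + pose proof (exp_pos (2 * PI)). pose proof (pow2_ge_0 (2 * PI)).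
        pose proof (pow2_ge_0 (Cmod w)). apply Rmult_le_pos; nra.
      + apply Rinv_le_contravar; [apply Rpow2_pos|]. apply Rle_pow; [lra|lia]. }
  assert (W1 : ((- twopii * w) ^ k)%C <> RtoC 0).
  { apply Cpow_nz, Cmult_neq_0; auto using Copp_twopii_neq_0. }
  assert (C3 := ccv_mult _ _ _ _ C1 (ccv_inv _ _ W1 (ccv_pow _ _ k C2))).
  eapply ccv_ext; [|exact C3]. intros r. cbn beta.
  rewrite Cpow_mult_l, <- Cpow_mult_r. unfold Cdiv. rewrite (Nat.mul_comm k).
  assert (N1 : ((1 - qpar (w * / 2 ^ (r + R0))) ^ k)%C <> RtoC 0).
  { apply Cpow_nz. intros H. pose proof (Cmod_qpar_lt_1 (w / 2 ^ (r + R0))) as Q.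
    replace (qpar (w / 2 ^ (r + R0))) with (1 - (1 - qpar (w * / 2 ^ (r + R0))))%C in Q
      by (unfold Cdiv; ring). rewrite H, Im_div_pow2 in Q.
    replace (1 - 0)%C with (RtoC 1) in Q by ring. rewrite Cmod_1 in Q.
    assert (1 < 1); [|lra]. apply Q. apply Rdiv_lt_0_compat; [auto|apply Rpow2_pos]. }
  field. split; [apply Cpow_nz, C2_neq_0|auto].
Qed.

(** The bound does not depend on [r], and its numerator depends on [w] only through [Im w], which
    all real translates share. Along these translates it therefore decays like |w|^(-k). *)
Lemma euler_term_bound k P L K w r :
  euler_poly k P L K -> 0 < Im w -> Rabs (Re w) <= 3 / 4 * 2 ^ r ->
  Cmod (P (qpar (w / 2 ^ r)) / (1 - qpar (w / 2 ^ r)) ^ k / 2 ^ (k * r))%C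
    <= K * (2 / exp (- 2 * PI * Im w)) ^ k / Cmod w ^ k.
Proof.
  intros E Hw Hr. pose proof (Rpow2_pos r) as T0. pose proof (Cmod_ge_Im w Hw) as W0.
  pose proof PI_bounds as [P1 P2].
  set (h := (w / 2 ^ r)%C).
  assert (Ih : 0 < Im h) by (unfold h; rewrite Im_div_pow2; now apply Rdiv_lt_0_compat).
  pose proof (Cmod_1_minus_qpar_lower h) as B.
  assert (B2 : exp (- 2 * PI * Im h) / 2 * Cmod h <= Cmod (1 - qpar h)).
  { apply B; auto. unfold h. rewrite Re_div_pow2. unfold Rdiv.
    rewrite Rabs_mult, (Rabs_pos_eq (/ 2 ^ r)) by (left; now apply Rinv_0_lt_compat).
    apply Rmult_le_reg_r with (2 ^ r); auto. rewrite Rmult_assoc, Rinv_l by lra. lra. }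
  assert (B3 : exp (- 2 * PI * Im w) / 2 * Cmod h <= Cmod (1 - qpar h)).
  { eapply Rle_trans; [|exact B2]. apply Rmult_le_compat_r; [apply Cmod_ge_0|].
    assert (Im h <= Im w).
    { unfold h. rewrite Im_div_pow2. apply Rmult_le_reg_r with (2 ^ r); auto.
      unfold Rdiv. rewrite Rmult_assoc, Rinv_l by lra.
      assert (1 <= 2 ^ r) by (apply pow_R1_Rle; lra). nra. }
    assert (exp (- 2 * PI * Im w) <= exp (- 2 * PI * Im h)); [|lra].
    destruct H as [H|H]; [left; apply exp_increasing; nra|rewrite H; lra]. }
  set (e := exp (- 2 * PI * Im w)) in *. assert (E0 : 0 < e) by apply exp_pos.
  assert (Eh : Cmod h = Cmod w / 2 ^ r) by apply Cmod_div_pow2.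
  assert (H0 : 0 < Cmod h) by (rewrite Eh; apply Rdiv_lt_0_compat; lra).
  assert (Q0 : 0 < Cmod (1 - qpar h)) by nra.
  assert (Qn : (1 - qpar h)%C <> RtoC 0) by now apply Cmod_gt_0.
  rewrite !Cmod_div by (try apply Cpow_nz; auto using C2_neq_0).
  rewrite !Cmod_pow, Cmod_R, Rabs_pos_eq by lra. rewrite Nat.mul_comm, pow_mult.
  assert (K0 : Cmod (P (qpar h)) <= K).
  { apply (euler_bound _ _ _ _ E). left. now apply Cmod_qpar_lt_1. }
  pose proof (Cmod_ge_0 (P (qpar h))) as PP.
  replace (Cmod (P (qpar h)) / Cmod (1 - qpar h) ^ k / (2 ^ r) ^ k)
    with (Cmod (P (qpar h)) * (/ Cmod (1 - qpar h) * / 2 ^ r) ^ k)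
    by (rewrite Rpow_mult_distr, !pow_inv; unfold Rdiv; ring).
  replace (K * (2 / e) ^ k / Cmod w ^ k) with (K * (2 / e * / Cmod w) ^ k)
    by (rewrite Rpow_mult_distr, !pow_inv; unfold Rdiv; ring).
  apply Rmult_le_compat; auto.
  - apply pow_le. left. apply Rmult_lt_0_compat; apply Rinv_0_lt_compat; lra.
  - apply pow_incr. split.
    + left. apply Rmult_lt_0_compat; apply Rinv_0_lt_compat; lra.
    + replace (2 / e * / Cmod w) with (/ (e / 2 * Cmod h) * / 2 ^ r).
      * apply Rmult_le_compat_r; [left; now apply Rinv_0_lt_compat|].
        apply Rinv_le_contravar; [|auto]. nra.
      * rewrite Eh. field. lra.
Qed.

(** The triangle inequality bounds n + 1 by the modulus of the translate plus |w| + 1, and this last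
    constant is absorbed because the modulus is at least [Im w]. *)
Lemma Cmod_shift_lower w n :
  0 < Im w ->
  INR n + 1 <= (1 + (Cmod w + 1) / Im w) * Cmod (w + INR n) /\
  INR n + 1 <= (1 + (Cmod w + 1) / Im w) * Cmod (w - 1 - INR n).
Proof.
  intros Hw. pose proof (pos_INR n) as N0. pose proof (Cmod_ge_0 w) as W0.
  assert (G : forall c, Im c = Im w -> INR n + 1 <= Cmod c + (Cmod w + 1) ->
     INR n + 1 <= (1 + (Cmod w + 1) / Im w) * Cmod c).
  { intros c Hc H. assert (Hl : Im w <= Cmod c) by (rewrite <- Hc; apply Cmod_ge_Im; lra).
    eapply Rle_trans; [exact H|]. rewrite Rmult_plus_distr_r, Rmult_1_l.
    apply Rplus_le_compat_l. apply Rmult_le_reg_r with (Im w); auto.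
    unfold Rdiv. replace ((Cmod w + 1) * / Im w * Cmod c * Im w)
      with ((Cmod w + 1) * Cmod c) by (field; lra). nra. }
  split; apply G.
  - apply Im_plus_R.
  - pose proof (Cmod_minus_le (w + INR n) w) as H.
    replace (w + INR n - w)%C with (RtoC (INR n)) in H by ring.
    rewrite Cmod_R, Rabs_pos_eq in H; lra.
  - destruct w. unfold Im. simpl. ring.
  - pose proof (Cmod_minus_le w (w - 1 - INR n)) as H.
    replace (w - (w - 1 - INR n))%C with (RtoC (INR n + 1)) in H by (rewrite RtoC_plus; ring).
    rewrite Cmod_R, Rabs_pos_eq in H; lra.
Qed.

Lemma rsum_inv_sq_scal c N : 0 <= c -> rsum (fun n => c * / (INR n + 1) ^ 2) N <= 2 * c.
Proof. intros H. rewrite rsum_scal. pose proof (rsum_inv_sq N). nra. Qed.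

Lemma inv_pow_le_inv_sq x y c k :
  (2 <= k)%nat -> 1 <= y -> 0 < c -> 0 < x -> y <= c * x -> / x ^ k <= c ^ k * / y ^ 2.
Proof.
  intros Hk Hy Hc Hx H.
  apply Rle_trans with (c ^ k * / y ^ k).
  - rewrite <- !pow_inv, <- Rpow_mult_distr. apply pow_incr. split.
    + left. now apply Rinv_0_lt_compat.
    + apply Rmult_le_reg_r with (x * y); [nra|].
      replace (/ x * (x * y)) with y by (field; lra).
      replace (c * / y * (x * y)) with (c * x) by (field; lra). auto.
  - apply Rmult_le_compat_l; [apply pow_le; lra|].
    apply Rinv_le_contravar; [apply pow_lt; lra|]. now apply pow_sq_le.
Qed.

(** After division by the power of 2, every stage of the centered duplication formula has the same
    value. Tannery's theorem moves the limit inside, so the limit of the stages is that value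
    itself. *)
Lemma lipschitz_formula k P L K z :
  (2 <= k)%nat -> euler_poly k P L K -> 0 < Im z ->
  csums (fun n => L / (- twopii * (z + INR n)) ^ k + L / (- twopii * (z - 1 - INR n)) ^ k)%C
        (P (qpar z) / (1 - qpar z) ^ k)%C.
Proof.
  intros Hk E Hz. pose proof (Cmod_ge_0 z) as Z0.
  (* Then |Re z| <= 2^(r+R0) / 2, and a shift by at most 2^(r+R0) keeps real parts within 3/4 of
     2^(r+R0+1), as [euler_term_bound] requires. *)
  destruct (exists_pow2_ge (2 * (Rabs (Re z) + 1))) as [R0 HR].
  set (T := fun w r => (P (qpar (w / 2 ^ r)) / (1 - qpar (w / 2 ^ r)) ^ k / 2 ^ (k * r))%C).
  (* The finite sums are padded by zeros to become series with a common index set. *)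
  set (a := fun r n => if (n <? 2 ^ (r + R0))%nat then
      (T (z + INR n)%C (S (r + R0)) + T (z - 1 - INR n)%C (S (r + R0)))%C else RtoC 0).
  set (c := 1 + (Cmod z + 1) / Im z).
  assert (c0 : 0 < c) by (unfold c; pose proof (Rdiv_lt_0_compat (Cmod z + 1) (Im z)); lra).
  set (D := K * (2 / exp (- 2 * PI * Im z)) ^ k).
  assert (K0 : 0 <= K).
  { eapply Rle_trans; [apply Cmod_ge_0|apply (euler_bound _ _ _ _ E 0%C)]. rewrite Cmod_0. lra. }
  assert (D0 : 0 <= D).
  { apply Rmult_le_pos; auto. apply pow_le. left. apply Rdiv_lt_0_compat; [lra|apply exp_pos]. }
  assert (Im1 : forall n, Im (z + INR n)%C = Im z) by (intros; apply Im_plus_R).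
  assert (Im2 : forall n, Im (z - 1 - INR n)%C = Im z) by (intros; destruct z; unfold Im; simpl; ring).
  destruct (tannery a (fun n => L / (- twopii * (z + INR n)) ^ k
      + L / (- twopii * (z - 1 - INR n)) ^ k)%C (fun n => (2 * D * c ^ k) * / (INR n + 1) ^ 2)
      (2 * (2 * D * c ^ k)) (fun _ => (P (qpar z) / (1 - qpar z) ^ k)%C)) as [l [H1 H2]].
  - intros N. apply rsum_inv_sq_scal. pose proof (pow_lt c k c0). nra.
  - intros r n. pose proof (pos_INR n) as N0.
    assert (V0 : 0 <= D * c ^ k * / (INR n + 1) ^ 2).
    { apply Rmult_le_pos; [pose proof (pow_lt c k c0); nra|]. left. apply Rinv_0_lt_compat, pow_lt. lra. }
    unfold a. destruct (Nat.ltb_spec n (2 ^ (r + R0))) as [Hn|Hn]; [|rewrite Cmod_0; lra].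
    assert (Hn' : INR n + 1 <= 2 ^ (r + R0)).
    { rewrite <- S_INR. replace (2 ^ (r + R0)) with (INR (2 ^ (r + R0))) by (rewrite pow_INR; reflexivity).
      apply le_INR. lia. }
    specialize (HR r). pose proof (Cmod_shift_lower z n Hz) as [S1 S2]. fold c in S1, S2.
    assert (G : forall w, Im w = Im z -> Rabs (Re w) <= Rabs (Re z) + (INR n + 1) ->
        INR n + 1 <= c * Cmod w -> Cmod (T w (S (r + R0))) <= D * c ^ k * / (INR n + 1) ^ 2).
    { intros w Hw Rw Sw. eapply Rle_trans; [apply (euler_term_bound k P L K); auto; [lra|simpl; lra]|].
      rewrite Hw. fold D. unfold Rdiv. rewrite Rmult_assoc. apply Rmult_le_compat_l; auto.
      apply inv_pow_le_inv_sq; auto; [lra|]. nra. }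
    eapply Rle_trans; [apply Cmod_triangle|].
    assert (Cmod (T (z + INR n)%C (S (r + R0))) <= D * c ^ k * / (INR n + 1) ^ 2).
    { apply G; auto.
      replace (Re (z + INR n)) with (Re z + INR n) by (destruct z; unfold Re; simpl; ring).
      eapply Rle_trans; [apply Rabs_triang|]. rewrite (Rabs_pos_eq (INR n)); lra. }
    assert (Cmod (T (z - 1 - INR n)%C (S (r + R0))) <= D * c ^ k * / (INR n + 1) ^ 2).
    { apply G; auto.
      replace (Re (z - 1 - INR n)) with (Re z + - (INR n + 1)) by (destruct z; unfold Re; simpl; ring).
      eapply Rle_trans; [apply Rabs_triang|]. rewrite Rabs_Ropp, (Rabs_pos_eq (INR n + 1)); lra. }
    lra.
  - intros n. apply (ccv_of_shift _ _ n).
    assert (C1 : forall w, Im w = Im z -> ccv (fun r => T w (S (r + n + R0))) (L / (- twopii * w) ^ k)%C).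
    { intros w Hw eps He. destruct (euler_term_cv k P L K w E ltac:(lra) eps He) as [N HN].
      exists N. intros m Hm. apply HN. lia. }
    eapply ccv_ext; [|apply (ccv_plus _ _ _ _ (C1 _ (Im1 n)) (C1 _ (Im2 n)))].
    intros r. unfold a. destruct (Nat.ltb_spec n (2 ^ (r + n + R0))) as [Hn|Hn]; auto.
    exfalso. assert (n < 2 ^ n)%nat by (apply Nat.pow_gt_lin_r; lia).
    assert (2 ^ n <= 2 ^ (r + n + R0))%nat by (apply Nat.pow_le_mono_r; lia). lia.
  - intros r. replace (P (qpar z) / (1 - qpar z) ^ k)%C with (csum (a r) (2 ^ (r + R0))).
    + apply csums_finite. intros n Hn. unfold a. destruct (Nat.ltb_spec n (2 ^ (r + R0))); [lia|auto].
    + rewrite (csum_ext _ (fun n => / 2 ^ (k * S (r + R0)) *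
        (P (qpar ((z + INR n) / 2 ^ S (r + R0))) / (1 - qpar ((z + INR n) / 2 ^ S (r + R0))) ^ k
        + P (qpar ((z - 1 - INR n) / 2 ^ S (r + R0))) / (1 - qpar ((z - 1 - INR n) / 2 ^ S (r + R0))) ^ k))%C).
      * rewrite csum_scal, (euler_iterate_centered k P L K z (r + R0) E Hz).
        rewrite Cmult_assoc, Cinv_l by apply pow2_neq_0. ring.
      * intros n Hn. unfold a. destruct (Nat.ltb_spec n (2 ^ (r + R0))); [|lia].
        unfold T, Cdiv. ring.
  - replace (P (qpar z) / (1 - qpar z) ^ k)%C with l; auto.
    exact (ccv_unique _ _ _ H2 (ccv_const _)).
Qed.

(** * Eisenstein series *)

(** Bernoulli's inequality for the powers of 1 / t. *)
Lemma INR_mult_pow_bound t : 0 <= t < 1 -> exists B, 0 <= B /\ forall n, INR n * t ^ n <= B.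
Proof.
  intros [H1 H2]. destruct (Req_dec t 0) as [->|H0].
  - exists 0. split; [lra|]. intros [|n]; simpl; lra.
  - assert (T : 0 < / t - 1).
    { assert (1 < / t); [|lra]. rewrite <- Rinv_1. apply Rinv_lt_contravar; lra. }
    exists (/ (/ t - 1)). split; [left; now apply Rinv_0_lt_compat|]. intros n.
    pose proof (poly n (/ t - 1) T) as Q. replace (1 + (/ t - 1)) with (/ t) in Q by ring.
    rewrite pow_inv in Q. assert (P : 0 < t ^ n) by (apply pow_lt; lra).
    apply Rmult_le_reg_r with (/ t - 1); auto. rewrite Rinv_l by lra.
    apply Rmult_le_reg_r with (/ t ^ n); [now apply Rinv_0_lt_compat|].
    replace (INR n * t ^ n * (/ t - 1) * / t ^ n) with (INR n * (/ t - 1)) by (field; lra). lra.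
Qed.

Lemma rsum_geom r N : 0 <= r < 1 -> rsum (fun n => r ^ n) N <= / (1 - r).
Proof.
  intros [H1 H2]. assert (E : rsum (fun n => r ^ n) N = (1 - r ^ N) / (1 - r)).
  { induction N as [|N IH]; simpl; [|rewrite IH]; field; lra. }
  rewrite E. unfold Rdiv. rewrite <- (Rmult_1_l (/ (1 - r))) at 2.
  apply Rmult_le_compat_r; [left; apply Rinv_0_lt_compat; lra|].
  pose proof (pow_le r N H1). lra.
Qed.

(** Each factor [INR d] is paid for by enlarging the ratio from r to (r + 1) / 2. *)
Lemma rsum_INR_pow_bound j r :
  0 <= r < 1 -> exists B, forall N, rsum (fun d => INR d ^ j * r ^ d) N <= B.
Proof.
  revert r. induction j as [|j IH]; intros r Hr.
  - exists (/ (1 - r)). intros N. rewrite (rsum_ext _ (fun d => r ^ d)); [now apply rsum_geom|].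
    intros; simpl; ring.
  - set (s := (r + 1) / 2). assert (Hs : 0 < s < 1 /\ r < s) by (unfold s; lra).
    destruct (INR_mult_pow_bound (r / s)) as [C [C0 HC]].
    { split; [apply Rmult_le_pos; [lra|left; apply Rinv_0_lt_compat; lra]|].
      apply Rmult_lt_reg_r with s; [lra|]. unfold Rdiv. rewrite Rmult_assoc, Rinv_l; lra. }
    destruct (IH s ltac:(lra)) as [B HB]. exists (C * B). intros N.
    apply Rle_trans with (rsum (fun d => C * (INR d ^ j * s ^ d)) N).
    + apply rsum_le. intros d _. specialize (HC d).
      replace (INR d ^ S j * r ^ d) with ((INR d * (r / s) ^ d) * (INR d ^ j * s ^ d)).
      * apply Rmult_le_compat_r; auto. apply Rmult_le_pos; apply pow_le; [apply pos_INR|lra].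
      * assert (s ^ d <> 0) by (apply pow_nonzero; lra).
        unfold Rdiv. rewrite Rpow_mult_distr, pow_inv. simpl. field. auto.
    + rewrite rsum_scal. specialize (HB N). nra.
Qed.

Lemma Cmod_INR_pow_term j d q : Cmod (INR d ^ j * q ^ d)%C = INR d ^ j * Cmod q ^ d.
Proof.
  rewrite Cmod_mult, !Cmod_pow, Cmod_R, Rabs_pos_eq by apply pos_INR. reflexivity.
Qed.

Lemma csums_INR_pow_exists j q : Cmod q < 1 -> exists l, csums (fun d => INR d ^ j * q ^ d)%C l.
Proof.
  intros Hq. destruct (rsum_INR_pow_bound j (Cmod q)) as [B HB]; [split; [apply Cmod_ge_0|auto]|].
  apply (csums_dominated _ (fun d => INR d ^ j * Cmod q ^ d) B); auto.
  intros n. rewrite Cmod_INR_pow_term. lra.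
Qed.

Lemma one_minus_neq_0 q : Cmod q < 1 -> (1 - q)%C <> RtoC 0.
Proof.
  intros H E. pose proof (Cmod_minus_ge 1 q) as G. rewrite E, Cmod_0, Cmod_1 in G. lra.
Qed.

Lemma csums_INR_pow_shift j q l T :
  Cmod q < 1 -> csums (fun d => (INR d + 1) ^ j * q ^ d)%C T ->
  csums (fun d => INR d ^ j * q ^ d)%C l -> l = (0 ^ j + q * T)%C.
Proof.
  intros Hq HT Hl. apply csums_shift in Hl.
  assert (H : csums (fun d => INR (S d) ^ j * q ^ S d)%C (q * T)%C).
  { apply (csums_ext (fun d => q * ((INR d + 1) ^ j * q ^ d))%C).
    - intros d. rewrite S_INR, RtoC_plus. simpl. ring.
    - now apply csums_scal. }
  pose proof (csums_unique _ _ _ Hl H) as E. simpl in E. rewrite <- E. ring.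
Qed.

(** Shifting the index and expanding (d + 1)^j expresses the j-th sum through itself and the lower
    ones; solving for it gives the closed form. The numerators are q times the Eulerian
    polynomials. *)
Lemma csums_INR_pow q : Cmod q < 1 ->
  csums (fun d => INR d ^ 3 * q ^ d)%C (q * (1 + 4 * q + q * q) / (1 - q) ^ 4)%C /\
  csums (fun d => INR d ^ 5 * q ^ d)%C
    (q * (1 + 26 * q + 66 * (q * q) + 26 * (q * q * q) + q * q * q * q) / (1 - q) ^ 6)%C.
Proof.
  intros Hq. pose proof (one_minus_neq_0 q Hq) as N.
  destruct (csums_INR_pow_exists 0 q Hq) as [s0 H0].
  destruct (csums_INR_pow_exists 1 q Hq) as [s1 H1].
  destruct (csums_INR_pow_exists 2 q Hq) as [s2 H2].
  destruct (csums_INR_pow_exists 3 q Hq) as [s3 H3].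
  destruct (csums_INR_pow_exists 4 q Hq) as [s4 H4].
  destruct (csums_INR_pow_exists 5 q Hq) as [s5 H5].
  assert (G : forall a b x : C, x = (a + q * (x + b))%C -> x = ((a + q * b) / (1 - q))%C).
  { intros a b x H. apply (f_equal (fun y => (y - q * x)%C)) in H.
    replace (a + q * b)%C with (x - q * x)%C by (rewrite H; ring). field. auto. }
  assert (E0 : s0 = ((1 + q * 0) / (1 - q))%C).
  { apply G, (csums_INR_pow_shift 0 q); auto.
    replace (s0 + 0)%C with s0 by ring. now apply (csums_ext (fun d => INR d ^ 0 * q ^ d)%C). }
  assert (E1 : s1 = ((0 + q * s0) / (1 - q))%C).
  { apply G. replace (RtoC 0) with (0 ^ 1)%C by (simpl; ring). apply (csums_INR_pow_shift 1 q); auto.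
    eapply csums_ext; [|exact (csums_plus _ _ _ _ H1 H0)]. intros; simpl; ring. }
  assert (E2 : s2 = ((0 + q * (2 * s1 + s0)) / (1 - q))%C).
  { apply G. replace (RtoC 0) with (0 ^ 2)%C by (simpl; ring). apply (csums_INR_pow_shift 2 q); auto.
    eapply csums_ext; [|exact (csums_plus _ _ _ _ H2 (csums_plus _ _ _ _ (csums_scal 2 _ _ H1) H0))].
    intros; simpl; ring. }
  assert (E3 : s3 = ((0 + q * (3 * s2 + (3 * s1 + s0))) / (1 - q))%C).
  { apply G. replace (RtoC 0) with (0 ^ 3)%C by (simpl; ring). apply (csums_INR_pow_shift 3 q); auto.
    eapply csums_ext; [|exact (csums_plus _ _ _ _ H3 (csums_plus _ _ _ _ (csums_scal 3 _ _ H2)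
      (csums_plus _ _ _ _ (csums_scal 3 _ _ H1) H0)))].
    intros; simpl; ring. }
  assert (E4 : s4 = ((0 + q * (4 * s3 + (6 * s2 + (4 * s1 + s0)))) / (1 - q))%C).
  { apply G. replace (RtoC 0) with (0 ^ 4)%C by (simpl; ring). apply (csums_INR_pow_shift 4 q); auto.
    eapply csums_ext; [|exact (csums_plus _ _ _ _ H4 (csums_plus _ _ _ _ (csums_scal 4 _ _ H3)
      (csums_plus _ _ _ _ (csums_scal 6 _ _ H2) (csums_plus _ _ _ _ (csums_scal 4 _ _ H1) H0))))].
    intros; simpl; ring. }
  assert (E5 : s5 = ((0 + q * (5 * s4 + (10 * s3 + (10 * s2 + (5 * s1 + s0))))) / (1 - q))%C).
  { apply G. replace (RtoC 0) with (0 ^ 5)%C by (simpl; ring). apply (csums_INR_pow_shift 5 q); auto.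
    eapply csums_ext; [|exact (csums_plus _ _ _ _ H5 (csums_plus _ _ _ _ (csums_scal 5 _ _ H4)
      (csums_plus _ _ _ _ (csums_scal 10 _ _ H3) (csums_plus _ _ _ _ (csums_scal 10 _ _ H2)
      (csums_plus _ _ _ _ (csums_scal 5 _ _ H1) H0)))))].
    intros; simpl; ring. }
  split.
  - replace (q * (1 + 4 * q + q * q) / (1 - q) ^ 4)%C with s3; auto.
    rewrite E3, E2, E1, E0. field. auto.
  - match goal with |- csums _ ?v => replace v with s5; auto end.
    rewrite E5, E4, E3, E2, E1, E0. field. auto.
Qed.

Lemma Cmod_poly_term c q x B :
  0 <= c -> Cmod q <= 1 -> Cmod x <= B -> Cmod (c + q * x) <= c + B.
Proof.
  intros Hc Hq Hx. eapply Rle_trans; [apply Cmod_triangle|].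
  rewrite Cmod_mult, Cmod_R, Rabs_pos_eq by auto.
  pose proof (Cmod_ge_0 q). pose proof (Cmod_ge_0 x). nra.
Qed.

Lemma one_plus_neq_0 q : Cmod q < 1 -> (1 + q)%C <> RtoC 0.
Proof.
  intros H. replace (1 + q)%C with (1 - - q)%C by ring. apply one_minus_neq_0. now rewrite Cmod_opp.
Qed.

(** 6 = 3! is the value of the polynomial at 1. The constant 12 is the coefficient sum 6 + 5 + 1 of
    the quotient of 6 - P by 1 - q; the smaller bound 6 for P itself is padded to it. The same
    pattern gives 120 = 5! and 360 in weight six. *)
Lemma euler_poly_4 : euler_poly 4 (fun q => q * (1 + 4 * q + q * q))%C 6 12.
Proof.
  split.
  - intros q Hq. replace (q * (1 + 4 * q + q * q))%C with (0 + q * (1 + q * (4 + q * 1)))%C by ring.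
    replace 12 with (0 + (1 + (4 + 7))) by ring.
    do 3 (apply Cmod_poly_term; [lra|auto|]). rewrite Cmod_1. lra.
  - intros q Hq. replace (q * (1 + 4 * q + q * q) - 6)%C
      with (- ((6 + q * (5 + q * 1)) * (1 - q)))%C by ring.
    rewrite Cmod_opp, Cmod_mult. apply Rmult_le_compat_r; [apply Cmod_ge_0|].
    replace 12 with (6 + (5 + 1)) by ring.
    do 2 (apply Cmod_poly_term; [lra|auto|]). rewrite Cmod_1. lra.
  - intros p Hp. pose proof (one_minus_neq_0 p Hp). pose proof (one_plus_neq_0 p Hp).
    replace (1 - p * p)%C with ((1 - p) * (1 + p))%C by ring. field. auto.
  - intros q Hq. apply (csums_INR_pow q Hq).
Qed.

Lemma euler_poly_6 : euler_poly 6
  (fun q => q * (1 + 26 * q + 66 * (q * q) + 26 * (q * q * q) + q * q * q * q))%C 120 360.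
Proof.
  split.
  - intros q Hq. match goal with |- Cmod ?v <= _ =>
      replace v with (0 + q * (1 + q * (26 + q * (66 + q * (26 + q * 1)))))%C by ring end.
    replace 360 with (0 + (1 + (26 + (66 + (26 + 241))))) by ring.
    do 5 (apply Cmod_poly_term; [lra|auto|]). rewrite Cmod_1. lra.
  - intros q Hq. match goal with |- Cmod ?v <= _ => replace v
      with (- ((120 + q * (119 + q * (93 + q * (27 + q * 1)))) * (1 - q)))%C by ring end.
    rewrite Cmod_opp, Cmod_mult. apply Rmult_le_compat_r; [apply Cmod_ge_0|].
    replace 360 with (120 + (119 + (93 + (27 + 1)))) by ring.
    do 4 (apply Cmod_poly_term; [lra|auto|]). rewrite Cmod_1. lra.
  - intros p Hp. pose proof (one_minus_neq_0 p Hp). pose proof (one_plus_neq_0 p Hp).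
    replace (1 - p * p)%C with ((1 - p) * (1 + p))%C by ring. field. auto.
  - intros q Hq. apply (csums_INR_pow q Hq).
Qed.

Lemma rsum_sup v B :
  (forall n, 0 <= v n) -> (forall N, rsum v N <= B) ->
  exists l, csums (fun n => RtoC (v n)) (RtoC l) /\ (forall N, rsum v N <= l) /\ l <= B.
Proof.
  intros Hv HB.
  destruct (completeness (fun x => exists n, x = rsum v n)) as [l [Hu Hl]].
  - exists B. intros x [n ->]. auto.
  - exists (rsum v 0). now exists O.
  - assert (Hu' : forall N, rsum v N <= l) by (intros N; apply Hu; now exists N).
    exists l. split; [|split; auto].
    + intros eps He. destruct (Classical_Prop.classic (exists N, l - eps < rsum v N)) as [[N K]|K].
      * exists N. intros n Hn.
        assert (E : forall m, csum (fun n => RtoC (v n)) m = RtoC (rsum v m)).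
        { induction m as [|m IH]; simpl; auto. now rewrite IH, RtoC_plus. }
        rewrite E, <- RtoC_minus, Cmod_R, Rabs_left1; [|specialize (Hu' n); lra].
        pose proof (rsum_incr v N n Hv Hn). lra.
      * assert (l <= l - eps); [|lra]. apply Hl. intros x [n ->].
        apply Rnot_lt_le. intros Hn. apply K. now exists n.
    + apply Hl. intros x [n ->]. auto.
Qed.

Lemma Cpow_even_opp x h : ((- x) ^ (2 * h))%C = (x ^ (2 * h))%C.
Proof. rewrite !Cpow_mult_r. f_equal. simpl. ring. Qed.

(** * Lattice sums and the inversion z |-> -1/z *)

Definition S_act (z : C) : C := (- / z)%C.

Lemma in_H_neq_0 z : 0 < Im z -> z <> RtoC 0.
Proof. intros H. apply Cmod_gt_0. pose proof (Cmod_ge_Im z H). lra. Qed.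

Lemma Im_S_act z : 0 < Im z -> 0 < Im (S_act z).
Proof.
  intros H. destruct z as [x y]. unfold Im in *. simpl in *.
  apply Rmult_lt_reg_r with (x * (x * 1) + y * (y * 1)); [nra|].
  replace (- (- y / (x * (x * 1) + y * (y * 1))) * (x * (x * 1) + y * (y * 1))) with y by (field; nra).
  lra.
Qed.

(** The lattice points with both coordinates nonzero, one from each pair of opposite points, with n
    and -n taken together. The two axes are accounted for separately by zeta(2h). *)
Definition lattice_term (h : nat) (z : C) (m n : nat) : C :=
  (/ (INR (S m) * z + INR (S n)) ^ (2 * h) + / (INR (S m) * z - INR (S n)) ^ (2 * h))%C.

(** Both coordinates are at most c |mz + sn|, hence so is their geometric mean. Raised to the power
    h >= 2, the bound becomes summable in m and n simultaneously. *)
Lemma lattice_lower z m n (s : R) :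
  0 < Im z -> Rabs s = 1 ->
  INR (S m) * INR (S n) <= (1 + (Cmod z + 1) / Im z) ^ 2 * Cmod (INR (S m) * z + s * INR (S n)) ^ 2.
Proof.
  intros Hz Hs. set (w := (INR (S m) * z + s * INR (S n))%C).
  set (c := 1 + (Cmod z + 1) / Im z). pose proof (Cmod_ge_0 z) as Z0.
  assert (M1 : 0 < INR (S m)) by (apply lt_0_INR; lia).
  assert (N1 : 0 < INR (S n)) by (apply lt_0_INR; lia).
  assert (Hw : INR (S m) * Im z <= Cmod w).
  { replace (INR (S m) * Im z) with (Im w).
    - apply Cmod_ge_Im. replace (Im w) with (INR (S m) * Im z); [nra|].
      unfold w. destruct z. unfold Im. cbn -[INR]. ring.
    - unfold w. destruct z. unfold Im. cbn -[INR]. ring. }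
  assert (W0 : 0 < Cmod w) by nra.
  assert (A : INR (S m) <= Cmod w / Im z).
  { apply Rmult_le_reg_r with (Im z); auto. unfold Rdiv. rewrite Rmult_assoc, Rinv_l; lra. }
  assert (Hc : c * Cmod w = Cmod w + Cmod z * (Cmod w / Im z) + Cmod w / Im z)
    by (unfold c; field; lra).
  assert (A1 : 0 <= Cmod w / Im z) by lra.
  assert (A2 : 0 <= Cmod z * (Cmod w / Im z)) by nra.
  assert (B1 : INR (S m) <= c * Cmod w) by lra.
  assert (B2 : INR (S n) <= c * Cmod w).
  { pose proof (Cmod_minus_le w (INR (S m) * z)) as H.
    replace (w - INR (S m) * z)%C with (s * INR (S n))%C in H by (unfold w; ring).
    rewrite !Cmod_mult, !Cmod_R, Hs, !Rabs_pos_eq in H by lra. nra. }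
  replace (c ^ 2 * Cmod w ^ 2) with ((c * Cmod w) * (c * Cmod w)) by ring.
  apply Rmult_le_compat; lra.
Qed.

Lemma lattice_term_bound h z m n :
  (2 <= h)%nat -> 0 < Im z ->
  Cmod (lattice_term h z m n)
    <= 2 * ((1 + (Cmod z + 1) / Im z) ^ 2) ^ h * / (INR m + 1) ^ 2 * / (INR n + 1) ^ 2.
Proof.
  intros Hh Hz. set (c := 1 + (Cmod z + 1) / Im z).
  assert (c0 : 0 < c).
  { unfold c. pose proof (Cmod_ge_0 z). pose proof (Rdiv_lt_0_compat (Cmod z + 1) (Im z)). lra. }
  assert (M1 : 1 <= INR (S m)) by (rewrite S_INR; pose proof (pos_INR m); lra).
  assert (N1 : 1 <= INR (S n)) by (rewrite S_INR; pose proof (pos_INR n); lra).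
  assert (G : forall s : R, Rabs s = 1 -> Cmod (/ (INR (S m) * z + s * INR (S n)) ^ (2 * h))
     <= (c ^ 2) ^ h * / (INR m + 1) ^ 2 * / (INR n + 1) ^ 2).
  { intros s Hs. pose proof (lattice_lower z m n s Hz Hs) as B. fold c in B.
    set (w := (INR (S m) * z + s * INR (S n))%C) in *.
    assert (W0 : 0 < Cmod w ^ 2).
    { apply Rnot_le_lt. intros H. assert (0 < c ^ 2) by (apply pow_lt; auto). nra. }
    assert (Wn : w <> RtoC 0).
    { intros E. rewrite E, Cmod_0 in W0. simpl in W0. lra. }
    rewrite Cmod_inv, Cmod_pow, pow_mult by now apply Cpow_nz.
    rewrite <- !S_INR. rewrite Rmult_assoc, <- Rinv_mult, <- Rpow_mult_distr.
    apply inv_pow_le_inv_sq; auto; [nra|now apply pow_lt]. }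
  unfold lattice_term. eapply Rle_trans; [apply Cmod_triangle|].
  pose proof (G 1 ltac:(apply Rabs_R1)) as G1.
  pose proof (G (-1) ltac:(rewrite Rabs_left; lra)) as G2.
  replace (INR (S m) * z + 1 * INR (S n))%C with (INR (S m) * z + INR (S n))%C in G1 by ring.
  replace (INR (S m) * z + -1 * INR (S n))%C with (INR (S m) * z - INR (S n))%C in G2.
  2:{ replace (RtoC (-1)) with (- (1))%C by (unfold RtoC, Copp; simpl; f_equal; ring). ring. }
  lra.
Qed.

(** Multiplying n (-1/z) + m by z exchanges the two coordinates up to signs, and the even exponent
    removes the overall sign. *)
Lemma lattice_term_S_act h z m n :
  0 < Im z -> lattice_term h z m n = (/ z ^ (2 * h) * lattice_term h (S_act z) n m)%C.
Proof.
  intros Hz. pose proof (in_H_neq_0 z Hz) as Zn.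
  assert (NZ : forall s : R, (INR (S m) * z + s)%C <> RtoC 0).
  { intros s. apply in_H_neq_0. rewrite Im_plus_R. destruct z. unfold Im in *. cbn -[INR] in *.
    pose proof (lt_0_INR (S m) ltac:(lia)). nra. }
  unfold lattice_term, S_act.
  assert (E1 : ((INR (S n) * - / z - INR (S m)) ^ (2 * h) = (INR (S m) * z + INR (S n)) ^ (2 * h) * / z ^ (2 * h))%C).
  { rewrite <- Cpow_inv, <- Cpow_mult_l, <- (Cpow_even_opp (_ - _)) by auto. f_equal. field. auto. }
  assert (E2 : ((INR (S n) * - / z + INR (S m)) ^ (2 * h) = (INR (S m) * z - INR (S n)) ^ (2 * h) * / z ^ (2 * h))%C).
  { rewrite <- Cpow_inv, <- Cpow_mult_l by auto. f_equal. field. auto. }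
  rewrite E1, E2.
  assert (P1 := Cpow_nz _ (2 * h) (NZ (INR (S n)))).
  assert (P2 := Cpow_nz _ (2 * h) (NZ (- INR (S n)))). rewrite RtoC_opp in P2.
  change (INR (S m) * z + - INR (S n))%C with (INR (S m) * z - INR (S n))%C in P2.
  assert (P3 := Cpow_nz z (2 * h) Zn). field. auto.
Qed.

Section Eisenstein.

Context (h : nat) (P : C -> C) (L K zeta : R).
Context (h_ge_2 : (2 <= h)%nat) (euler : euler_poly (2 * h) P L K) (L_neq_0 : L <> 0).
Context (zeta_sum : csums (fun n => RtoC (/ (INR n + 1) ^ (2 * h))) (RtoC zeta)).

(** The constant of Lipschitz' formula: [phi (qpar w) / c] is the sum of (w + n)^(-2h) over all
    integers n. *)
Let c : C := (L / twopii ^ (2 * h))%C.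
Let phi (q : C) : C := (P q / (1 - q) ^ (2 * h))%C.

Lemma lipschitz_c_neq_0 : c <> RtoC 0.
Proof.
  unfold c, Cdiv. apply Cmult_neq_0.
  - intros H. apply L_neq_0. now apply RtoC_inj.
  - apply Cmod_gt_0. rewrite Cmod_inv by apply Cpow_nz, twopii_neq_0.
    apply Rinv_0_lt_compat, Cmod_gt_0, Cpow_nz, twopii_neq_0.
Qed.

(** Lipschitz' formula pairs n with -1 - n, whereas the lattice row pairs n + 1 with -(n + 1). The
    half series over n >= 0 converges by itself, so it can be subtracted and added back shifted by
    one, which drops its term n = 0. *)
Lemma csums_lattice_row z m :
  0 < Im z ->
  csums (lattice_term h z m) (phi (qpar (INR (S m) * z)) / c - / (INR (S m) * z) ^ (2 * h))%C.
Proof.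
  intros Hz. set (w := (INR (S m) * z)%C).
  assert (Hw : 0 < Im w).
  { unfold w. destruct z. unfold Im in *. cbn -[INR] in *. pose proof (lt_0_INR (S m) ltac:(lia)). nra. }
  pose proof lipschitz_c_neq_0 as C0.
  pose proof (lipschitz_formula (2 * h) P L K w ltac:(lia) euler Hw) as H.
  apply (csums_scal (/ c)) in H.
  assert (NZ : forall s : R, (w + s)%C <> RtoC 0).
  { intros s. apply in_H_neq_0. now rewrite Im_plus_R. }
  assert (H1 : csums (fun n => / (w + INR n) ^ (2 * h) + / (w - 1 - INR n) ^ (2 * h))%C
      (phi (qpar w) / c)%C).
  { replace (phi (qpar w) / c)%C with (/ c * (P (qpar w) / (1 - qpar w) ^ (2 * h)))%C
      by (unfold phi, Cdiv; ring).
    eapply csums_ext; [|exact H]. intros n. simpl.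
    assert (N1 := Cpow_nz _ (2 * h) (NZ (INR n))).
    assert (N2 := Cpow_nz _ (2 * h) (NZ (-1 - INR n))).
    replace (w + (-1 - INR n)%R)%C with (w - 1 - INR n)%C in N2.
    2:{ rewrite RtoC_minus. replace (RtoC (-1)) with (- (1))%C; [ring|].
        unfold RtoC, Copp; simpl; f_equal; ring. }
    assert (N3 := Cpow_nz _ (2 * h) twopii_neq_0).
    assert (LN : RtoC L <> RtoC 0) by (intros E; apply L_neq_0; now apply RtoC_inj).
    change (h + (h + 0))%nat with (2 * h)%nat.
    rewrite !Cpow_mult_l, !Cpow_even_opp. unfold c. field. auto. }
  assert (Hb : forall n, INR n + 1 <= (1 + (Cmod w + 1) / Im w) * Cmod (w + INR n))
    by (intros n; apply (Cmod_shift_lower w n Hw)).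
  set (b := 1 + (Cmod w + 1) / Im w) in *.
  assert (b0 : 0 < b).
  { unfold b. pose proof (Cmod_ge_0 w). pose proof (Rdiv_lt_0_compat (Cmod w + 1) (Im w)). lra. }
  destruct (csums_dominated (fun n => / (w + INR n) ^ (2 * h))%C
    (fun n => b ^ (2 * h) * / (INR n + 1) ^ 2) (2 * b ^ (2 * h))) as [A HA].
  { intros n. rewrite Cmod_inv, Cmod_pow by apply Cpow_nz, NZ.
    apply inv_pow_le_inv_sq; auto; [lia| |apply Cmod_gt_0, NZ].
    pose proof (pos_INR n). lra. }
  { intros N. apply rsum_inv_sq_scal. apply pow_le. lra. }
  pose proof (csums_plus _ _ _ _ H1 (csums_scal (- (1))%C _ _ HA)) as H2.
  apply csums_shift in HA.
  pose proof (csums_plus _ _ _ _ HA H2) as H3.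
  replace (phi (qpar w) / c - / w ^ (2 * h))%C with
    (A - / (w + INR 0) ^ (2 * h) + (phi (qpar w) / c + - (1) * A))%C.
  - eapply csums_ext; [|exact H3]. intros n. cbn beta. unfold lattice_term. fold w.
    rewrite (S_INR n), RtoC_plus. replace (w - (INR n + 1))%C with (w - 1 - INR n)%C by ring. ring.
  - simpl INR. replace (w + 0)%C with w by ring. ring.
Qed.

Lemma csums_zeta_scal z :
  0 < Im z -> csums (fun m => / (INR (S m) * z) ^ (2 * h))%C (zeta * / z ^ (2 * h))%C.
Proof.
  intros Hz. rewrite Cmult_comm. eapply csums_ext; [|exact (csums_scal (/ z ^ (2 * h))%C _ _ zeta_sum)].
  intros n. cbn beta. assert (INR n + 1 <> 0) by (pose proof (pos_INR n); lra).
  rewrite RtoC_inv, RtoC_pow, RtoC_plus by (now apply pow_nonzero).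
  rewrite S_INR, RtoC_plus, Cpow_mult_l.
  assert (N1 := Cpow_nz z (2 * h) (in_H_neq_0 z Hz)).
  assert (N2 : ((INR n + 1) ^ (2 * h))%C <> RtoC 0).
  { apply Cpow_nz. rewrite <- RtoC_plus. intros E. apply H. now apply RtoC_inj. }
  field. auto.
Qed.

(** The columns of the lattice sum at z are, up to z^(-2h), its rows at -1/z, so Fubini gives the
    transformation law off the axes. The axis n = 0 contributes zeta / z^(2h) and the axis m = 0
    contributes zeta; the inversion exchanges them. *)
Lemma eisenstein_S_act z :
  0 < Im z -> exists s t : C,
    csums (fun m => phi (qpar (INR (S m) * z))) s /\
    csums (fun m => phi (qpar (INR (S m) * S_act z))) t /\
    (zeta + t / c = z ^ (2 * h) * (zeta + s / c))%C.
Proof.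
  intros Hz. pose proof lipschitz_c_neq_0 as C0. pose proof (in_H_neq_0 z Hz) as Zn.
  pose proof (Im_S_act z Hz) as Hs.
  assert (N1 := Cpow_nz z (2 * h) Zn).
  set (D := 2 * ((1 + (Cmod z + 1) / Im z) ^ 2) ^ h).
  assert (D0 : 0 <= D).
  { unfold D. apply Rmult_le_pos; [lra|]. apply pow_le, pow2_ge_0. }
  destruct (csums_fubini (lattice_term h z)
    (fun m => phi (qpar (INR (S m) * z)) / c - / (INR (S m) * z) ^ (2 * h))%C
    (fun n => / z ^ (2 * h) * (phi (qpar (INR (S n) * S_act z)) / c - / (INR (S n) * S_act z) ^ (2 * h)))%C
    (fun m => (2 * D) * / (INR m + 1) ^ 2) (2 * (2 * D))) as [l [H1 H2]].
  - intros N. apply rsum_inv_sq_scal. lra.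
  - intros m N.
    assert (0 <= D * / (INR m + 1) ^ 2).
    { apply Rmult_le_pos; auto. left. apply Rinv_0_lt_compat, pow_lt. pose proof (pos_INR m). lra. }
    eapply Rle_trans; [apply rsum_le; intros n _; apply (lattice_term_bound h z m n h_ge_2 Hz)|].
    fold D. eapply Rle_trans; [apply rsum_inv_sq_scal; auto|]. lra.
  - intros m. now apply csums_lattice_row.
  - intros n. eapply csums_ext; [|exact (csums_scal _ _ _ (csums_lattice_row (S_act z) n Hs))].
    intros m. cbn beta. symmetry. now apply lattice_term_S_act.
  - pose proof (csums_plus _ _ _ _ H1 (csums_zeta_scal z Hz)) as H3.
    pose proof (csums_plus _ _ _ _ (csums_scal (z ^ (2 * h))%C _ _ H2) (csums_zeta_scal _ Hs)) as H4.
    exists (c * (l + zeta * / z ^ (2 * h)))%C.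
    exists (c * (z ^ (2 * h) * l + zeta * / S_act z ^ (2 * h)))%C. repeat split.
    + eapply csums_ext; [|exact (csums_scal c _ _ H3)]. intros m. cbn beta.
      set (u := phi _). set (v := (/ (_ * z) ^ (2 * h))%C). field. auto.
    + eapply csums_ext; [|exact (csums_scal c _ _ H4)]. intros m. cbn beta.
      set (u := phi _). set (v := (/ (_ * S_act z) ^ (2 * h))%C). field. auto.
    + unfold S_act. rewrite Cpow_even_opp, Cpow_inv by auto. field. auto.
Qed.

End Eisenstein.

(** * Lambert series and divisor sums *)

(** The coefficients of the series with coefficients [b] after q is replaced by q^m. *)
Definition sparse (m : nat) (b : nat -> C) (n : nat) : C :=
  if (n mod m =? 0)%nat then b (n / m)%nat else RtoC 0.

Lemma div_ceil_step m N : (0 < m)%nat ->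
  ((N + m) / m = if N mod m =? 0 then S ((N + m - 1) / m) else (N + m - 1) / m)%nat.
Proof.
  intros Hm. assert (m <> 0)%nat by lia.
  pose proof (Nat.div_mod N m ltac:(lia)) as D. pose proof (Nat.mod_upper_bound N m ltac:(lia)) as U.
  set (Q := (N / m)%nat) in *. set (r := (N mod m)%nat) in *.
  replace ((N + m) / m)%nat with (S Q).
  2:{ apply (Nat.div_unique _ _ _ r); lia. }
  destruct (Nat.eqb_spec r 0) as [E|E]; f_equal.
  - apply (Nat.div_unique _ _ _ (m - 1)); lia.
  - apply (Nat.div_unique _ _ _ (r - 1)); lia.
Qed.

(** [(N + m - 1) / m] counts the multiples of [m] below [N]. *)
Lemma csum_sparse m b N : (0 < m)%nat -> csum (sparse m b) N = csum b ((N + m - 1) / m).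
Proof.
  intros Hm. induction N as [|N IH].
  - rewrite Nat.div_small by lia. reflexivity.
  - replace (S N + m - 1)%nat with (N + m)%nat by lia. cbn [csum]. rewrite IH.
    rewrite div_ceil_step by auto. unfold sparse.
    destruct (Nat.eqb_spec (N mod m) 0) as [E|E]; [|ring]. simpl. do 2 f_equal.
    pose proof (Nat.div_mod N m ltac:(lia)) as D. rewrite E in D.
    apply (Nat.div_unique _ _ _ (m - 1)); lia.
Qed.

Lemma csums_sparse m b l : (0 < m)%nat -> csums b l -> csums (sparse m b) l.
Proof.
  intros Hm H eps He. destruct (H eps He) as [N HN]. exists (N * m)%nat. intros n Hn.
  rewrite csum_sparse by auto. apply HN. apply Nat.div_le_lower_bound; lia.
Qed.

Lemma rsum_Cmod_sparse m b N :
  (0 < m)%nat -> rsum (fun n => Cmod (sparse m b n)) N = rsum (fun n => Cmod (b n)) ((N + m - 1) / m).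
Proof.
  intros Hm.
  assert (E : forall f M, RtoC (rsum f M) = csum (fun n => RtoC (f n)) M).
  { intros f M. induction M as [|M IH]; simpl; auto. now rewrite RtoC_plus, IH. }
  apply RtoC_inj. rewrite !E, <- csum_sparse by auto. apply csum_ext. intros n _.
  unfold sparse. destruct (Nat.eqb_spec (n mod m) 0); auto. now rewrite Cmod_0.
Qed.

(** The arithmetic function sigma_j, summed over the divisors [S m] complementary to the base of
    each power. *)
Definition divisor_sum (j n : nat) : R :=
  rsum (fun m => if (n mod S m =? 0)%nat then INR (n / S m) ^ j else 0) n.

(** Fubini for the double series of d^j q^((m+1) d). Column n collects the factorisations of n, and
    the index d = 0 contributes nothing because j >= 1. *)
Lemma lambert j q (phi : C -> C) :
  (1 <= j)%nat -> Cmod q < 1 ->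
  (forall q, Cmod q < 1 -> csums (fun d => INR d ^ j * q ^ d)%C (phi q)) ->
  exists l, csums (fun m => phi (q ^ S m)%C) l /\ csums (fun n => divisor_sum j n * q ^ n)%C l.
Proof.
  intros Hj Hq Hphi. pose proof (Cmod_ge_0 q) as Q0.
  destruct (rsum_INR_pow_bound j (Cmod q)) as [B HB]; [lra|].
  assert (B0 : 0 <= B) by apply (HB O).
  assert (Hpow : forall m, Cmod (q ^ S m) < 1).
  { intros m. rewrite Cmod_pow. simpl. pose proof (pow_incr (Cmod q) 1 m). rewrite pow1 in H.
    pose proof (pow_le (Cmod q) m Q0). nra. }
  apply (csums_fubini (fun m => sparse (S m) (fun d => INR d ^ j * (q ^ S m) ^ d)%C) _ _
    (fun m => B * Cmod q ^ m) (B * / (1 - Cmod q))).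
  - intros N. rewrite rsum_scal. apply Rmult_le_compat_l; auto. apply rsum_geom. lra.
  - intros m N. rewrite rsum_Cmod_sparse by lia. set (M := ((N + S m - 1) / S m)%nat).
    apply Rle_trans with (rsum (fun d => Cmod q ^ m * (INR d ^ j * Cmod q ^ d)) M).
    + apply rsum_le. intros d _. rewrite Cmod_INR_pow_term.
      destruct d as [|d].
      * simpl INR. rewrite pow_i by lia. lra.
      * rewrite Cmod_pow, <- pow_mult.
        replace (Cmod q ^ m * (INR (S d) ^ j * Cmod q ^ S d)) with (INR (S d) ^ j * Cmod q ^ (m + S d))
          by (rewrite pow_add; ring).
        apply Rmult_le_compat_l; [apply pow_le, pos_INR|].
        (* Since (m + 1)(d + 1) >= m + (d + 1), a factor |q|^m splits off and makes the row bounds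
           summable. *)
        replace (S m * S d)%nat with ((m + S d) + m * d)%nat by lia. rewrite (pow_add _ (m + S d)).
        pose proof (pow_le (Cmod q) (m + S d) Q0). pose proof (pow_incr (Cmod q) 1 (m * d)).
        rewrite pow1 in H0. nra.
    + rewrite rsum_scal. specialize (HB M). pose proof (pow_le (Cmod q) m Q0). nra.
  - intros m. apply csums_sparse; [lia|]. apply Hphi, Hpow.
  - intros n.
    replace (divisor_sum j n * q ^ n)%C with
      (csum (fun m => sparse (S m) (fun d => INR d ^ j * (q ^ S m) ^ d)%C n) n).
    + apply csums_finite. intros m Hm. unfold sparse.
      destruct n as [|n].
      * rewrite Nat.Div0.mod_0_l, Nat.Div0.div_0_l. simpl Nat.eqb. cbv iota.
        destruct j as [|j]; [lia|]. simpl. ring.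
      * rewrite Nat.mod_small by lia. reflexivity.
    + unfold divisor_sum.
      assert (G : forall M, csum (fun m => sparse (S m) (fun d => INR d ^ j * (q ^ S m) ^ d)%C n) M =
         (RtoC (rsum (fun m => if (n mod S m =? 0)%nat then INR (n / S m) ^ j else 0) M)%R * q ^ n)%C); [|apply G].
      induction M as [|M IH]; [simpl; ring|]. cbn [csum rsum]. rewrite IH, RtoC_plus.
      rewrite Cmult_plus_distr_r. f_equal. unfold sparse.
      destruct (Nat.eqb_spec (n mod S M) 0) as [E|E]; [|ring].
      rewrite RtoC_pow. f_equal. rewrite <- Cpow_mult_r. f_equal.
      pose proof (Nat.div_mod n (S M) ltac:(lia)). lia.
Qed.

Definition eis_coef (alpha : R) (j n : nat) : C :=
  match n with O => RtoC 1 | _ => RtoC (alpha * divisor_sum j n) end.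

Lemma divisor_sum_0 j : divisor_sum j 0 = 0.
Proof. reflexivity. Qed.

(** [E] is the lattice sum divided by zeta, so that its constant term is 1; [alpha] is the resulting
    factor 1 / (c zeta) with c = L / (2 pi i)^(2h). *)
Lemma eisenstein_series h P (L K zeta alpha : R) :
  (2 <= h)%nat -> euler_poly (2 * h) P L K -> L <> 0 ->
  csums (fun n => RtoC (/ (INR n + 1) ^ (2 * h))) (RtoC zeta) -> zeta <> 0 ->
  (twopii ^ (2 * h) = alpha * L * zeta)%C ->
  exists E : C -> C,
    (forall z, 0 < Im z -> E (S_act z) = z ^ (2 * h) * E z)%C /\
    (forall z, 0 < Im z -> csums (fun n => eis_coef alpha (2 * h - 1) n * qpar z ^ n)%C (E z)).
Proof.
  intros Hh HP HL Hz Z0 Ha.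
  set (phi := fun q => (P q / (1 - q) ^ (2 * h))%C).
  (* The sum of the series, picked by choice; uniqueness of limits identifies it wherever the series
     converges. *)
  set (lam := fun z => epsilon (inhabits (RtoC 0)) (csums (fun m => phi (qpar (INR (S m) * z))))).
  assert (LN : RtoC L <> RtoC 0) by (intros E; apply HL; now apply RtoC_inj).
  assert (ZN : RtoC zeta <> RtoC 0) by (intros E; apply Z0; now apply RtoC_inj).
  assert (TN := Cpow_nz _ (2 * h) twopii_neq_0).
  assert (AE : RtoC alpha = (twopii ^ (2 * h) / (L * zeta))%C).
  { rewrite Ha. field. auto. }
  assert (HS : forall z s, csums (fun m => phi (qpar (INR (S m) * z))) s -> lam z = s).
  { intros z s H. apply (csums_unique _ _ _ (epsilon_spec (inhabits (RtoC 0)) _ (ex_intro _ s H)) H). }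
  exists (fun z => 1 + alpha * lam z)%C. split.
  - intros z Iz.
    destruct (eisenstein_S_act h P L K zeta Hh HP HL Hz z Iz) as [s [t [H1 [H2 H3]]]].
    rewrite (HS _ _ H1), (HS _ _ H2), AE.
    replace (1 + twopii ^ (2 * h) / (L * zeta) * t)%C with
      ((zeta + t / (L / twopii ^ (2 * h))) / zeta)%C by (field; auto).
    rewrite H3. field. auto.
  - intros z Iz. assert (Hq := Cmod_qpar_lt_1 z Iz).
    destruct (lambert (2 * h - 1) (qpar z) phi) as [l [H1 H2]]; auto; [lia| |].
    { intros q Hq'. apply (euler_series _ _ _ _ HP q Hq'). }
    rewrite (HS z l).
    2:{ eapply csums_ext; [|exact H1]. intros m. cbn beta. now rewrite qpar_INR. }
    apply csums_shift. simpl eis_coef at 2. replace (1 + alpha * l - 1 * qpar z ^ 0)%C with (alpha * l)%C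
      by (simpl; ring).
    apply csums_shift in H2. rewrite divisor_sum_0 in H2. replace (l - 0 * qpar z ^ 0)%C with l in H2 by (simpl; ring).
    eapply csums_ext; [|exact (csums_scal alpha _ _ H2)]. intros n. cbn beta. unfold eis_coef.
    rewrite RtoC_mult. ring.
Qed.

(** Three terms are exact. In the tail, k - 2 factors are bounded below by 4 and the remaining
    square is compared with the telescoping series of 1 / ((n - 1) n) over n >= 4, whose sum is
    1/3. *)
Lemma csums_zeta_bounds k :
  (2 <= k)%nat -> exists zeta,
    csums (fun n => RtoC (/ (INR n + 1) ^ k)) (RtoC zeta) /\
    1 + / 2 ^ k + / 3 ^ k <= zeta <= 1 + / 2 ^ k + / 3 ^ k + / 4 ^ (k - 2) * / 3.
Proof.
  intros Hk.
  assert (V0 : forall n, 0 <= / (INR n + 1) ^ k).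
  { intros n. left. apply Rinv_0_lt_compat, pow_lt. pose proof (pos_INR n). lra. }
  assert (E3 : rsum (fun n => / (INR n + 1) ^ k) 3 = 1 + / 2 ^ k + / 3 ^ k).
  { simpl rsum. simpl INR. replace (0 + 1) with 1 by ring. replace (1 + 1 + 1) with 3 by ring.
    replace (1 + 1) with 2 by ring. rewrite pow1, Rinv_1. ring. }
  assert (T0 : 0 < / 4 ^ (k - 2)) by (apply Rinv_0_lt_compat, pow_lt; lra).
  assert (G : forall M, rsum (fun n => / (INR n + 1) ^ k) (3 + M)
      <= 1 + / 2 ^ k + / 3 ^ k + / 4 ^ (k - 2) * (/ 3 - / (INR M + 3))).
  { induction M as [|M IH].
    - rewrite Nat.add_0_r, E3. simpl INR. replace (0 + 3) with 3 by ring. nra.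
    - rewrite Nat.add_succ_r. cbn [rsum].
      assert (H : / (INR (3 + M) + 1) ^ k <= / 4 ^ (k - 2) * (/ (INR M + 3) - / (INR (S M) + 3))).
      { rewrite S_INR, plus_INR. replace (INR 3) with 3 by (simpl; ring).
        pose proof (pos_INR M) as M0. set (x := INR M) in *.
        replace k with ((k - 2) + 2)%nat at 1 by lia. rewrite pow_add, Rinv_mult.
        assert (4 ^ (k - 2) <= (3 + x + 1) ^ (k - 2)) by (apply pow_incr; lra).
        apply Rmult_le_compat.
        - left. apply Rinv_0_lt_compat, pow_lt. lra.
        - left. apply Rinv_0_lt_compat, pow_lt. lra.
        - apply Rinv_le_contravar; auto. apply pow_lt. lra.
        - replace (/ (x + 3) - / (x + 1 + 3)) with (/ ((x + 3) * (x + 4))) by (field; lra).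
          apply Rinv_le_contravar; nra. }
      lra. }
  destruct (rsum_sup _ (1 + / 2 ^ k + / 3 ^ k + / 4 ^ (k - 2) * / 3) V0) as [l [H1 [H2 H3]]].
  - intros N. eapply Rle_trans; [apply (rsum_incr _ N (3 + N)); auto; lia|].
    eapply Rle_trans; [apply G|]. assert (0 < / (INR N + 3)); [|nra].
    apply Rinv_0_lt_compat. pose proof (pos_INR N). lra.
  - exists l. split; auto. split; auto. rewrite <- E3. auto.
Qed.

Lemma twopii_sq : (twopii ^ 2)%C = RtoC (- (2 * PI) ^ 2).
Proof. unfold twopii, RtoC. simpl. unfold Cmult. simpl. f_equal; ring. Qed.

(** The true value of [alpha] is 240. The interval follows from the enclosures of pi and of zeta(4),
    and its width is affordable in the estimate of Delta; likewise 504 in weight six. *)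
Lemma eisenstein_4 : exists (E : C -> C) (alpha : R), 236 <= alpha <= 245 /\
  (forall z, 0 < Im z -> E (S_act z) = z ^ 4 * E z)%C /\
  (forall z, 0 < Im z -> csums (fun n => eis_coef alpha 3 n * qpar z ^ n)%C (E z)).
Proof.
  destruct (csums_zeta_bounds 4 ltac:(lia)) as [zeta [H1 H2]]. simpl in H2.
  assert (Z1 : 1.0748 <= zeta <= 1.0957) by lra.
  pose proof PI_bounds as [P1 P2].
  assert (PP : 9.8596 <= PI * PI <= 9.9225) by nra.
  assert (PP2 : 97.2 <= (PI * PI) * (PI * PI) <= 98.46) by nra.
  set (alpha := (2 * PI) ^ 4 / (6 * zeta)).
  assert (A : alpha * zeta = 16 / 6 * ((PI * PI) * (PI * PI))) by (unfold alpha; field; lra).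
  destruct (eisenstein_series 2 _ 6 12 zeta alpha ltac:(lia) euler_poly_4 ltac:(lra) H1 ltac:(lra))
    as [E [E1 E2]].
  - change (2 * 2)%nat with 4%nat. change 4%nat with (2 * 2)%nat at 1.
    rewrite Cpow_mult_r, twopii_sq, <- RtoC_pow, <- !RtoC_mult. f_equal. unfold alpha. field. lra.
  - exists E, alpha. repeat split; auto; nra.
Qed.

Lemma eisenstein_6 : exists (E : C -> C) (beta : R), 500 <= beta <= 514 /\
  (forall z, 0 < Im z -> E (S_act z) = z ^ 6 * E z)%C /\
  (forall z, 0 < Im z -> csums (fun n => eis_coef (- beta) 5 n * qpar z ^ n)%C (E z)).
Proof.
  destruct (csums_zeta_bounds 6 ltac:(lia)) as [zeta [H1 H2]]. simpl in H2.
  assert (Z1 : 1.01699 <= zeta <= 1.0184) by lra.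
  pose proof PI_bounds as [P1 P2].
  assert (PP : 9.8596 <= PI * PI <= 9.9225) by nra.
  assert (PP2 : 97.2 <= (PI * PI) * (PI * PI) <= 98.46) by nra.
  assert (PP3 : 958.3 <= (PI * PI) * (PI * PI) * (PI * PI) <= 977) by nra.
  set (beta := (2 * PI) ^ 6 / (120 * zeta)).
  assert (A : beta * zeta = 64 / 120 * ((PI * PI) * (PI * PI) * (PI * PI))) by (unfold beta; field; lra).
  destruct (eisenstein_series 3 _ 120 360 zeta (- beta) ltac:(lia) euler_poly_6 ltac:(lra) H1 ltac:(lra))
    as [E [E1 E2]].
  - change (2 * 3)%nat with 6%nat. change 6%nat with (2 * 3)%nat at 1.
    rewrite Cpow_mult_r, twopii_sq, <- RtoC_pow, <- !RtoC_mult. f_equal. unfold beta. field. lra.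
  - exists E, beta. repeat split; auto; nra.
Qed.

(** * Power series on a disc in [q] *)

(* Just larger than [exp (- PI * sqrt 3)], the largest value of |q| on the fundamental domain. *)
Definition rad : R := / 220.

(** A submultiplicative norm on power series: products, powers and geometric inverses are estimated
    without returning to coefficients, and it dominates the values on the disc |q| <= [rad]. *)
Definition weighted_bound (a : nat -> C) (v : R) : Prop :=
  forall N, rsum (fun n => Cmod (a n) * rad ^ n) N <= v.

Definition q_series (f : C -> C) (a : nat -> C) : Prop :=
  forall z, Cmod (qpar z) <= rad -> csums (fun n => a n * qpar z ^ n)%C (f z).

Definition ps (f : C -> C) (a : nat -> C) (v : R) : Prop :=
  weighted_bound a v /\ q_series f a.

Lemma rad_dom_Im z : Cmod (qpar z) <= rad -> 0 < Im z.
Proof.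
  intros Hz. apply Rnot_le_lt. intros I. rewrite Cmod_qpar in Hz. pose proof PI_bounds.
  pose proof (exp_ge_1 (- 2 * PI * Im z)). unfold rad in Hz. nra.
Qed.

Lemma rad_pow_pos n : 0 < rad ^ n.
Proof. apply pow_lt. unfold rad. lra. Qed.

Lemma weighted_bound_pos a v : weighted_bound a v -> 0 <= v.
Proof. intros H. apply (H O). Qed.

Lemma weighted_bound_coef a v n : weighted_bound a v -> Cmod (a n) * rad ^ n <= v.
Proof.
  intros H. specialize (H (S n)). simpl in H.
  assert (0 <= rsum (fun n => Cmod (a n) * rad ^ n) n); [|lra].
  apply rsum_ge_0. intros i _. apply Rmult_le_pos; [apply Cmod_ge_0|left; apply rad_pow_pos].
Qed.

Lemma weighted_bound_at a v q N :
  weighted_bound a v -> Cmod q <= rad -> rsum (fun n => Cmod (a n * q ^ n)%C) N <= v.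
Proof.
  intros H Hq. eapply Rle_trans; [|apply (H N)]. apply rsum_le. intros n _.
  rewrite Cmod_mult, Cmod_pow. apply Rmult_le_compat_l; [apply Cmod_ge_0|].
  apply pow_incr. split; [apply Cmod_ge_0|auto].
Qed.

Lemma ps_Cmod f a v z : ps f a v -> Cmod (qpar z) <= rad -> Cmod (f z) <= v.
Proof.
  intros [H1 H2] Hz. apply (csums_bound _ _ _ (H2 z Hz)). intros N. now apply weighted_bound_at.
Qed.

Lemma ps_ext f g a b v :
  (forall z, Cmod (qpar z) <= rad -> f z = g z) -> (forall n, a n = b n) -> ps f a v -> ps g b v.
Proof.
  intros Hf Ha [H1 H2]. split.
  - intros N. rewrite (rsum_ext _ (fun n => Cmod (a n) * rad ^ n)); auto. intros; now rewrite Ha.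
  - intros z Hz. rewrite <- Hf by auto. eapply csums_ext; [|apply (H2 z Hz)].
    intros n. cbn beta. now rewrite Ha.
Qed.

Lemma ps_weaken f a v w : v <= w -> ps f a v -> ps f a w.
Proof. intros H [H1 H2]. split; auto. intros N. specialize (H1 N). lra. Qed.

Lemma ps_plus f g a b v w :
  ps f a v -> ps g b w -> ps (fun z => f z + g z)%C (fun n => a n + b n)%C (v + w).
Proof.
  intros [H1 H2] [H3 H4]. split.
  - intros N. eapply Rle_trans; [|apply Rplus_le_compat; [apply (H1 N)|apply (H3 N)]].
    rewrite <- rsum_plus. apply rsum_le. intros n _. pose proof (rad_pow_pos n).
    pose proof (Cmod_triangle (a n) (b n)). nra.
  - intros z Hz. eapply csums_ext; [|exact (csums_plus _ _ _ _ (H2 z Hz) (H4 z Hz))].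
    intros n. cbn beta. ring.
Qed.

Lemma ps_scal c f a v : ps f a v -> ps (fun z => c * f z)%C (fun n => c * a n)%C (Cmod c * v).
Proof.
  intros [H1 H2]. split.
  - intros N. rewrite (rsum_ext _ (fun n => Cmod c * (Cmod (a n) * rad ^ n))).
    + rewrite rsum_scal. apply Rmult_le_compat_l; [apply Cmod_ge_0|apply H1].
    + intros n _. rewrite Cmod_mult. ring.
  - intros z Hz. eapply csums_ext; [|exact (csums_scal c _ _ (H2 z Hz))].
    intros n. cbn beta. ring.
Qed.

Lemma ps_mult f g a b v w :
  ps f a v -> ps g b w -> ps (fun z => f z * g z)%C (conv a b) (v * w).
Proof.
  intros [H1 H2] [H3 H4]. split.
  - intros N. eapply Rle_trans; [|apply (rsum_conv_le (fun n => Cmod (a n) * rad ^ n)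
      (fun n => Cmod (b n) * rad ^ n) v w N); auto].
    + apply rsum_le. intros n _. unfold conv.
      apply Rle_trans with (rad ^ n * rsum (fun i => Cmod (a i * b (n - i)%nat)%C) (S n)).
      * rewrite Rmult_comm. apply Rmult_le_compat_l; [left; apply rad_pow_pos|apply Cmod_csum].
      * rewrite <- rsum_scal. apply rsum_le. intros i Hi.
        replace n with (i + (n - i))%nat at 1 by lia. rewrite Cmod_mult, pow_add. lra.
    + intros n. apply Rmult_le_pos; [apply Cmod_ge_0|left; apply rad_pow_pos].
    + intros n. apply Rmult_le_pos; [apply Cmod_ge_0|left; apply rad_pow_pos].
  - intros z Hz. eapply csums_ext; [|exact (csums_conv _ _ _ _ v w
      (fun N => weighted_bound_at a v _ N H1 Hz) (fun N => weighted_bound_at b w _ N H3 Hz)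
      (H2 z Hz) (H4 z Hz))].
    intros n. unfold conv. rewrite (Cmult_comm (csum _ _)), <- csum_scal.
    apply csum_ext. intros i Hi.
    replace (qpar z ^ n)%C with (qpar z ^ i * qpar z ^ (n - i))%C
      by (rewrite <- Cpow_add_r; f_equal; lia). ring.
Qed.

Definition cone (n : nat) : C := match n with O => RtoC 1 | _ => RtoC 0 end.

Lemma csums_cone q : csums (fun n => cone n * q ^ n)%C (RtoC 1).
Proof.
  replace (RtoC 1) with (csum (fun n => cone n * q ^ n)%C 1) by (simpl; ring).
  apply csums_finite. intros [|n] Hn; [lia|]. simpl. ring.
Qed.

Lemma ps_one : ps (fun _ => RtoC 1) cone 1.
Proof.
  split.
  - intros [|N]; [simpl; lra|]. rewrite rsum_shift, rsum_0.
    + simpl. rewrite Cmod_1. lra.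
    + intros i _. simpl. rewrite Cmod_0. ring.
  - intros z _. apply csums_cone.
Qed.

Fixpoint cpw (a : nat -> C) (n : nat) : nat -> C :=
  match n with O => cone | S p => conv a (cpw a p) end.

Lemma ps_pow f a v n : ps f a v -> ps (fun z => f z ^ n)%C (cpw a n) (v ^ n).
Proof.
  intros H. induction n as [|n IH]; simpl; [apply ps_one|]. exact (ps_mult _ _ _ _ _ _ H IH).
Qed.

Lemma conv_0 a b : conv a b O = (a O * b O)%C.
Proof. unfold conv. simpl. ring. Qed.

Lemma cpw_0 a n : a O = RtoC 1 -> cpw a n O = RtoC 1.
Proof. intros H. induction n as [|n IH]; auto. simpl cpw. rewrite conv_0, H, IH. ring. Qed.

Lemma ps_shift N f a v :
  ps f a v -> ps (fun z => qpar z ^ N * f z)%C (shift N a) (rad ^ N * v).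
Proof.
  intros [H1 H2]. assert (v0 := weighted_bound_pos _ _ H1). pose proof (rad_pow_pos N). split.
  - intros M. eapply Rle_trans;
      [|apply (rsum_shift_seq_le N (fun n => rad ^ N * (Cmod (a n) * rad ^ n)) (rad ^ N * v) M)].
    + apply rsum_le. intros i _. unfold shift. destruct (Nat.ltb_spec i N).
      * rewrite Cmod_0. lra.
      * replace i with (N + (i - N))%nat at 2 by lia. rewrite pow_add. lra.
    + nra.
    + intros K. rewrite rsum_scal. specialize (H1 K). nra.
  - intros z Hz. eapply csums_ext; [|exact (csums_shift_seq N _ _ (csums_scal (qpar z ^ N)%C _ _ (H2 z Hz)))].
    intros n. unfold shift. destruct (Nat.ltb_spec n N); [ring|].
    replace (qpar z ^ n)%C with (qpar z ^ N * qpar z ^ (n - N))%C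
      by (rewrite <- Cpow_add_r; f_equal; lia). ring.
Qed.

Lemma csums_drop N a l :
  (forall n, (n < N)%nat -> a n = RtoC 0) -> csums a l -> csums (fun n => a (N + n)%nat) l.
Proof.
  intros H Ha eps He. destruct (Ha eps He) as [K HK]. exists K. intros n Hn.
  specialize (HK (N + n)%nat ltac:(lia)). rewrite csum_split, csum_0 in HK by auto.
  now rewrite Cplus_0_l in HK.
Qed.

Lemma ps_unshift N f a v :
  (forall n, (n < N)%nat -> a n = RtoC 0) -> ps f a v ->
  ps (fun z => f z / qpar z ^ N)%C (fun n => a (N + n)%nat) (v / rad ^ N).
Proof.
  intros HN [H1 H2]. pose proof (rad_pow_pos N) as R0. split.
  - intros M. specialize (H1 (N + M)%nat). rewrite rsum_split, rsum_0 in H1.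
    2:{ intros i Hi. rewrite HN, Cmod_0 by auto. ring. }
    rewrite Rplus_0_l in H1. apply Rmult_le_reg_l with (rad ^ N); auto.
    rewrite <- rsum_scal. replace (rad ^ N * (v / rad ^ N)) with v by (field; lra).
    eapply Rle_trans; [|exact H1]. apply rsum_le. intros i _. rewrite pow_add. lra.
  - intros z Hz. specialize (H2 z Hz). apply (csums_drop N) in H2.
    2:{ intros n Hn. rewrite HN by auto. ring. }
    assert (Q := Cpow_nz _ N (qpar_neq_0 z)).
    replace (f z / qpar z ^ N)%C with (/ qpar z ^ N * f z)%C by (field; auto).
    eapply csums_ext; [|exact (csums_scal (/ qpar z ^ N)%C _ _ H2)].
    intros n. cbn beta. rewrite Cpow_add_r. field. auto.
Qed.

(** Iterating [F] from the zero sequence leaves entry n fixed after n + 1 steps. *)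
Lemma strong_recursion (F : (nat -> C) -> nat -> C) :
  (forall u v n, (forall i, (i < n)%nat -> u i = v i) -> F u n = F v n) ->
  exists b, forall n, b n = F b n.
Proof.
  intros HF. set (T := fun k => Nat.iter k F (fun _ => RtoC 0)).
  assert (St : forall n k, (n < k)%nat -> T k n = T (S n) n).
  { induction n as [n IH] using lt_wf_ind. intros k Hk. destruct k as [|k]; [lia|].
    change (F (T k) n = F (T n) n). apply HF. intros i Hi.
    rewrite (IH i Hi k) by lia. symmetry. apply IH; lia. }
  exists (fun n => T (S n) n). intros n. change (F (T n) n = F (fun n => T (S n) n) n).
  apply HF. intros i Hi. now apply St.
Qed.

(** The coefficients solve b = 1 + a b, which is a recursion because a_0 = 0. Taking norms gives |b|
    <= 1 + v |b|, and taking values gives l = 1 + f l. *)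
Lemma ps_inv f a v :
  ps f a v -> v < 1 -> a O = RtoC 0 ->
  exists b, b O = RtoC 1 /\ ps (fun z => / (1 - f z))%C b (/ (1 - v)).
Proof.
  intros Hf Hv Ha. destruct (strong_recursion (fun b n => cone n + conv a b n)%C) as [b Hb].
  { intros u w n H. f_equal. unfold conv. apply csum_ext. intros [|i] Hi.
    - rewrite Ha. ring.
    - f_equal. apply H. lia. }
  exists b. assert (B0 : b O = RtoC 1) by (rewrite Hb, conv_0, Ha; simpl; ring). split; auto.
  destruct Hf as [H1 H2]. assert (v0 := weighted_bound_pos _ _ H1).
  assert (WB : weighted_bound b (/ (1 - v))).
  { intros N. set (bb := fun n => Cmod (b n) * rad ^ n).
    assert (bb0 : forall n, 0 <= bb n).
    { intros n. apply Rmult_le_pos; [apply Cmod_ge_0|left; apply rad_pow_pos]. }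
    assert (G : rsum bb N <= 1 + v * rsum bb N).
    (* The series is cut off at [N], since its norm is not yet known to be finite. *)
    { set (bt := fun n => if (n <? N)%nat then bb n else 0).
      assert (Ebt : forall M, rsum bt M <= rsum bb N).
      { intros M. eapply Rle_trans; [apply (rsum_incr bt M (N + M)); [|lia]|].
        - intros i. unfold bt. destruct (i <? N)%nat; [apply bb0|lra].
        - rewrite rsum_split, (rsum_0 (fun i => bt (N + i)%nat)).
          + rewrite Rplus_0_r. right. apply rsum_ext. intros i Hi. unfold bt.
            destruct (Nat.ltb_spec i N); [auto|lia].
          + intros i _. unfold bt. destruct (Nat.ltb_spec (N + i) N); [lia|auto]. }
      apply Rle_trans with (rsum (fun n => Cmod (cone n) * rad ^ n
        + rsum (fun i => (Cmod (a i) * rad ^ i) * bt (n - i)%nat) (S n)) N).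
      - apply rsum_le. intros n Hn. unfold bb. rewrite Hb.
        eapply Rle_trans; [apply Rmult_le_compat_r; [left; apply rad_pow_pos|apply Cmod_triangle]|].
        rewrite Rmult_plus_distr_r. apply Rplus_le_compat_l. unfold conv.
        apply Rle_trans with (rad ^ n * rsum (fun i => Cmod (a i * b (n - i)%nat)%C) (S n)).
        * rewrite Rmult_comm. apply Rmult_le_compat_l; [left; apply rad_pow_pos|apply Cmod_csum].
        * rewrite <- rsum_scal. apply rsum_le. intros i Hi. unfold bt, bb.
          destruct (Nat.ltb_spec (n - i) N); [|lia].
          replace n with (i + (n - i))%nat at 1 by lia. rewrite Cmod_mult, pow_add. lra.
      - rewrite rsum_plus. apply Rplus_le_compat; [apply ps_one|].
        apply rsum_conv_le; auto.
        + intros n. apply Rmult_le_pos; [apply Cmod_ge_0|left; apply rad_pow_pos].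
        + intros n. unfold bt. destruct (n <? N)%nat; [apply bb0|lra]. }
    apply Rmult_le_reg_l with (1 - v); [lra|]. rewrite Rinv_r by lra. fold bb. lra. }
  split; auto. intros z Hz.
  destruct (csums_dominated (fun n => b n * qpar z ^ n)%C (fun n => Cmod (b n * qpar z ^ n)%C) (/ (1 - v)))
    as [l Hl]; [intros; lra|intros N; now apply weighted_bound_at|].
  replace (/ (1 - f z))%C with l; auto.
  pose proof (csums_conv _ _ _ _ v (/ (1 - v)) (fun N => weighted_bound_at a v _ N H1 Hz)
    (fun N => weighted_bound_at b _ _ N WB Hz) (H2 z Hz) Hl) as Hc.
  assert (El : l = (1 + f z * l)%C).
  { apply (csums_unique _ _ _ Hl).
    eapply csums_ext; [|exact (csums_plus _ _ _ _ (csums_cone (qpar z)) Hc)].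
    intros n. cbn beta. rewrite (Hb n), Cmult_plus_distr_r. f_equal.
    unfold conv. rewrite (Cmult_comm (csum _ _)), <- csum_scal.
    apply csum_ext. intros i Hi.
    replace (qpar z ^ n)%C with (qpar z ^ i * qpar z ^ (n - i))%C
      by (rewrite <- Cpow_add_r; f_equal; lia). ring. }
  assert (Nz : (1 - f z)%C <> RtoC 0).
  { apply one_minus_neq_0. eapply Rle_lt_trans; [apply (ps_Cmod f a v z)|auto]; auto. now split. }
  apply (f_equal (fun x => (x - f z * l) / (1 - f z))%C) in El.
  replace ((1 + f z * l - f z * l) / (1 - f z))%C with (/ (1 - f z))%C in El by (field; auto).
  rewrite <- El. field. auto.
Qed.

(** Hides the coefficients other than the constant term, so that norms of algebraic expressions can
    be assembled mechanically. *)
Definition psx (f : C -> C) (v : R) (c : C) : Prop := exists a, a O = c /\ ps f a v.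

Lemma psx_plus f g v w c d : psx f v c -> psx g w d -> psx (fun z => f z + g z)%C (v + w) (c + d)%C.
Proof.
  intros [a [A1 A2]] [b [B1 B2]]. exists (fun n => a n + b n)%C. split; [|exact (ps_plus _ _ _ _ _ _ A2 B2)].
  now rewrite A1, B1.
Qed.

Lemma psx_mult f g v w c d : psx f v c -> psx g w d -> psx (fun z => f z * g z)%C (v * w) (c * d)%C.
Proof.
  intros [a [A1 A2]] [b [B1 B2]]. exists (conv a b). split; [|exact (ps_mult _ _ _ _ _ _ A2 B2)].
  now rewrite conv_0, A1, B1.
Qed.

Lemma psx_scal k f v c : psx f v c -> psx (fun z => k * f z)%C (Cmod k * v) (k * c)%C.
Proof.
  intros [a [A1 A2]]. exists (fun n => k * a n)%C. split; [|exact (ps_scal k _ _ _ A2)]. now rewrite A1.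
Qed.

Lemma psx_one : psx (fun _ => RtoC 1) 1 1.
Proof. exists cone. split; auto using ps_one. Qed.

Lemma psx_qpar f v c : psx f v c -> psx (fun z => qpar z * f z)%C (rad * v) 0.
Proof.
  intros [a [A1 A2]]. exists (shift 1 a). split; auto.
  apply (ps_shift 1) in A2. rewrite pow_1 in A2.
  eapply ps_ext; [| |exact A2]; auto. intros z _. cbn beta. now rewrite Cpow_1_r.
Qed.

Lemma psx_ext f g v w c d :
  (forall z, Cmod (qpar z) <= rad -> f z = g z) -> v <= w -> c = d -> psx f v c -> psx g w d.
Proof.
  intros H Hv -> [a [A1 A2]]. exists a. split; auto.
  apply (ps_weaken _ _ v); auto. now apply (ps_ext f g a a).
Qed.

Lemma divisor_sum_le j n : divisor_sum j n <= INR n ^ S j.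
Proof.
  unfold divisor_sum. apply Rle_trans with (rsum (fun _ => INR n ^ j) n).
  - apply rsum_le. intros i Hi. destruct (_ =? _)%nat; [|apply pow_le, pos_INR].
    apply pow_incr. split; [apply pos_INR|]. apply le_INR. apply Nat.Div0.div_le_upper_bound. nia.
  - assert (G : forall c N, rsum (fun _ => c) N = INR N * c).
    { intros c N. induction N as [|N IH]; [simpl; ring|]. cbn [rsum]. rewrite IH, S_INR. ring. }
    rewrite G. simpl. lra.
Qed.

Lemma divisor_sum_ge_0 j n : 0 <= divisor_sum j n.
Proof.
  apply rsum_ge_0. intros i _. destruct (_ =? _)%nat; [apply pow_le, pos_INR|lra].
Qed.

(** From n = 4 on, passing from n to n + 1 multiplies n^j by at most (5/4)^j. *)
Lemma pow_le_geometric B j :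
  4 ^ j <= B ^ 4 -> 0 < B -> (5 / 4) ^ j <= B -> forall n, INR (4 + n) ^ j <= B ^ (4 + n).
Proof.
  intros H0 HB H1. induction n as [|n IH].
  - replace (INR (4 + 0)) with 4 by (simpl; ring). auto.
  - rewrite Nat.add_succ_r. replace (B ^ S (4 + n)) with (B * B ^ (4 + n)) by (simpl; ring).
    apply Rle_trans with ((5 / 4) ^ j * INR (4 + n) ^ j).
    + rewrite <- Rpow_mult_distr. apply pow_incr. split; [apply pos_INR|].
      rewrite S_INR, plus_INR. replace (INR 4) with 4 by (simpl; ring). pose proof (pos_INR n). lra.
    + apply Rmult_le_compat; auto; apply pow_le; [lra|apply pos_INR].
Qed.

Lemma divisor_sum_3_le n : (3 <= n)%nat -> divisor_sum 3 n <= 4 ^ n.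
Proof.
  (* The crude bound n^4 exceeds 4^n at n = 3, so this value is computed; at n = 4 the two are
     equal. *)
  intros Hn. destruct (Nat.eq_dec n 3) as [->|].
  - unfold divisor_sum. simpl. lra.
  - eapply Rle_trans; [apply divisor_sum_le|]. replace n with (4 + (n - 4))%nat by lia.
    apply (pow_le_geometric 4 4); lra.
Qed.

Lemma divisor_sum_5_le n : (3 <= n)%nat -> divisor_sum 5 n <= 8 ^ n.
Proof.
  intros Hn. destruct (Nat.eq_dec n 3) as [->|].
  - unfold divisor_sum. simpl. lra.
  - eapply Rle_trans; [apply divisor_sum_le|]. replace n with (4 + (n - 4))%nat by lia.
    apply (pow_le_geometric 8 6); lra.
Qed.

(** Index n stands for the divisor sum at n + 1, whence the exponent [S n]. The coefficient of q is
    kept apart because the geometric majorant would nearly double it in both applications. *)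
Lemma weighted_bound_tail (a : nat -> C) B c :
  0 < B -> B * rad < 1 -> a O = RtoC 0 -> Cmod (a 1%nat) <= c ->
  (forall n, (2 <= n)%nat -> Cmod (a n) <= B ^ S n) ->
  weighted_bound a (c * rad + B * (B * rad) ^ 2 / (1 - B * rad)).
Proof.
  intros HB Hr H0 H1 H2 N.
  assert (R0 : 0 < rad) by (unfold rad; lra).
  assert (T : 0 < 1 - B * rad) by lra.
  eapply Rle_trans; [apply (rsum_incr _ N (2 + N)); [|lia]|].
  { intros n. apply Rmult_le_pos; [apply Cmod_ge_0|left; apply rad_pow_pos]. }
  rewrite rsum_split. cbn [rsum]. rewrite H0, Cmod_0.
  apply Rle_trans with (c * rad + rsum (fun n => B * (B * rad) ^ 2 * (B * rad) ^ n) N).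
  - apply Rplus_le_compat.
    + simpl. nra.
    + apply rsum_le. intros n _. replace (B * (B * rad) ^ 2 * (B * rad) ^ n) with (B ^ S (2 + n) * rad ^ (2 + n)).
      * apply Rmult_le_compat_r; [left; apply rad_pow_pos|]. apply H2. lia.
      * rewrite !Rpow_mult_distr, pow_add. simpl. ring.
  - apply Rplus_le_compat_l. rewrite rsum_scal. unfold Rdiv. apply Rmult_le_compat_l.
    + apply Rmult_le_pos; [lra|apply pow2_ge_0].
    + apply rsum_geom. split; [|lra]. nra.
Qed.

(* [E = 1 + alpha q (1 + x)] with [x] small. *)
Lemma psx_eisenstein_tail E alpha j B c :
  alpha <> 0 ->
  (forall z, 0 < Im z -> csums (fun n => eis_coef alpha j n * qpar z ^ n)%C (E z)) ->
  0 < B -> B * rad < 1 -> divisor_sum j 1 = 1 -> divisor_sum j 2 <= c ->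
  (forall n, (3 <= n)%nat -> divisor_sum j n <= B ^ n) ->
  psx (fun z => (E z - 1) / (alpha * qpar z) - 1)%C
    (c * rad + B * (B * rad) ^ 2 / (1 - B * rad)) 0.
Proof.
  intros Ha HE HB Hr H1 H2 H3. set (x := fun n => match n with O => RtoC 0 | S _ => RtoC (divisor_sum j (S n)) end).
  exists x. split; auto. split.
  - apply weighted_bound_tail; auto.
    + simpl x. rewrite Cmod_R, Rabs_pos_eq by apply divisor_sum_ge_0. auto.
    + intros n Hn. destruct n as [|n]; [lia|]. unfold x.
      rewrite Cmod_R, Rabs_pos_eq by apply divisor_sum_ge_0. apply H3. lia.
  - intros z Hz. assert (Iz := rad_dom_Im z Hz).
    assert (An : RtoC alpha <> RtoC 0) by (intros e; apply Ha; now apply RtoC_inj).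
    assert (Qn := qpar_neq_0 z).
    specialize (HE z Iz). apply csums_shift in HE. simpl eis_coef at 2 in HE.
    apply (csums_scal (/ (alpha * qpar z))%C) in HE.
    pose proof (csums_plus _ _ _ _ HE (csums_scal (- (1))%C _ _ (csums_cone (qpar z)))) as H.
    replace ((E z - 1) / (alpha * qpar z) - 1)%C with
      (/ (alpha * qpar z) * (E z - 1 * qpar z ^ 0) + - (1) * 1)%C by (simpl; field; auto).
    eapply csums_ext; [|exact H]. intros [|n]; cbn beta; unfold x, cone, eis_coef.
    + rewrite H1, Rmult_1_r. simpl. field. auto.
    + rewrite RtoC_mult. set (s := RtoC (divisor_sum j (S (S n)))). simpl. field. auto.
Qed.

(** * The discriminant *)

Lemma psx_scal_R (k : R) f v c : psx f v c -> psx (fun z => k * f z)%C (Rabs k * v) (k * c)%C.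
Proof. intros H. rewrite <- Cmod_R. now apply psx_scal. Qed.

Lemma psx_eisenstein E (alpha : R) x nx :
  alpha <> 0 -> psx x nx 0 ->
  (forall z, Cmod (qpar z) <= rad -> x z = (E z - 1) / (alpha * qpar z) - 1)%C ->
  psx E (1 + Rabs alpha * (rad * (1 + nx))) 1.
Proof.
  intros Ha Hx Ex. assert (An : RtoC alpha <> RtoC 0) by (intros e; apply Ha; now apply RtoC_inj).
  eapply psx_ext; [| | |exact (psx_plus _ _ _ _ _ _ psx_one
    (psx_scal_R alpha _ _ _ (psx_qpar _ _ _ (psx_plus _ _ _ _ _ _ psx_one Hx))))].
  - intros z Hz. cbn beta. rewrite Ex by auto. field. split; [apply qpar_neq_0|auto].
  - apply Rle_refl.
  - ring.
Qed.

(* [Delta / q = 1 - eta], where [eta] is expanded so that the large terms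
   [3 alpha^2] and [beta^2] cancel before absolute values are taken. *)
Lemma psx_eta x y alpha beta nx ny :
  236 <= alpha <= 245 -> 500 <= beta <= 514 -> 0 <= nx <= 0.0423 -> 0 <= ny <= 0.1611 ->
  psx x nx 0 -> psx y ny 0 ->
  psx (fun z => 1 - ((1 + alpha * (qpar z * (1 + x z))) ^ 3 - (1 + (- beta)%R * (qpar z * (1 + y z))) ^ 2)
     / ((3 * alpha + 2 * beta)%R * qpar z))%C (9 / 10) 0.
Proof.
  intros Ha Hb Hnx Hny Hx Hy. set (kappa := 3 * alpha + 2 * beta).
  assert (K0 : 1708 <= kappa) by (unfold kappa; lra).
  assert (Kn : RtoC kappa <> RtoC 0) by (intros e; apply RtoC_inj in e; lra).
  pose proof (psx_plus _ _ _ _ _ _ psx_one Hx) as H1x.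
  pose proof (psx_plus _ _ _ _ _ _ (psx_scal_R 2 _ _ _ Hx) (psx_mult _ _ _ _ _ _ Hx Hx)) as Hxx.
  pose proof (psx_plus _ _ _ _ _ _ (psx_scal_R 2 _ _ _ Hy) (psx_mult _ _ _ _ _ _ Hy Hy)) as Hyy.
  (* [T1] is the second-order term of E4^3 - E6^2 with x = y = 0, [T2] its correction by x and y,
     and [T3] comes from the cube of E4 - 1. *)
  pose proof (psx_qpar _ _ _ (psx_scal_R (3 * alpha ^ 2 - beta ^ 2) _ _ _ psx_one)) as T1.
  pose proof (psx_qpar _ _ _ (psx_plus _ _ _ _ _ _ (psx_scal_R (3 * alpha ^ 2) _ _ _ Hxx)
    (psx_scal_R (- beta ^ 2) _ _ _ Hyy))) as T2.
  pose proof (psx_qpar _ _ _ (psx_qpar _ _ _ (psx_scal_R (alpha ^ 3) _ _ _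
    (psx_mult _ _ _ _ _ _ H1x (psx_mult _ _ _ _ _ _ H1x H1x))))) as T3.
  pose proof (psx_scal_R (- / kappa) _ _ _ (psx_plus _ _ _ _ _ _
    (psx_plus _ _ _ _ _ _ (psx_scal_R (3 * alpha) _ _ _ Hx) (psx_scal_R (2 * beta) _ _ _ Hy))
    (psx_plus _ _ _ _ _ _ T1 (psx_plus _ _ _ _ _ _ T2 T3)))) as H.
  eapply psx_ext; [| | |exact H].
  - intros z _. cbn beta. assert (Q := qpar_neq_0 z).
    rewrite !RtoC_opp, RtoC_inv by lra.
    rewrite !RtoC_minus, !RtoC_mult, !RtoC_pow.
    assert (EK : RtoC kappa = (3 * alpha + 2 * beta)%C).
    { unfold kappa. now rewrite RtoC_plus, !RtoC_mult. }
    rewrite EK in *. simpl Cpow. field. auto.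
  - rewrite (Rabs_left (- / kappa)) by (assert (0 < / kappa) by (apply Rinv_0_lt_compat; lra); lra).
    rewrite (Rabs_left (- beta ^ 2)) by nra.
    rewrite !(Rabs_pos_eq (3 * _)), (Rabs_pos_eq (2 * _)), (Rabs_pos_eq (alpha ^ 3)), (Rabs_pos_eq 2)
      by (try apply pow_le; nra).
    assert (A2 : alpha ^ 2 <= 60025) by nra.
    assert (A2' : 55696 <= alpha ^ 2) by nra.
    assert (A3 : alpha ^ 3 <= 14706125).
    { replace 14706125 with (245 ^ 3) by ring. apply pow_incr. lra. }
    assert (B2 : 250000 <= beta ^ 2 <= 264196) by nra.
    assert (AB : Rabs (3 * alpha ^ 2 - beta ^ 2) <= 97200) by (apply Rabs_le; lra).
    assert (X2 : 2 * nx + nx * nx <= 0.08639) by nra.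
    assert (Y2 : 2 * ny + ny * ny <= 0.34816) by nra.
    assert (X3 : (1 + nx) * ((1 + nx) * (1 + nx)) <= 1.1324).
    { assert ((1 + nx) * (1 + nx) <= 1.08639) by nra. nra. }
    assert (S1 : 3 * alpha * nx <= 31.2) by nra.
    assert (S2 : 2 * beta * ny <= 165.7) by nra.
    assert (S3 : 3 * alpha ^ 2 * (2 * nx + nx * nx) <= 15557).
    { apply Rle_trans with (180075 * 0.08639); [|lra]. apply Rmult_le_compat; nra. }
    assert (S4 : beta ^ 2 * (2 * ny + ny * ny) <= 91983).
    { apply Rle_trans with (264196 * 0.34816); [|lra]. apply Rmult_le_compat; nra. }
    assert (S5 : alpha ^ 3 * ((1 + nx) * ((1 + nx) * (1 + nx))) <= 16653300).
    { apply Rle_trans with (14706125 * 1.1324); [|lra]. apply Rmult_le_compat; auto; [apply pow_le; lra|].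
      repeat apply Rmult_le_pos; lra. }
    (* With 1 / [rad] = 220 the terms add up to about 1472, while 9/10 of [kappa] is at least
       1537. *)
    apply Rmult_le_reg_l with kappa; [lra|].
    match goal with |- kappa * (- - / kappa * ?v) <= _ =>
      replace (kappa * (- - / kappa * v)) with v by (field; lra) end.
    unfold rad. lra.
  - ring.
Qed.

(** Of the modular group only z |-> -1/z is recorded explicitly, since translations by 1 are carried
    by the q-expansions. One constant [V] bounds all four norms and later also the growth of
    coefficients. *)
Record modular_generators (E4 E6 Dl : C -> C) (e4 e6 d d' : nat -> C) (V : R) : Prop := {
  gen_V : 1 <= V;
  gen_E4_S : forall z, 0 < Im z -> E4 (S_act z) = (z ^ 4 * E4 z)%C;
  gen_E6_S : forall z, 0 < Im z -> E6 (S_act z) = (z ^ 6 * E6 z)%C;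
  gen_Dl_S : forall z, 0 < Im z -> Dl (S_act z) = (z ^ 12 * Dl z)%C;
  gen_E4 : ps E4 e4 V;
  gen_E6 : ps E6 e6 V;
  gen_Dl : ps (fun z => Dl z / qpar z)%C d V;
  gen_Dl_inv : ps (fun z => qpar z / Dl z)%C d' V;
  gen_e4_0 : e4 O = RtoC 1;
  gen_e6_0 : e6 O = RtoC 1;
  gen_d_0 : d O = RtoC 1;
  gen_d'_0 : d' O = RtoC 1;
  gen_Dl_neq_0 : forall z, Cmod (qpar z) <= rad -> Dl z <> RtoC 0
}.

Lemma modular_generators_exist :
  exists E4 E6 Dl e4 e6 d d' V, modular_generators E4 E6 Dl e4 e6 d d' V.
Proof.
  destruct eisenstein_4 as [E4 [alpha [Ha [S4 H4]]]].
  destruct eisenstein_6 as [E6 [beta [Hb [S6 H6]]]].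
  set (x := fun z => ((E4 z - 1) / (alpha * qpar z) - 1)%C).
  set (y := fun z => ((E6 z - 1) / ((- beta)%R * qpar z) - 1)%C).
  (* 9 and 33 are the divisor sums sigma_3(2) and sigma_5(2). *)
  set (nx := 9 * rad + 4 * (4 * rad) ^ 2 / (1 - 4 * rad)).
  set (ny := 33 * rad + 8 * (8 * rad) ^ 2 / (1 - 8 * rad)).
  assert (Hx : psx x nx 0).
  { apply (psx_eisenstein_tail E4 alpha 3); auto; try (unfold rad; lra).
    - unfold divisor_sum. simpl. lra.
    - unfold divisor_sum. simpl. lra.
    - apply divisor_sum_3_le. }
  assert (Hy : psx y ny 0).
  { apply (psx_eisenstein_tail E6 (- beta) 5); auto; try (unfold rad; lra).
    - unfold divisor_sum. simpl. lra.
    - unfold divisor_sum. simpl. lra.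
    - apply divisor_sum_5_le. }
  assert (Nx : 0 <= nx <= 0.0423) by (unfold nx, rad; lra).
  assert (Ny : 0 <= ny <= 0.1611) by (unfold ny, rad; lra).
  assert (An : RtoC alpha <> RtoC 0) by (intros e; apply RtoC_inj in e; lra).
  assert (Bn : RtoC (- beta)%R <> RtoC 0) by (intros e; apply RtoC_inj in e; lra).
  assert (Kn : RtoC (3 * alpha + 2 * beta)%R <> RtoC 0) by (intros e; apply RtoC_inj in e; lra).
  (* The divisor is the coefficient of q in E4^3 - E6^2, so the expansion of [Dl] starts with q
     whatever [alpha] and [beta] are. *)
  set (Dl := fun z => ((E4 z ^ 3 - E6 z ^ 2) / (3 * alpha + 2 * beta)%R)%C).
  destruct (psx_eisenstein E4 alpha x nx ltac:(lra) Hx ltac:(reflexivity)) as [e4 [A1 A2]].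
  destruct (psx_eisenstein E6 (- beta) y ny ltac:(lra) Hy ltac:(reflexivity)) as [e6 [B1 B2]].
  pose proof (psx_eta x y alpha beta nx ny Ha Hb Nx Ny Hx Hy) as HE.
  set (eta := fun z => (1 - Dl z / qpar z)%C).
  assert (He : psx eta (9 / 10) 0).
  { eapply psx_ext; [|apply Rle_refl|reflexivity|exact HE]. intros z _. cbn beta. unfold eta, Dl.
    assert (Q := qpar_neq_0 z).
    replace (1 + alpha * (qpar z * (1 + x z)))%C with (E4 z) by (unfold x; field; auto).
    replace (1 + (- beta)%R * (qpar z * (1 + y z)))%C with (E6 z) by (unfold y; field; auto).
    set (u := (E4 z ^ 3)%C). set (v := (E6 z ^ 2)%C). field. auto. }
  clear HE.
  assert (Hd : psx (fun z => Dl z / qpar z)%C (1 + 9 / 10) 1).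
  { eapply psx_ext; [| | |exact (psx_plus _ _ _ _ _ _ psx_one (psx_scal_R (-1) _ _ _ He))].
    - intros z _. unfold eta. replace (RtoC (-1)) with (- (1))%C; [ring|].
      unfold RtoC, Copp; simpl; f_equal; ring.
    - rewrite Rabs_left; lra.
    - ring. }
  destruct Hd as [d [D1 D2]].
  destruct He as [c [C1 C2]].
  assert (Dn : forall z, Cmod (qpar z) <= rad -> Dl z <> RtoC 0).
  (* At a zero of [Dl] the function [eta] would take the value 1, against its bound 9/10. *)
  { intros z Hz E. pose proof (ps_Cmod _ _ _ z C2 Hz) as B. unfold eta in B. rewrite E in B.
    replace (1 - 0 / qpar z)%C with (RtoC 1) in B by (field; apply qpar_neq_0).
    rewrite Cmod_1 in B. lra. }
  destruct (ps_inv _ _ _ C2 ltac:(lra) C1) as [d' [D3 D4]].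
  exists E4, E6, Dl, e4, e6, d, d'.
  (* 10 = 1 / (1 - 9/10) is the norm of the geometric inverse q / Delta. *)
  set (V := Rmax (1 + Rabs alpha * (rad * (1 + nx))) (Rmax (1 + Rabs (- beta) * (rad * (1 + ny))) 10)).
  assert (V1 : 1 + Rabs alpha * (rad * (1 + nx)) <= V) by apply Rmax_l.
  assert (V2 : 1 + Rabs (- beta) * (rad * (1 + ny)) <= V).
  { eapply Rle_trans; [|apply Rmax_r]. apply Rmax_l. }
  assert (V3 : 10 <= V) by (eapply Rle_trans; [|apply Rmax_r]; apply Rmax_r).
  exists V. split; auto.
  - lra.
  - intros z Hz. unfold Dl. rewrite S4, S6 by auto. simpl Cpow. field. auto.
  - now apply (ps_weaken _ _ _ _ V1).
  - now apply (ps_weaken _ _ _ _ V2).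
  - apply (ps_weaken _ _ (1 + 9 / 10)); auto. lra.
  - apply (ps_weaken _ _ (/ (1 - 9 / 10))); [lra|].
    apply (ps_ext (fun z => / (1 - eta z))%C _ d'); auto.
    intros z Hz. unfold eta. replace (1 - (1 - Dl z / qpar z))%C with (Dl z / qpar z)%C by ring.
    field. split; [apply Dn; auto|apply qpar_neq_0].
Qed.

(** * Forms of weight two *)

Lemma exp_pow x n : exp x ^ n = exp (INR n * x).
Proof.
  induction n as [|n IH]; [simpl; now rewrite Rmult_0_l, exp_0|].
  rewrite S_INR, Rmult_plus_distr_r, Rmult_1_l, exp_plus, <- IH. simpl. ring.
Qed.

(** 5.438 lies just below 3.14 * 1.732, hence below pi sqrt 3. Taking a tenth of it lets a short
    Taylor polynomial suffice. *)
Lemma exp_5_438_lower : 220 < exp 5.438.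
Proof.
  assert (H : 1.722 <= exp 0.5438).
  { eapply Rle_trans; [|apply (exp_ge_taylor 0.5438 4); lra]. simpl. lra. }
  replace 5.438 with (INR 10 * 0.5438) by (simpl; lra). rewrite <- exp_pow.
  apply Rlt_le_trans with (1.722 ^ 10); [simpl; lra|]. apply pow_incr. lra.
Qed.

(** The value of |q| at height sqrt 3 / 2, that of the two corners of the fundamental domain. *)
Definition corner_rad : R := exp (- 2 * PI * (sqrt 3 / 2)).

Lemma corner_rad_lt : 0 < corner_rad < rad.
Proof.
  split; [apply exp_pos|]. unfold corner_rad, rad.
  replace (- 2 * PI * (sqrt 3 / 2)) with (- (PI * sqrt 3)) by field. rewrite exp_Ropp.
  apply Rinv_lt_contravar; [pose proof (exp_pos (PI * sqrt 3)); nra|].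
  eapply Rlt_le_trans; [apply exp_5_438_lower|].
  assert (S3 : 1.732 <= sqrt 3).
  { rewrite <- (sqrt_pow2 1.732) by lra. apply sqrt_le_1_alt. lra. }
  pose proof PI_bounds.
  destruct (Req_dec 5.438 (PI * sqrt 3)) as [->|]; [lra|].
  left. apply exp_increasing. nra.
Qed.

Lemma sqrt3_pos : 0 < sqrt 3.
Proof. apply sqrt_lt_R0. lra. Qed.

Lemma Cmod_qpar_corner z : sqrt 3 / 2 <= Im z -> Cmod (qpar z) <= corner_rad.
Proof.
  intros H. rewrite Cmod_qpar. unfold corner_rad. pose proof PI_bounds.
  destruct H as [H|<-]; [|lra]. left. apply exp_increasing. nra.
Qed.

Lemma ps_exists a v : weighted_bound a v -> exists f, ps f a v.
Proof.
  intros H. exists (fun z => epsilon (inhabits (RtoC 0)) (csums (fun n => a n * qpar z ^ n)%C)).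
  split; auto. intros z Hz. apply epsilon_spec.
  apply (csums_dominated _ (fun n => Cmod (a n * qpar z ^ n)%C) v); [intros; lra|].
  intros N. now apply weighted_bound_at.
Qed.

(* The termwise primitive [w_0 z + sum_(n >= 1) w_n q^n / (2 pi i n)] of [W]. *)
Lemma primitive W w v :
  ps W w v -> exists A K h0,
    0 < h0 /\ (forall z, sqrt 3 / 2 <= Im z -> A (z + 1)%C = (A z + w O)%C) /\
    forall z h, sqrt 3 / 2 <= Im z -> Cmod h <= h0 ->
      Cmod (A (z + h) - A z - h * W z)%C <= K * Cmod h ^ 2.
Proof.
  intros [H1 H2]. pose proof PI_bounds as [P1 P2]. assert (v0 := weighted_bound_pos _ _ H1).
  set (t := fun n => match n with O => RtoC 0 | S _ => (w n / (twopii * INR n))%C end).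
  assert (NS : forall n, RtoC (INR (S n)) <> RtoC 0).
  { intros n E. apply RtoC_inj in E. pose proof (lt_0_INR (S n) ltac:(lia)). lra. }
  assert (Ct : forall n, Cmod (t (S n)) = Cmod (w (S n)) / (2 * PI * INR (S n))).
  { intros n. unfold t. rewrite Cmod_div by (apply Cmult_neq_0; [apply twopii_neq_0|apply NS]).
    rewrite Cmod_mult, Cmod_twopii, Cmod_R, Rabs_pos_eq by apply pos_INR. reflexivity. }
  destruct (ps_exists t v) as [T [_ HT]].
  { intros N. eapply Rle_trans; [|apply (H1 N)]. apply rsum_le. intros n _.
    apply Rmult_le_compat_r; [left; apply rad_pow_pos|]. destruct n as [|n].
    - simpl t. rewrite Cmod_0. apply Cmod_ge_0.
    - rewrite Ct. pose proof (Cmod_ge_0 (w (S n))). assert (1 <= INR (S n)).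
      { rewrite S_INR. pose proof (pos_INR n). lra. }
      apply Rmult_le_reg_r with (2 * PI * INR (S n)); [nra|].
      unfold Rdiv. rewrite Rmult_assoc, Rinv_l by nra.
      assert (1 <= 2 * PI * INR (S n)) by nra. nra. }
  pose proof corner_rad_lt as [C1 C2]. set (r1 := corner_rad) in *. set (r2 := (r1 + rad) / 2).
  assert (R2 : r1 < r2 < rad) by (unfold r2; lra).
  (* An increment of modulus at most [h0] multiplies |q| by at most r2 / r1, so z + h stays within
     r2 < [rad]. *)
  set (h0 := ln (r2 / r1) / (2 * PI)).
  assert (Hr : 1 < r2 / r1).
  { apply Rmult_lt_reg_r with r1; auto. unfold Rdiv. rewrite Rmult_assoc, Rinv_l; lra. }
  assert (h0p : 0 < h0).
  { unfold h0. apply Rdiv_lt_0_compat; [|lra]. rewrite <- ln_1. apply ln_increasing; lra. }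
  assert (Eh : r1 * exp (2 * PI * h0) = r2).
  { unfold h0. replace (2 * PI * (ln (r2 / r1) / (2 * PI))) with (ln (r2 / r1)) by (field; lra).
    rewrite exp_ln by lra. field. lra. }
  (* The second-order remainder of the n-th term costs n^2. One factor n cancels against the
     primitive's denominator; the other is absorbed by the gap between r2 and [rad]. *)
  destruct (INR_mult_pow_bound (r2 / rad)) as [B [B0 HB]].
  { split; [left; apply Rdiv_lt_0_compat; lra|]. apply Rmult_lt_reg_r with rad; [lra|].
    unfold Rdiv. rewrite Rmult_assoc, Rinv_l; lra. }
  exists (fun z => w O * z + T z)%C, (8 * PI * B * v), h0. repeat split; auto.
  - intros z Hz. assert (D : Cmod (qpar z) <= rad).
    { pose proof (Cmod_qpar_corner z Hz). fold r1 in H. lra. }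
    replace (T (z + 1)%C) with (T z); [ring|].
    apply (csums_unique _ _ _ (HT z D)). rewrite <- (qpar_add_1 z). apply HT.
    now rewrite qpar_add_1.
  - intros z h Hz Hh. pose proof (Cmod_qpar_corner z Hz) as Q1. fold r1 in Q1.
    pose proof (Cmod_ge_0 h) as h_0.
    assert (X : exp (2 * PI * Cmod h) <= exp (2 * PI * h0)).
    { destruct Hh as [Hh| ->]; [left; apply exp_increasing; nra|lra]. }
    assert (X0 := exp_pos (2 * PI * Cmod h)).
    assert (QX : Cmod (qpar z) * exp (2 * PI * Cmod h) <= r2).
    { rewrite <- Eh. apply Rmult_le_compat; auto; [apply Cmod_ge_0|lra]. }
    assert (D1 : Cmod (qpar z) <= rad) by lra.
    assert (D2 : Cmod (qpar (z + h)) <= rad).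
    { rewrite qpar_plus, Cmod_mult, (Cmod_qpar h).
      apply Rle_trans with (Cmod (qpar z) * exp (2 * PI * Cmod h)); [|lra].
      apply Rmult_le_compat_l; [apply Cmod_ge_0|].
      pose proof (im_le_Cmod h) as I. pose proof (Rle_abs (- Im h)) as I2. rewrite Rabs_Ropp in I2.
      destruct (Req_dec (- 2 * PI * Im h) (2 * PI * Cmod h)) as [->|]; [lra|].
      left. apply exp_increasing. nra. }
    replace (w O * (z + h) + T (z + h) - (w O * z + T z) - h * W z)%C
      with (T (z + h) + - (1) * (T z + h * (W z + - (1) * (w O * 1))))%C by ring.
    assert (HT2 := csums_plus _ _ _ _ (HT (z + h)%C D2) (csums_scal (- (1))%C _ _
      (csums_plus _ _ _ _ (HT z D1) (csums_scal h _ _ (csums_plus _ _ _ _ (H2 z D1)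
        (csums_scal (- (1))%C _ _ (csums_scal (w O) _ _ (csums_cone (qpar z))))))))).
    apply (csums_bound _ _ _ HT2). intros N.
    apply Rle_trans with (rsum (fun n => (8 * PI * B * Cmod h ^ 2) * (Cmod (w n) * rad ^ n)) N).
    2:{ rewrite rsum_scal. specialize (H1 N). pose proof (pow2_ge_0 (Cmod h)).
        replace (8 * PI * B * v * Cmod h ^ 2) with (8 * PI * B * Cmod h ^ 2 * v) by ring.
        apply Rmult_le_compat_l; auto. apply Rmult_le_pos; auto. apply Rmult_le_pos; lra. }
    apply rsum_le. intros n _. destruct n as [|n].
    + simpl t. simpl cone. match goal with |- Cmod ?u <= _ => replace u with (RtoC 0) by (simpl; ring) end.
      rewrite Cmod_0. pose proof (pow2_ge_0 (Cmod h)). pose proof (Cmod_ge_0 (w O)).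
      apply Rmult_le_pos; [apply Rmult_le_pos; auto; apply Rmult_le_pos; lra|].
      apply Rmult_le_pos; auto. left. apply rad_pow_pos.
    + set (m := S n). assert (m1 : 1 <= INR m) by (unfold m; rewrite S_INR; pose proof (pos_INR n); lra).
      set (tm := t m). assert (Ew : (w m = tm * (twopii * INR m))%C).
      { unfold tm, t, m. field. split; [apply NS|apply twopii_neq_0]. }
      rewrite qpar_plus, Cpow_mult_l. change (cone m) with (RtoC 0).
      match goal with |- Cmod ?u <= _ => replace u with
        (tm * (qpar z ^ m * (qpar (INR m * h) - 1 - twopii * (INR m * h))))%C end.
      2:{ rewrite qpar_INR, Ew. ring. }
      rewrite !Cmod_mult, Cmod_pow.
      pose proof (qpar_quad (INR m * h)) as Q. rewrite Cmod_mult, Cmod_R, Rabs_pos_eq in Q by lra.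
      assert (Etm : Cmod tm = Cmod (w m) / (2 * PI * INR m)) by apply Ct.
      assert (Eexp : exp (2 * PI * (INR m * Cmod h)) = exp (2 * PI * Cmod h) ^ m).
      { rewrite exp_pow. f_equal. ring. }
      rewrite Eexp in Q.
      apply Rle_trans with (Cmod tm * (Cmod (qpar z) ^ m *
        (4 * (2 * PI * (INR m * Cmod h)) ^ 2 * exp (2 * PI * Cmod h) ^ m))).
      { apply Rmult_le_compat_l; [apply Cmod_ge_0|].
        apply Rmult_le_compat_l; [apply pow_le, Cmod_ge_0|exact Q]. }
      replace (Cmod tm * (Cmod (qpar z) ^ m * (4 * (2 * PI * (INR m * Cmod h)) ^ 2 * exp (2 * PI * Cmod h) ^ m)))
        with (8 * PI * Cmod h ^ 2 * Cmod (w m) * (INR m * (Cmod (qpar z) * exp (2 * PI * Cmod h)) ^ m)).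
      2:{ rewrite Etm, Rpow_mult_distr. field. lra. }
      replace (8 * PI * B * Cmod h ^ 2 * (Cmod (w m) * rad ^ m))
        with (8 * PI * Cmod h ^ 2 * Cmod (w m) * (B * rad ^ m)) by ring.
      apply Rmult_le_compat_l.
      { apply Rmult_le_pos; [|apply Cmod_ge_0]. apply Rmult_le_pos; [lra|apply pow2_ge_0]. }
      apply Rle_trans with (INR m * r2 ^ m).
      { apply Rmult_le_compat_l; [lra|]. apply pow_incr. split; auto.
        apply Rmult_le_pos; [apply Cmod_ge_0|lra]. }
      specialize (HB m). replace (INR m * r2 ^ m) with (INR m * (r2 / rad) ^ m * rad ^ m).
      { apply Rmult_le_compat_r; auto. left. apply rad_pow_pos. }
      unfold Rdiv. rewrite Rpow_mult_distr, pow_inv. pose proof (rad_pow_pos m). field. lra.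
Qed.

(** Over N equal steps the increments add up to at most M (b - a)^2 / N, which tends to 0. *)
Lemma quadratic_increments_constant (F : R -> C) a b M eps :
  a <= b -> 0 < eps ->
  (forall s t, a <= s <= b -> a <= t <= b -> Rabs (t - s) <= eps -> Cmod (F t - F s) <= M * (t - s) ^ 2) ->
  F a = F b.
Proof.
  intros Hab He H.
  assert (G : forall n, b - a <= eps * INR (S n) -> Cmod (F b - F a) <= Rabs M * (b - a) ^ 2 / INR (S n)).
  { intros n Hn. set (N := INR (S n)) in *. assert (N1 : 0 < N) by (apply lt_0_INR; lia).
    set (p := fun i => a + (b - a) * (INR i / N)).
    assert (Hd : 0 <= (b - a) / N) by (apply Rmult_le_pos; [lra|left; now apply Rinv_0_lt_compat]).
    assert (Q : forall i, (i <= S n)%nat -> Cmod (F (p i) - F a) <= INR i * (Rabs M * ((b - a) / N) ^ 2)).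
    { induction i as [|i IH]; intros Hi.
      - replace (p O) with a by (unfold p; simpl; field; lra).
        replace (F a - F a)%C with (RtoC 0) by ring. rewrite Cmod_0. simpl. lra.
      - eapply Rle_trans; [apply (Cmod_triangle3 _ (F (p i)))|]. rewrite S_INR, Rmult_plus_distr_r, Rplus_comm.
        apply Rplus_le_compat; [apply IH; lia|]. rewrite Rmult_1_l.
        assert (Ed : p (S i) - p i = (b - a) / N) by (unfold p; rewrite S_INR; field; lra).
        assert (In : forall j, (j <= S n)%nat -> a <= p j <= b).
        { intros j Hj. assert (0 <= INR j / N <= 1); [|unfold p; nra].
          split; [apply Rmult_le_pos; [apply pos_INR|left; now apply Rinv_0_lt_compat]|].
          apply Rmult_le_reg_r with N; auto. unfold Rdiv. rewrite Rmult_assoc, Rinv_l by lra.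
          apply le_INR in Hj. fold N in Hj. lra. }
        eapply Rle_trans; [apply H; [apply In; lia|apply In; lia|]|].
        + rewrite Ed, Rabs_pos_eq by auto. apply Rmult_le_reg_r with N; auto.
          unfold Rdiv. rewrite Rmult_assoc, Rinv_l; lra.
        + rewrite Ed. apply Rmult_le_compat_r; [apply pow2_ge_0|apply Rle_abs]. }
    specialize (Q (S n) (le_n _)). replace (p (S n)) with b in Q.
    - fold N in Q. eapply Rle_trans; [exact Q|]. right. field. lra.
    - unfold p. fold N. field. lra. }
  assert (Z : Cmod (F b - F a) <= 0).
  { apply Rnot_lt_le. intros Hp. set (D := Cmod (F b - F a)) in *.
    pose proof (Rabs_pos M) as M0. pose proof (pow2_ge_0 (b - a)) as L0.
    set (X := Rabs M * (b - a) ^ 2) in *. assert (X0 : 0 <= X) by (apply Rmult_le_pos; auto).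
    destruct (archimed_cor1 (Rmin (eps / (b - a + 1)) (D / (X + 1)))) as [n [Hn1 Hn2]].
    { apply Rmin_glb_lt; apply Rdiv_lt_0_compat; lra. }
    destruct n as [|n]; [lia|]. assert (N1 : 0 < INR (S n)) by (apply lt_0_INR; lia).
    pose proof (Rmin_l (eps / (b - a + 1)) (D / (X + 1))) as m1.
    pose proof (Rmin_r (eps / (b - a + 1)) (D / (X + 1))) as m2.
    assert (G1 : / INR (S n) * (b - a + 1) < eps).
    { apply Rmult_lt_reg_r with (/ (b - a + 1)); [apply Rinv_0_lt_compat; lra|].
      rewrite Rmult_assoc, Rinv_r by lra. unfold Rdiv in m1. lra. }
    assert (G2 : / INR (S n) * (X + 1) < D).
    { apply Rmult_lt_reg_r with (/ (X + 1)); [apply Rinv_0_lt_compat; lra|].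
      rewrite Rmult_assoc, Rinv_r by lra. unfold Rdiv in m2. lra. }
    assert (I0 : 0 < / INR (S n)) by now apply Rinv_0_lt_compat.
    assert (D <= X / INR (S n)).
    { apply G. apply Rmult_le_reg_l with (/ INR (S n)); auto.
      replace (/ INR (S n) * (eps * INR (S n))) with eps by (field; lra). nra. }
    unfold Rdiv in H0. nra. }
  pose proof (Cmod_ge_0 (F b - F a)). assert (E : Cmod (F b - F a) = 0) by lra.
  apply Cmod_eq_0 in E. replace (F b) with (F b - F a + F a)%C by ring. rewrite E. ring.
Qed.

Definition arc (t : R) : C := (cos t, sin t).

Lemma Cmod_arc t : Cmod (arc t) = 1.
Proof.
  unfold Cmod, arc. simpl fst. simpl snd. pose proof (sin2_cos2 t) as H. unfold Rsqr in H.
  replace (cos t ^ 2 + sin t ^ 2) with 1 by lra. apply sqrt_1.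
Qed.

Lemma arc_lipschitz s t : Cmod (arc t - arc s) <= 2 * Rabs (t - s).
Proof.
  eapply Rle_trans; [apply Cmod_le_re_im|].
  change (Re (arc t - arc s)) with (cos t - cos s). change (Im (arc t - arc s)) with (sin t - sin s).
  rewrite form2, form4. rewrite !Rabs_mult.
  pose proof (Rabs_sin_le ((t - s) / 2)) as H.
  replace (Rabs ((t - s) / 2)) with (Rabs (t - s) / 2) in H.
  2:{ unfold Rdiv. rewrite Rabs_mult, (Rabs_pos_eq (/ 2)); lra. }
  assert (H1 : Rabs (sin ((t + s) / 2)) <= 1) by (apply Rabs_le, SIN_bound).
  assert (H2 : Rabs (cos ((t + s) / 2)) <= 1) by (apply Rabs_le, COS_bound).
  rewrite (Rabs_left (-2)), (Rabs_pos_eq 2) by lra.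
  pose proof (Rabs_pos (sin ((t - s) / 2))). pose proof (Rabs_pos (sin ((t + s) / 2))).
  pose proof (Rabs_pos (cos ((t + s) / 2))). nra.
Qed.

Lemma Im_arc t : PI / 3 <= t <= 2 * (PI / 3) -> sqrt 3 / 2 <= Im (arc t).
Proof.
  intros [H1 H2]. pose proof PI_bounds as [P1 P2]. change (Im (arc t)) with (sin t).
  assert (C1 : cos t <= 1 / 2).
  { rewrite <- cos_PI3. apply cos_decr_1; lra. }
  assert (C2 : - (1 / 2) <= cos t).
  { replace (- (1 / 2)) with (-1 / 2) by field. rewrite <- cos_2PI3. apply cos_decr_1; lra. }
  assert (S0 : 0 <= sin t) by (apply sin_ge_0; lra).
  pose proof (sin2_cos2 t) as SC. unfold Rsqr in SC.
  apply Rsqr_incr_0_var; auto. unfold Rsqr.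
  pose proof (sqrt_sqrt 3 ltac:(lra)). nra.
Qed.

(** On the unit circle the inversion is the reflection in the imaginary axis; in particular it keeps
    the arc at the same height. *)
Lemma S_act_unit z : Cmod z = 1 -> S_act z = (- Re z, Im z).
Proof.
  intros H. pose proof (Cmod2_alt z) as E. rewrite H in E. destruct z as [x y].
  unfold S_act, Re, Im in *. simpl in *. unfold Cinv, Copp. simpl.
  replace (x * (x * 1) + y * (y * 1)) with 1 by lra. f_equal; field.
Qed.

(* The differential form [W dz] is invariant under [z |-> -1/z] and [z |-> z+1], which both map
   one corner of the fundamental domain to the other; so the primitive of [W] changes by [w_0]
   along the bottom arc, but also by [0]. *)
Lemma weight_two_constant_term W w v :
  ps W w v ->
  (forall z, Cmod z = 1 -> sqrt 3 / 2 <= Im z -> W (S_act z) = z ^ 2 * W z)%C ->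
  w O = RtoC 0.
Proof.
  intros HW HS. destruct (primitive W w v HW) as [A [K [h0 [h0p [A1 A2]]]]].
  pose proof PI_bounds as [P1 P2].
  set (Phi := fun t => (A (S_act (arc t)) - A (arc t))%C).
  assert (E : Phi (PI / 3) = Phi (2 * (PI / 3))).
  (* Two remainders of the primitive and one error |h|^2 |W| occur; the factor 4 and the halved step
     come from |h| <= 2 |t - s|. *)
  { apply (quadratic_increments_constant Phi _ _ ((2 * Rabs K + v) * 4) (h0 / 2)); [lra|lra|].
    intros s t Hs Ht Hst. set (z := arc s). set (z' := arc t). set (h := (z' - z)%C).
    assert (Hh : Cmod h <= 2 * Rabs (t - s)) by apply arc_lipschitz.
    assert (Z1 : Cmod z = 1) by apply Cmod_arc. assert (Z2 : Cmod z' = 1) by apply Cmod_arc.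
    assert (Zn : z <> RtoC 0) by (apply Cmod_gt_0; lra).
    assert (Zn' : z' <> RtoC 0) by (apply Cmod_gt_0; lra).
    assert (I1 : sqrt 3 / 2 <= Im z) by now apply Im_arc.
    assert (I2 : sqrt 3 / 2 <= Im (S_act z)) by (rewrite S_act_unit by auto; exact I1).
    (* The exact increment of -1/z. Multiplied by z^2 W(z) it gives h W(z) up to the quadratic error
       h^2 W(z) / z'. *)
    set (h' := (h / (z * z'))%C).
    assert (Ch : Cmod h' = Cmod h).
    { unfold h'. rewrite Cmod_div by now apply Cmult_neq_0. rewrite Cmod_mult, Z1, Z2. field. }
    pose proof (A2 z h I1 ltac:(lra)) as B1. pose proof (A2 (S_act z) h' I2 ltac:(lra)) as B2.
    replace (z + h)%C with z' in B1 by (unfold h; ring).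
    replace (S_act z + h')%C with (S_act z') in B2 by (unfold h', h, S_act; field; auto).
    rewrite HS in B2 by auto. rewrite Ch in B2.
    unfold Phi. fold z z'.
    replace (A (S_act z') - A z' - (A (S_act z) - A z))%C with
      ((A (S_act z') - A (S_act z) - h' * (z ^ 2 * W z)) + (- (A z' - A z - h * W z)
        + - (h * h / z') * W z))%C.
    2:{ unfold h'. replace z' with (z + h)%C in * by (unfold h; ring). simpl. field. auto. }
    eapply Rle_trans; [apply Cmod_triangle|]. eapply Rle_trans; [apply Rplus_le_compat_l, Cmod_triangle|].
    rewrite Cmod_opp, (Cmod_mult (- _)), Cmod_opp, Cmod_div, Z2, Cmod_mult by auto.
    assert (WB : Cmod (W z) <= v).
    { apply (ps_Cmod W w v); auto. pose proof (Cmod_qpar_corner z I1). pose proof corner_rad_lt. lra. }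
    pose proof (Cmod_ge_0 h) as h_0. pose proof (Rle_abs K) as KA. pose proof (Rabs_pos K) as K0.
    assert (v0 : 0 <= v) by (eapply Rle_trans; [apply Cmod_ge_0|exact WB]).
    assert (HQ : Cmod h ^ 2 <= 4 * (t - s) ^ 2).
    { rewrite <- (pow2_abs (t - s)). replace (4 * Rabs (t - s) ^ 2) with ((2 * Rabs (t - s)) ^ 2) by ring.
      apply pow_incr. lra. }
    pose proof (pow2_ge_0 (Cmod h)) as H2.
    replace (Cmod h * Cmod h / 1) with (Cmod h ^ 2) by field.
    assert (K * Cmod h ^ 2 <= Rabs K * Cmod h ^ 2) by (apply Rmult_le_compat_r; auto).
    assert (Cmod h ^ 2 * Cmod (W z) <= Cmod h ^ 2 * v) by (apply Rmult_le_compat_l; auto).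
    apply Rle_trans with ((2 * Rabs K + v) * Cmod h ^ 2); [lra|].
    rewrite Rmult_assoc. apply Rmult_le_compat_l; lra. }
  set (r := arc (PI / 3)). set (r' := arc (2 * (PI / 3))).
  assert (R1 : S_act r = r').
  { rewrite S_act_unit by apply Cmod_arc. unfold r, r', arc, Re, Im. simpl fst. simpl snd.
    rewrite cos_PI3, cos_2PI3, sin_PI3, sin_2PI3. f_equal. field. }
  assert (R2 : S_act r' = r).
  { rewrite S_act_unit by apply Cmod_arc. unfold r, r', arc, Re, Im. simpl fst. simpl snd.
    rewrite cos_PI3, cos_2PI3, sin_PI3, sin_2PI3. f_equal. field. }
  assert (R3 : r = (r' + 1)%C).
  { unfold r, r', arc, Cplus, RtoC. simpl. rewrite cos_PI3, cos_2PI3, sin_PI3, sin_2PI3. f_equal; field. }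
  (* At the two ends of the arc [Phi] equals -w_0 and w_0, since the inversion exchanges the corners
     and the corners differ by 1. *)
  unfold Phi in E. fold r r' in E. rewrite R1, R2, R3, A1 in E by (apply Im_arc; lra).
  assert (E2 : (2 * w O = 0)%C).
  { apply (f_equal (fun x => x - (A r' - (A r' + w O)))%C) in E. ring_simplify in E.
    rewrite <- E. ring. }
  replace (w O) with (/ 2 * (2 * w O))%C by (field; apply C2_neq_0). rewrite E2. ring.
Qed.

Lemma modular_vanishing E4 E6 Dl e4 e6 d d' V k l a b f c v :
  modular_generators E4 E6 Dl e4 e6 d d' V ->
  (k = 12 * l + 4 * a + 6 * b)%nat -> (a <= 2)%nat -> (b <= 1)%nat ->
  ps f c v -> (forall z, 0 < Im z -> f (S_act z) = z ^ k * f z)%C ->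
  (forall n, (n <= l)%nat -> c n = RtoC 0) -> forall n, c n = RtoC 0.
Proof.
  intros G Hk Ha Hb Hf HS Hc. induction n as [n IH] using lt_wf_ind.
  destruct (Nat.le_gt_cases n l) as [Hn|Hn]; [auto|].
  (* These exponents give k + 4 i + 6 j = 12 n + 2. The subtractions are exact because a <= 2, b <=
     1 and l < n. *)
  set (i := (2 - a + 3 * (n - l - 1))%nat). set (j := (1 - b)%nat).
  pose proof (ps_mult _ _ _ _ _ _ (ps_unshift n f c v IH Hf)
    (ps_mult _ _ _ _ _ _ (ps_pow _ _ _ i (gen_E4 _ _ _ _ _ _ _ _ G))
      (ps_mult _ _ _ _ _ _ (ps_pow _ _ _ j (gen_E6 _ _ _ _ _ _ _ _ G))
        (ps_pow _ _ _ n (gen_Dl_inv _ _ _ _ _ _ _ _ G))))) as HW.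
  apply weight_two_constant_term in HW.
  - rewrite !conv_0, !cpw_0, Nat.add_0_r in HW by apply G. rewrite <- HW. ring.
  - intros z Hz Iz. pose proof sqrt3_pos as S3. pose proof corner_rad_lt as CR.
    assert (Iz' : sqrt 3 / 2 <= Im (S_act z)) by (rewrite S_act_unit by auto; exact Iz).
    assert (D1 := gen_Dl_neq_0 _ _ _ _ _ _ _ _ G z ltac:(pose proof (Cmod_qpar_corner z Iz); lra)).
    assert (D2 := gen_Dl_neq_0 _ _ _ _ _ _ _ _ G (S_act z) ltac:(pose proof (Cmod_qpar_corner _ Iz'); lra)).
    assert (Zn : z <> RtoC 0) by (apply Cmod_gt_0; lra).
    assert (X : forall u, Dl u <> RtoC 0 ->
      (f u / qpar u ^ n * (E4 u ^ i * (E6 u ^ j * (qpar u / Dl u) ^ n))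
        = f u * E4 u ^ i * E6 u ^ j / Dl u ^ n)%C).
    { intros u Hu. assert (Q := Cpow_nz _ n (qpar_neq_0 u)). assert (Q2 := Cpow_nz _ n Hu).
      unfold Cdiv. rewrite Cpow_mult_l, Cpow_inv by auto. field. auto. }
    rewrite !X by auto.
    rewrite HS, (gen_E4_S _ _ _ _ _ _ _ _ G), (gen_E6_S _ _ _ _ _ _ _ _ G),
      (gen_Dl_S _ _ _ _ _ _ _ _ G) by lra.
    rewrite !Cpow_mult_l, <- !Cpow_mult_r.
    assert (Q2 := Cpow_nz _ n D1). assert (Q3 := Cpow_nz _ (12 * n) Zn).
    assert (Ez : (z ^ k * z ^ (4 * i) * z ^ (6 * j) = z ^ 2 * z ^ (12 * n))%C).
    { rewrite <- !Cpow_add_r. f_equal. unfold i, j. lia. }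
    transitivity ((z ^ k * z ^ (4 * i) * z ^ (6 * j)) * f z * E4 z ^ i * E6 z ^ j
      / (z ^ (12 * n) * Dl z ^ n))%C.
    { set (u := (z ^ k)%C). set (u1 := (z ^ (4 * i))%C). set (u2 := (z ^ (6 * j))%C).
      set (u3 := (z ^ (12 * n))%C) in *. field. auto. }
    rewrite Ez. set (u3 := (z ^ (12 * n))%C) in *. field. auto.
Qed.

(** * Miller forms *)

Definition geometric (M : R) (a : nat -> C) : Prop :=
  a O = RtoC 1 /\ forall n, Cmod (a n) <= M ^ n.

(** The summands occur in the binomial expansion of (x + y)^n with coefficients at least 1. Hence
    growth rates add under Cauchy products, and a product of k series has a rate linear in k. *)
Lemma rsum_pow_le_pow_sum x y n :
  0 <= x -> 0 <= y -> rsum (fun i => x ^ i * y ^ (n - i)) (S n) <= (x + y) ^ n.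
Proof.
  intros Hx Hy. induction n as [|n IH].
  - simpl. lra.
  - cbn [rsum] in *. rewrite Nat.sub_diag.
    rewrite (rsum_ext _ (fun i => y * (x ^ i * y ^ (n - i)))).
    2:{ intros i Hi. replace (S n - i)%nat with (S (n - i)) by lia. simpl. ring. }
    rewrite rsum_scal. replace (S n - n)%nat with 1%nat by lia. rewrite Nat.sub_diag in IH.
    simpl pow in *.
    assert (x ^ n <= (x + y) ^ n) by (apply pow_incr; lra). nra.
Qed.

Lemma geometric_conv M N a b :
  0 <= M -> 0 <= N -> geometric M a -> geometric N b -> geometric (M + N) (conv a b).
Proof.
  intros HM HN [A1 A2] [B1 B2]. split; [rewrite conv_0, A1, B1; ring|]. intros n.
  eapply Rle_trans; [|apply (rsum_pow_le_pow_sum M N n); auto].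
  eapply Rle_trans; [apply Cmod_csum|]. apply rsum_le. intros i _. rewrite Cmod_mult.
  apply Rmult_le_compat; auto using Cmod_ge_0.
Qed.

Lemma geometric_cpw M a n : 0 <= M -> geometric M a -> geometric (INR n * M) (cpw a n).
Proof.
  intros HM Ha. induction n as [|n IH].
  - split; auto. intros [|n]; simpl.
    + rewrite Cmod_1. lra.
    + rewrite Cmod_0, Rmult_0_l, Rmult_0_l. lra.
  - rewrite S_INR. replace ((INR n + 1) * M) with (M + INR n * M) by ring.
    apply geometric_conv; auto. apply Rmult_le_pos; [apply pos_INR|auto].
Qed.

Lemma geometric_weaken M N a : 0 <= M <= N -> geometric M a -> geometric N a.
Proof.
  intros H [A1 A2]. split; auto. intros n. eapply Rle_trans; [apply A2|]. now apply pow_incr.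
Qed.

Lemma geometric_of_ps f a V : ps f a V -> 1 <= V -> a O = RtoC 1 -> geometric (V / rad) a.
Proof.
  intros [H _] HV Ha. split; auto. intros [|n].
  - rewrite Ha, Cmod_1. simpl. lra.
  - pose proof (weighted_bound_coef a V (S n) H) as B. pose proof (rad_pow_pos (S n)) as R0.
    unfold Rdiv. rewrite Rpow_mult_distr, pow_inv.
    apply Rmult_le_reg_r with (rad ^ S n); auto. rewrite Rmult_assoc, Rinv_l, Rmult_1_r by lra.
    (* For positive index V <= V^n, because V >= 1; so the constant can be absorbed into the
       rate. *)
    eapply Rle_trans; [exact B|]. rewrite <- (pow_1 V) at 1. apply Rle_pow; [auto|lia].
Qed.

(** Without its constant term the series has a factor q, which yields |q| / [rad] in front of the
    norm. *)
Lemma ps_near_cusp f a v z :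
  ps f a v -> Cmod (qpar z) <= rad -> Cmod (f z - a O) <= v * (Cmod (qpar z) / rad).
Proof.
  intros [H1 H2] Hz. specialize (H2 z Hz). apply csums_shift in H2.
  replace (f z - a O * qpar z ^ 0)%C with (f z - a O)%C in H2 by (simpl; ring).
  assert (R0 : 0 < rad) by (unfold rad; lra). pose proof (Cmod_ge_0 (qpar z)) as Q0.
  apply (csums_bound _ _ _ H2). intros N.
  apply Rle_trans with (rsum (fun n => Cmod (qpar z) / rad * (Cmod (a (S n)) * rad ^ S n)) N).
  - apply rsum_le. intros n _. rewrite Cmod_mult, Cmod_pow. simpl.
    replace (Cmod (qpar z) / rad * (Cmod (a (S n)) * (rad * rad ^ n)))
      with (Cmod (a (S n)) * (Cmod (qpar z) * rad ^ n)) by (field; lra).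
    apply Rmult_le_compat_l; [apply Cmod_ge_0|]. apply Rmult_le_compat_l; auto. apply pow_incr. lra.
  - rewrite rsum_scal, Rmult_comm. apply Rmult_le_compat_r.
    + apply Rmult_le_pos; [auto|]. left. now apply Rinv_0_lt_compat.
    + eapply Rle_trans; [|apply (H1 (S N))]. rewrite rsum_shift.
      assert (0 <= Cmod (a O) * rad ^ 0); [|lra].
      apply Rmult_le_pos; [apply Cmod_ge_0|left; apply rad_pow_pos].
Qed.

Lemma csums_terms_bounded a l : csums a l -> exists M, 0 <= M /\ forall n, Cmod (a n) <= M.
Proof.
  intros H. destruct (H 1 Rlt_0_1) as [N HN].
  assert (B : forall n, Cmod (csum a n) <= rsum (fun i => Cmod (csum a i)) N + (Cmod l + 1)).
  { intros n. pose proof (Cmod_ge_0 l) as L0. destruct (Nat.le_gt_cases N n) as [Hn|Hn].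
    - specialize (HN n Hn). pose proof (Cmod_minus_ge (csum a n) l).
      assert (0 <= rsum (fun i => Cmod (csum a i)) N) by (apply rsum_ge_0; intros; apply Cmod_ge_0). lra.
    - pose proof (rsum_incr (fun i => Cmod (csum a i)) (S n) N ltac:(intros; apply Cmod_ge_0) Hn) as I.
      cbn [rsum] in I.
      assert (0 <= rsum (fun i => Cmod (csum a i)) n) by (apply rsum_ge_0; intros; apply Cmod_ge_0). lra. }
  set (K := rsum (fun i => Cmod (csum a i)) N + (Cmod l + 1)) in *.
  exists (2 * K). split.
  - specialize (B O). pose proof (Cmod_ge_0 (csum a O)). lra.
  - intros n. replace (a n) with (csum a (S n) - csum a n)%C by (simpl; ring).
    pose proof (Cmod_minus_le (csum a (S n)) (csum a n)). pose proof (B n). pose proof (B (S n)). lra.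
Qed.

(** Convergence at a single point with |q| = 2 [rad] bounds the terms there, and at radius [rad]
    they are then dominated by a geometric series of ratio 1/2. *)
Lemma ps_of_q_expansion g a :
  (forall z, 0 < Im z -> csums (fun n => a n * qpar z ^ n)%C (g z)) -> exists v, ps g a v.
Proof.
  intros H. set (y := - ln (2 * rad) / (2 * PI)). pose proof PI_bounds as [P1 P2].
  assert (Ly : ln (2 * rad) < 0) by (rewrite <- ln_1; apply ln_increasing; unfold rad; lra).
  assert (y0 : 0 < y) by (unfold y; apply Rdiv_lt_0_compat; lra).
  destruct (csums_terms_bounded _ _ (H (0, y) y0)) as [M [M0 HM]].
  assert (Q : Cmod (qpar (0, y)) = 2 * rad).
  { rewrite Cmod_qpar. change (Im (0, y)) with y. unfold y.
    replace (- 2 * PI * (- ln (2 * rad) / (2 * PI))) with (ln (2 * rad)) by (field; lra).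
    apply exp_ln. unfold rad. lra. }
  exists (M * / (1 - / 2)). split.
  - intros N. apply Rle_trans with (rsum (fun n => M * (/ 2) ^ n) N).
    + apply rsum_le. intros n _. specialize (HM n). rewrite Cmod_mult, Cmod_pow, Q, Rpow_mult_distr in HM.
      rewrite pow_inv. assert (T : 0 < 2 ^ n) by (apply pow_lt; lra).
      apply Rmult_le_reg_r with (2 ^ n); auto.
      replace (M * / 2 ^ n * 2 ^ n) with M by (field; lra). lra.
    + rewrite rsum_scal. apply Rmult_le_compat_l; auto. apply rsum_geom. lra.
  - intros z Hz. apply H. now apply rad_dom_Im.
Qed.

Lemma weight_decomposition k :
  (4 <= k)%nat -> Nat.Even k ->
  exists a b, (a <= 2)%nat /\ (b <= 1)%nat /\ (k = 12 * ell k + 4 * a + 6 * b)%nat.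
Proof.
  intros H4 [h Hh]. unfold ell.
  pose proof (Nat.div_mod k 12 ltac:(lia)) as D. pose proof (Nat.mod_upper_bound k 12 ltac:(lia)) as U.
  set (r := (k mod 12)%nat) in *. set (Q := (k / 12)%nat) in *.
  destruct (Nat.eqb_spec r 2) as [E|E].
  (* Residue 2 is the case k' = 14 = 4 * 2 + 6, for which [ell] is one less than the quotient. *)
  - exists 2%nat, 1%nat. lia.
  - assert (R : (r = 0 \/ r = 4 \/ r = 6 \/ r = 8 \/ r = 10)%nat) by lia.
    destruct R as [R|[R|[R|[R|R]]]].
    + exists 0%nat, 0%nat. lia.
    + exists 1%nat, 0%nat. lia.
    + exists 0%nat, 1%nat. lia.
    + exists 2%nat, 0%nat. lia.
    + exists 1%nat, 1%nat. lia.
Qed.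

(** The diagonal entries are 1, so gamma_p is determined by its predecessors. The bound reproduces
    itself because the sum of (2D)^i D^(p-i) over i < p is D^p (2^p - 1). *)
Lemma triangular_system (b : nat -> nat -> C) d D :
  0 <= D -> (forall i, (i <= d)%nat -> geometric D (b i)) ->
  exists gamma : nat -> C,
    gamma O = RtoC 1 /\
    (forall p, (p <= d)%nat -> csum (fun i => gamma i * b i (p - i)%nat)%C (S p) = cone p) /\
    (forall p, (p <= d)%nat -> Cmod (gamma p) <= (2 * D) ^ p).
Proof.
  intros D0 Hb.
  destruct (strong_recursion (fun u p => cone p - csum (fun i => u i * b i (p - i)%nat) p)%C)
    as [gamma Hg].
  { intros u v n H. f_equal. apply csum_ext. intros i Hi. now rewrite H. }
  exists gamma. assert (G0 : gamma O = RtoC 1) by (rewrite Hg; simpl; ring).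
  repeat split; auto.
  - intros p Hp. cbn [csum]. rewrite Nat.sub_diag, (proj1 (Hb p Hp)), (Hg p). ring.
  - induction p as [p IH] using lt_wf_ind. intros Hp. destruct p as [|p].
    + rewrite G0, Cmod_1. simpl. lra.
    + rewrite Hg. change (cone (S p)) with (RtoC 0).
      replace (0 - csum (fun i => gamma i * b i (S p - i)%nat) (S p))%C
        with (- csum (fun i => gamma i * b i (S p - i)%nat) (S p))%C by ring.
      rewrite Cmod_opp. eapply Rle_trans; [apply Cmod_csum|].
      apply Rle_trans with (rsum (fun i => D ^ S p * 2 ^ i) (S p)).
      * apply rsum_le. intros i Hi. rewrite Cmod_mult.
        replace (D ^ S p * 2 ^ i) with ((2 * D) ^ i * D ^ (S p - i)).
        -- apply Rmult_le_compat; try apply Cmod_ge_0; [apply IH; lia|]. apply Hb. lia.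
        -- replace (S p) with (i + (S p - i))%nat at 2 by lia. rewrite Rpow_mult_distr, pow_add. ring.
      * rewrite rsum_scal, Rpow_mult_distr, Rmult_comm. apply Rmult_le_compat_r; [now apply pow_le|].
        assert (G : forall n, rsum (fun i => 2 ^ i) n = 2 ^ n - 1).
        { induction n as [|n IHn]; simpl; [ring|]. rewrite IHn. ring. }
        rewrite G. lra.
Qed.

(** The terms after the leading 1 add up to at most 1/3 + 1/9 + ... = 1/2. *)
Lemma csum_geometric_neq_0 (gamma : nat -> C) t d :
  gamma O = RtoC 1 -> (forall p, (p <= d)%nat -> Cmod (gamma p * t ^ p)%C <= (/ 3) ^ p) ->
  csum (fun i => gamma i * t ^ i)%C (S d) <> RtoC 0.
Proof.
  intros G0 H E. rewrite csum_shift, G0 in E. simpl Cpow in E.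
  set (s := csum _ d) in E.
  assert (Hs : Cmod s <= / 2).
  { eapply Rle_trans; [apply Cmod_csum|].
    apply Rle_trans with (rsum (fun i => / 3 * (/ 3) ^ i) d).
    - apply rsum_le. intros i Hi. change (/ 3 * (/ 3) ^ i) with ((/ 3) ^ S i). apply H. lia.
    - rewrite rsum_scal. apply Rle_trans with (/ 3 * / (1 - / 3)); [|right; field].
      apply Rmult_le_compat_l; [lra|]. apply rsum_geom. lra. }
  assert (E2 : s = (- (1))%C).
  { transitivity ((1 * 1 + s) - 1)%C; [ring|]. rewrite E. ring. }
  rewrite E2, Cmod_opp, Cmod_1 in Hs. lra.
Qed.

Lemma ps_0 : ps (fun _ => RtoC 0) (fun _ => RtoC 0) 0.
Proof.
  split.
  - intros N. rewrite rsum_0; [lra|]. intros. rewrite Cmod_0. ring.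
  - intros z _. apply (csums_finite (fun n => 0 * qpar z ^ n)%C 0). intros. ring.
Qed.

Lemma ps_csum (f : nat -> C -> C) (a : nat -> nat -> C) (n : nat) :
  (forall i, (i < n)%nat -> exists v, ps (f i) (a i) v) ->
  exists v, ps (fun z => csum (fun i => f i z) n) (fun j => csum (fun i => a i j) n) v.
Proof.
  induction n as [|n IH]; intros H.
  - exists 0. apply ps_0.
  - destruct IH as [v Hv]; [intros; apply H; lia|]. destruct (H n) as [w Hw]; [lia|].
    exists (v + w). exact (ps_plus _ _ _ _ _ _ Hv Hw).
Qed.

(** The factor 18 is 2 * 3 * 3: gamma_p is at most (2D)^p, |Delta / E4^3| is at most 3 |q|, and the
    product of the two has to be at most 1/3. *)
Lemma miller_nonvanishing E4 E6 Dl e4 e6 d d' V k m g z :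
  modular_generators E4 E6 Dl e4 e6 d d' V ->
  (4 <= k)%nat -> Nat.Even k -> (m <= ell k)%nat -> is_miller_form k m g ->
  Cmod (qpar z) <= rad / (18 * V * INR k) -> g z <> RtoC 0.
Proof.
  intros G Hk4 Heven Hm [[_ [HS _]] [c [Hc1 Hc2]]] Hz Eg.
  pose proof (gen_V _ _ _ _ _ _ _ _ G) as V1.
  destruct (weight_decomposition k Hk4 Heven) as [a [b [Ha [Hb Hk]]]].
  set (l := ell k) in *. set (n := (l - m)%nat).
  assert (K4 : 4 <= INR k) by (apply le_INR in Hk4; simpl in Hk4; lra).
  assert (R0 : 0 < rad) by (unfold rad; lra).
  destruct (ps_of_q_expansion g c) as [v Hg].
  { intros u Hu. apply csums_of_is_series. now apply Hc2. }
  (* The coefficients of the basis form [Bf i] after division by q^(m+i). It has at most k factors,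
     each of rate V / [rad], which gives the common rate [D]. *)
  set (bb := fun i => conv (cpw e4 (a + 3 * (n - i))) (conv (cpw e6 b) (cpw d (m + i)))).
  set (Bf := fun i u => (E4 u ^ (a + 3 * (n - i)) * E6 u ^ b * Dl u ^ (m + i))%C).
  set (D := INR k * (V / rad)).
  assert (VR : 0 < V / rad) by (apply Rdiv_lt_0_compat; lra).
  assert (D0 : 0 < D) by (unfold D; nra).
  assert (Hgeo : forall i, (i <= n)%nat -> geometric D (bb i)).
  { intros i Hi.
    apply (geometric_weaken (INR (a + 3 * (n - i)) * (V / rad) + (INR b * (V / rad) + INR (m + i) * (V / rad)))).
    - rewrite <- !Rmult_plus_distr_r, <- !plus_INR. split.
      + apply Rmult_le_pos; [apply pos_INR|lra].
      + unfold D. apply Rmult_le_compat_r; [lra|]. apply le_INR. unfold n in *. lia.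
    - assert (P : forall j, 0 <= INR j * (V / rad)) by (intros; apply Rmult_le_pos; [apply pos_INR|lra]).
      unfold bb. apply geometric_conv; auto; [pose proof (P b); pose proof (P (m + i)%nat); lra| |].
      + apply geometric_cpw; [lra|]. apply (geometric_of_ps E4); auto; apply G.
      + apply geometric_conv; auto; apply geometric_cpw; try lra.
        * apply (geometric_of_ps E6); auto; apply G.
        * apply (geometric_of_ps (fun z => Dl z / qpar z)%C); auto; apply G. }
  destruct (triangular_system bb n D ltac:(lra) Hgeo) as [gamma [G0 [G1 G2]]].
  destruct (ps_csum (fun i u => gamma i * Bf i u)%C (fun i j => gamma i * shift (m + i) (bb i) j)%C (S n))
    as [w Hw].
  { intros i Hi. eexists. apply ps_scal.
    pose proof (ps_shift (m + i) _ _ _ (ps_mult _ _ _ _ _ _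
      (ps_pow _ _ _ (a + 3 * (n - i)) (gen_E4 _ _ _ _ _ _ _ _ G))
      (ps_mult _ _ _ _ _ _ (ps_pow _ _ _ b (gen_E6 _ _ _ _ _ _ _ _ G))
        (ps_pow _ _ _ (m + i) (gen_Dl _ _ _ _ _ _ _ _ G))))) as H.
    eapply ps_ext; [| |exact H]; [|reflexivity].
    intros u _. cbn beta. unfold Bf, Cdiv. rewrite Cpow_mult_l, Cpow_inv by apply qpar_neq_0.
    assert (Q := Cpow_nz _ (m + i) (qpar_neq_0 u)). field. auto. }
  pose proof (ps_plus _ _ _ _ _ _ Hg (ps_scal (- (1))%C _ _ _ Hw)) as Hf.
  pose proof (modular_vanishing E4 E6 Dl e4 e6 d d' V k l a b _ _ _ G Hk Ha Hb Hf) as Van.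
  assert (Vc : forall j, (c j + - (1) * csum (fun i => gamma i * shift (m + i) (bb i) j) (S n))%C = RtoC 0).
  { apply Van.
    - intros u Hu. assert (Un := in_H_neq_0 u Hu).
      assert (E1 : g (S_act u) = (u ^ k * g u)%C).
      (* The matrix of z |-> -1/z. *)
      { pose proof (HS 0%Z (-1)%Z 1%Z 0%Z u eq_refl Hu) as E.
        replace ((0 * u + -1) / (1 * u + 0))%C with (S_act u) in E.
        - rewrite E. f_equal. f_equal. ring.
        - unfold S_act. replace (RtoC (-1)) with (- (1))%C
            by (unfold RtoC, Copp; simpl; f_equal; ring). field. auto. }
      rewrite E1, Cmult_plus_distr_l. f_equal.
      transitivity (- (1) * (u ^ k * csum (fun i => gamma i * Bf i u) (S n)))%C; [|ring].
      f_equal. rewrite <- csum_scal. apply csum_ext. intros i Hi. unfold Bf.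
      rewrite (gen_E4_S _ _ _ _ _ _ _ _ G), (gen_E6_S _ _ _ _ _ _ _ _ G),
        (gen_Dl_S _ _ _ _ _ _ _ _ G) by auto.
      rewrite !Cpow_mult_l, <- !Cpow_mult_r.
      replace (u ^ k)%C with (u ^ (4 * (a + 3 * (n - i))) * u ^ (6 * b) * u ^ (12 * (m + i)))%C.
      + ring.
      + rewrite <- !Cpow_add_r. f_equal. unfold n in *. lia.
    (* From q^m to q^l the coefficients agree by the triangular system; below q^m both sides have
       none. *)
    - intros j Hj. rewrite (Hc1 j Hj). destruct (Nat.le_gt_cases m j) as [Hmj|Hmj].
      + set (p := (j - m)%nat). replace j with (m + p)%nat by (unfold p; lia).
        assert (Hp : (p <= n)%nat) by (unfold p, n; lia).
        replace (csum (fun i => gamma i * shift (m + i) (bb i) (m + p)%nat)%C (S n)) with (cone p).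
        * destruct (Nat.eqb_spec (m + p) m) as [E|E].
          -- replace p with O by lia. simpl. ring.
          -- destruct p as [|p']; [lia|]. simpl. ring.
        * rewrite <- (G1 p Hp). symmetry.
          rewrite (csum_eventually_0 _ (S p) (S n)); [|lia|].
          -- apply csum_ext. intros i Hi. unfold shift.
             destruct (Nat.ltb_spec (m + p) (m + i)); [lia|]. f_equal. f_equal. lia.
          -- intros i Hi. unfold shift. destruct (Nat.ltb_spec (m + p) (m + i)); [ring|lia].
      + destruct (Nat.eqb_spec j m); [lia|]. rewrite csum_0; [ring|].
        intros i Hi. unfold shift. destruct (Nat.ltb_spec j (m + i)); [ring|lia]. }
  assert (Vk : 72 <= 18 * V * INR k) by nra.
  assert (Qz : Cmod (qpar z) * (18 * V * INR k) <= rad).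
  { apply (Rmult_le_compat_r (18 * V * INR k)) in Hz; [|lra].
    replace (rad / (18 * V * INR k) * (18 * V * INR k)) with rad in Hz by (field; lra). lra. }
  pose proof (Cmod_ge_0 (qpar z)) as Q0.
  assert (Qr : Cmod (qpar z) <= rad) by nra.
  assert (Qc : V * (Cmod (qpar z) / rad) <= 1 / 4).
  { apply Rmult_le_reg_r with (4 * rad); [lra|].
    replace (V * (Cmod (qpar z) / rad) * (4 * rad)) with (4 * (V * Cmod (qpar z))) by (field; lra).
    assert (0 <= V * Cmod (qpar z)) by nra. nra. }
  assert (E4n : 3 / 4 <= Cmod (E4 z)).
  { pose proof (ps_near_cusp _ _ _ z (gen_E4 _ _ _ _ _ _ _ _ G) Qr) as H.
    rewrite (gen_e4_0 _ _ _ _ _ _ _ _ G), Cmod_minus_sym in H.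
    pose proof (Cmod_minus_ge 1 (E4 z)). rewrite Cmod_1 in H0. lra. }
  assert (E6n : 3 / 4 <= Cmod (E6 z)).
  { pose proof (ps_near_cusp _ _ _ z (gen_E6 _ _ _ _ _ _ _ _ G) Qr) as H.
    rewrite (gen_e6_0 _ _ _ _ _ _ _ _ G), Cmod_minus_sym in H.
    pose proof (Cmod_minus_ge 1 (E6 z)). rewrite Cmod_1 in H0. lra. }
  assert (Dln : Cmod (Dl z / qpar z) <= 5 / 4).
  { pose proof (ps_near_cusp _ _ _ z (gen_Dl _ _ _ _ _ _ _ _ G) Qr) as H. cbn beta in H.
    rewrite (gen_d_0 _ _ _ _ _ _ _ _ G) in H.
    pose proof (Cmod_minus_ge (Dl z / qpar z) 1). rewrite Cmod_1 in H0. lra. }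
  assert (E4z : E4 z <> RtoC 0) by (apply Cmod_gt_0; lra).
  assert (E6z : E6 z <> RtoC 0) by (apply Cmod_gt_0; lra).
  assert (Dlz := gen_Dl_neq_0 _ _ _ _ _ _ _ _ G z Qr).
  set (t := (Dl z / E4 z ^ 3)%C).
  assert (E43 := Cpow_nz _ 3 E4z).
  (* (5/4) / (3/4)^3 = 80/27 is below 3. *)
  assert (Ht : Cmod t <= 3 * Cmod (qpar z)).
  { unfold t. rewrite Cmod_div, Cmod_pow by auto.
    replace (Dl z) with (Dl z / qpar z * qpar z)%C by (field; apply qpar_neq_0). rewrite Cmod_mult.
    assert (27 / 64 <= Cmod (E4 z) ^ 3).
    { replace (27 / 64) with ((3 / 4) ^ 3) by field. apply pow_incr. lra. }
    apply Rmult_le_reg_r with (Cmod (E4 z) ^ 3); [lra|].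
    unfold Rdiv at 1. rewrite Rmult_assoc, Rinv_l by lra. nra. }
  apply (csum_geometric_neq_0 gamma t n G0).
  - intros p Hp. rewrite Cmod_mult, Cmod_pow.
    apply Rle_trans with ((2 * D) ^ p * Cmod t ^ p).
    + apply Rmult_le_compat_r; [apply pow_le, Cmod_ge_0|auto].
    + rewrite <- Rpow_mult_distr. apply pow_incr. pose proof (Cmod_ge_0 t). split; [nra|].
      apply Rle_trans with (2 * D * (3 * Cmod (qpar z))); [nra|].
      unfold D. apply Rmult_le_reg_r with (3 * rad); [lra|].
      replace (2 * (INR k * (V / rad)) * (3 * Cmod (qpar z)) * (3 * rad))
        with (Cmod (qpar z) * (18 * V * INR k)) by (field; lra). lra.
  - assert (Fz : (g z + - (1) * csum (fun i => gamma i * Bf i z) (S n))%C = RtoC 0).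
    { apply (csums_unique _ _ _ (proj2 Hf z Qr)).
      apply (csums_ext (fun n => 0 * qpar z ^ n)%C); [|apply ps_0; auto].
      intros j. cbn beta. now rewrite Vc. }
    rewrite Eg in Fz.
    assert (Bz : Bf O z <> RtoC 0).
    { unfold Bf. repeat apply Cmult_neq_0; now apply Cpow_nz. }
    (* Each increase of i trades a factor E4^3 for Delta, so [Bf i] is [Bf 0] times t^i. *)
    assert (Es : csum (fun i => gamma i * Bf i z)%C (S n) = (Bf O z * csum (fun i => gamma i * t ^ i) (S n))%C).
    { rewrite <- csum_scal. apply csum_ext. intros i Hi. unfold Bf, t, Cdiv.
      rewrite Cpow_mult_l, Cpow_inv, <- Cpow_mult_r by auto.
      rewrite Nat.add_0_r, Nat.sub_0_r, (Cpow_add_r (Dl z)).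
      replace (a + 3 * n)%nat with ((a + 3 * (n - i)) + 3 * i)%nat by lia.
      rewrite (Cpow_add_r (E4 z) (a + 3 * (n - i)) (3 * i)). assert (H3 := Cpow_nz _ (3 * i) E4z). field. auto. }
    rewrite Es in Fz. replace (csum (fun i => gamma i * t ^ i)%C (S n)) with
      (/ Bf O z * (Bf O z * csum (fun i => gamma i * t ^ i) (S n)))%C by (field; auto).
    replace (Bf O z * csum (fun i => gamma i * t ^ i) (S n))%C with
      (- (0 + - (1) * (Bf O z * csum (fun i => gamma i * t ^ i) (S n))))%C by ring.
    rewrite Fz. ring.
Qed.

(** * The height bound *)

Lemma cconst_bounds : 0 < cconst < 1.
Proof.
  unfold cconst. pose proof (exp_pos (2 * PI)) as E0. split; [lra|].
  assert (H : exp (2 * PI) < 1728); [|lra].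
  pose proof PI_bounds as [P1 P2].
  (* 2 pi < 6.3, and exp 0.1 <= 10/9 because 1 - x <= exp(-x). Splitting 63 = 7 * 9 keeps the
     rational powers small. *)
  apply Rlt_trans with (exp (INR 63 * 0.1)).
  - apply exp_increasing. replace (INR 63) with 63 by (rewrite INR_IZR_INZ; reflexivity). lra.
  - rewrite <- exp_pow. change 63%nat with (7 * 9)%nat. rewrite pow_mult.
    assert (X : exp 0.1 <= 10 / 9).
    { pose proof (exp_minus_1_le 0.1). lra. }
    pose proof (exp_pos 0.1).
    assert (Y : exp 0.1 ^ 7 <= 2.1).
    { apply Rle_trans with ((10 / 9) ^ 7); [apply pow_incr; lra|simpl; lra]. }
    apply Rle_lt_trans with (2.1 ^ 9); [|simpl; lra].
    apply pow_incr. split; auto. apply pow_le. lra.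
Qed.

Theorem theoremC :
  exists C0 : R,
    forall (k m : nat), (4 <= k)%nat -> Nat.Even k -> (m <= ell k)%nat ->
    forall (g : C -> C), is_miller_form k m g ->
    forall z : C, in_F z -> g z = RtoC 0 ->
      Im z < 2 * ln (INR k) / (1 - cconst) + C0.
Proof.
  destruct modular_generators_exist as [E4 [E6 [Dl [e4 [e6 [d [d' [V G]]]]]]]].
  pose proof (gen_V _ _ _ _ _ _ _ _ G) as V1.
  (* A zero with Im z >= ln k + C0 would have |q| = exp(-2 pi Im z) below k^(-1) exp(-C0) = [rad] /
     (18 V k), by 2 pi > 1 alone. *)
  exists (ln (18 * V / rad)).
  intros k m Hk Heven Hm g Hg z _ Ez. apply Rnot_le_lt. intros Hz.
  apply (miller_nonvanishing E4 E6 Dl e4 e6 d d' V k m g z G Hk Heven Hm Hg); auto.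
  assert (R0 : 0 < rad) by (unfold rad; lra).
  assert (K4 : 4 <= INR k) by (apply le_INR in Hk; simpl in Hk; lra).
  assert (VR : 1 < 18 * V / rad).
  { unfold rad, Rdiv. rewrite Rinv_inv. lra. }
  assert (L1 : 0 < ln (INR k)) by (rewrite <- ln_1; apply ln_increasing; lra).
  assert (L2 : 0 < ln (18 * V / rad)) by (rewrite <- ln_1; apply ln_increasing; lra).
  pose proof cconst_bounds as [c0 c1]. pose proof PI_bounds as [P1 P2].
  assert (L3 : ln (INR k) <= 2 * ln (INR k) / (1 - cconst)).
  { apply Rmult_le_reg_r with (1 - cconst); [lra|].
    unfold Rdiv. rewrite Rmult_assoc, Rinv_l by lra. nra. }
  rewrite Cmod_qpar.
  replace (rad / (18 * V * INR k)) with (exp (- (ln (INR k) + ln (18 * V / rad)))).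
  - assert (H : - 2 * PI * Im z < - (ln (INR k) + ln (18 * V / rad))) by nra.
    left. now apply exp_increasing.
  - rewrite exp_Ropp, exp_plus, !exp_ln by lra. field. lra.
Qed.
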